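(* For every prime $p\ge5$ and each $r\in\{1,2,3\}$, \[ F_r(q):=\Lambda_p\!\left(\frac{C(q)}{t(q)^{rp}}\right)-\frac{C(q)}{t(q)^r}\equiv0\pmod{p^4}. \] Equivalently, $\delta_{r,s}:=[q^{-r+s}]F_r(q)\equiv0\pmod{p^4}$ for all $1\le s\le r\le3$.
   Context: Let $\chi_3(n)=\left(\frac{n}{3}\right)$, $C(q)=1+\sum_{n\ge1}c_nq^n$ with $c_n=3\sum_{d\mid n}\chi_3(d)d^4$, and $t(q)=q\prod_{n\ge1}(1-q^{3n})^{12}(1-q^n)^{-12}$, so $C/t^j\in\mathbf{Z}((q))$. For a Laurent series $f=\sum_{n\gg-\infty}a_nq^n$, $\Lambda_p(f):=\sum_{n}a_{np}q^n$. A congruence mod $p^4$ of Laurent series means every coefficient of the difference lies in $p^4\mathbf{Z}_{(p)}$. *)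

(* Defs.v *)
From mathcomp Require Import all_boot all_order all_algebra.
Set Implicit Arguments. Unset Strict Implicit. Unset Printing Implicit Defensive.
Import Order.TTheory GRing.Theory Num.Theory.
Local Open Scope ring_scope.

Definition powser (R : Type) := nat -> R.

Definition ps_one (R : comUnitRingType) : powser R := fun n => (n == 0)%:R.

Definition ps_mul (R : comUnitRingType) (f g : powser R) : powser R :=
  fun n => \sum_(i < n.+1) f i * g (n - i)%N.

Definition ps_exp (R : comUnitRingType) (f : powser R) (k : nat) : powser R :=
  iter k (ps_mul f) (ps_one R).

(* The list of the first n coefficients of 1/f, by the recursion
   g_0 = 1/f_0 and g_m = - (1/f_0) * \sum_(i < m) f_(m-i) g_i.
   This is meaningful when f_0 is a unit of R, see ps_mulV. *)
Fixpoint ps_inv_seq (R : comUnitRingType) (f : powser R) (n : nat) : seq R :=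
  if n is m.+1 then
    let s := ps_inv_seq f m in
    rcons s ((f 0%N)^-1 * ((m == 0)%:R - \sum_(i < m) f (m - i)%N * s`_i))
  else [::].

Definition ps_inv (R : comUnitRingType) (f : powser R) : powser R :=
  fun n => (ps_inv_seq f n.+1)`_n.

Fixpoint ps_prodn (R : comUnitRingType) (u : nat -> powser R) (N : nat) :
    powser R :=
  if N is M.+1 then ps_mul (ps_prodn u M) (u M.+1) else ps_one R.

(* The product of u_n over n >= 1, for u_n = 1 + O(q^n): the coefficient of
   q^m is the common one of all partial products with at least m factors,
   see ps_prodE. *)
Definition ps_prod (R : comUnitRingType) (u : nat -> powser R) : powser R :=
  fun m => ps_prodn u m m.

(* 1 - q^k, for k > 0 *)
Definition ps_oneBXn (R : comUnitRingType) (k : nat) : powser R :=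
  fun n => (n == 0)%:R - (n == k)%:R.

(* Laurent v f stands for q^v * f(q). The leading coefficient f_0 may vanish,
   so a Laurent series has several representations: it is only to be observed
   through its coefficients l_coef. *)
Record laurent (R : Type) := Laurent { l_shift : int; l_ser : powser R }.

Definition l_coef (R : comUnitRingType) (f : laurent R) (n : int) : R :=
  if l_shift f <= n then l_ser f `|n - l_shift f|%N else 0.

Definition l_zero (R : comUnitRingType) : laurent R := Laurent 0 (fun=> 0).

Definition l_of_ps (R : comUnitRingType) (f : powser R) : laurent R :=
  Laurent 0 f.

Definition l_mul (R : comUnitRingType) (f g : laurent R) : laurent R :=
  Laurent (l_shift f + l_shift g) (ps_mul (l_ser f) (l_ser g)).

Definition l_exp (R : comUnitRingType) (f : laurent R) (k : nat) : laurent R :=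
  iter k (l_mul f) (l_of_ps (ps_one R)).

(* Meaningful when l_ser f 0 is a unit of R. *)
Definition l_inv (R : comUnitRingType) (f : laurent R) : laurent R :=
  Laurent (- l_shift f) (ps_inv (l_ser f)).

Definition l_div (R : comUnitRingType) (f g : laurent R) : laurent R :=
  l_mul f (l_inv g).

Definition l_sub (R : comUnitRingType) (f g : laurent R) : laurent R :=
  let v := Num.min (l_shift f) (l_shift g) in
  Laurent v (fun k => l_coef f (v + k%:Z) - l_coef g (v + k%:Z)).

(* For p > 0 any shift v with v * p <= l_shift f would do, see l_coef_Lambda. *)
Definition l_Lambda (R : comUnitRingType) (p : nat) (f : laurent R) :
    laurent R :=
  let v := (l_shift f %/ p%:Z)%Z in
  Laurent v (fun k => l_coef f ((v + k%:Z) * p%:Z)).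

(* x lies in Z_(p), for p prime. *)
Definition in_Zloc (p : nat) (x : rat) : bool := ~~ (p%:Z %| denq x)%Z.

Definition in_pZloc (p k : nat) (x : rat) : Prop :=
  exists2 y : rat, in_Zloc p y & x = p%:R ^+ k * y.

Definition l_cong (p k : nat) (f g : laurent int) : Prop :=
  forall n : int, in_pZloc p k (l_coef f n - l_coef g n)%:~R.

(* The Legendre symbol (n / p), for p an odd prime. *)
Definition legendre (n p : nat) : int :=
  if (p %| n)%N then 0
  else if [exists x : 'I_p, x ^ 2 == n %[mod p]]%N then 1 else -1.

Definition chi3 (n : nat) : int := legendre n 3.

Definition c_ (n : nat) : int :=
  3 * \sum_(d <- divisors n) chi3 d * d%:Z ^+ 4.

Definition C : laurent int := l_of_ps (fun n => if n is 0%N then 1 else c_ n).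

(* The leading coefficient of t ^ k is 1 (l_ser_exp_t0), and each factor is
   1 + O(q^n) (t_factorP). *)
Definition t_factor (n : nat) : powser int :=
  ps_mul (ps_exp (ps_oneBXn int (3 * n)) 12)
         (ps_inv (ps_exp (ps_oneBXn int n) 12)).

Definition t : laurent int := Laurent 1 (ps_prod t_factor).

Definition F (p r : nat) : laurent int :=
  l_sub (l_Lambda p (l_div C (l_exp t (r * p)))) (l_div C (l_exp t r)).

Definition delta (p r s : nat) : int := l_coef (F p r) (- r%:Z + s%:Z).

Lemma size_ps_inv_seq (R : comUnitRingType) (f : powser R) n :
  size (ps_inv_seq f n) = n.
Proof. by elim: n => //= n IHn; rewrite size_rcons IHn. Qed.

Lemma nth_ps_inv_seq (R : comUnitRingType) (f : powser R) n i :
  (i < n)%N -> (ps_inv_seq f n)`_i = ps_inv f i.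
Proof.
elim: n => // n IHn; rewrite ltnS leq_eqVlt => /orP[/eqP-> //|lt_in].
by rewrite /= nth_rcons size_ps_inv_seq lt_in IHn.
Qed.

Lemma ps_mulV (R : comUnitRingType) (f : powser R) :
    f 0%N \is a GRing.unit ->
  ps_mul f (ps_inv f) =1 ps_one R.
Proof.
move=> Uf n; rewrite /ps_mul (reindex_inj rev_ord_inj) big_ord_recr /=.
rewrite subSS subnn subn0 {2}/ps_inv /= nth_rcons size_ps_inv_seq ltnn eqxx.
rewrite mulrA mulrV // mul1r.
have ->: \sum_(i < n) f (n.+1 - i.+1)%N * ps_inv f (n - (n.+1 - i.+1))%N
       = \sum_(i < n) f (n - i)%N * (ps_inv_seq f n)`_i.
  apply: eq_bigr => i _.
  by rewrite nth_ps_inv_seq // subSS subKn // ltnW.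
by rewrite addrC subrK.
Qed.

Lemma ps_prodE (R : comUnitRingType) (u : nat -> powser R) m N :
    (forall n i, (i < n)%N -> u n i = ps_one R i) -> (m <= N)%N ->
  ps_prod u m = ps_prodn u N m.
Proof.
move=> u1 le_mN; rewrite -(subnKC le_mN).
elim: (N - m)%N => [|k IHk]; first by rewrite addn0.
rewrite IHk addnS /= /ps_mul big_ord_recr /= subnn u1 // mulr1.
rewrite big1 ?add0r // => i _; rewrite u1; last first.
  by rewrite ltnS (leq_trans (leq_subr _ _)) ?leq_addr.
by rewrite /ps_one subn_eq0 leqNgt ltn_ord mulr0.
Qed.

Definition ps_one_upto (R : comUnitRingType) (n : nat) (f : powser R) : Prop :=
  forall i, (i < n)%N -> f i = ps_one R i.

Lemma ps_one_upto_mul (R : comUnitRingType) n (f g : powser R) :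
  ps_one_upto n f -> ps_one_upto n g -> ps_one_upto n (ps_mul f g).
Proof.
move=> f1 g1 i lt_in; have n_gt0 := leq_ltn_trans (leq0n i) lt_in.
rewrite /ps_mul big_ord_recl f1 // subn0 g1 // mul1r -[RHS]addr0.
congr (_ + _); apply: big1 => j _.
by rewrite f1 ?mul0r //= (leq_ltn_trans _ lt_in).
Qed.

Lemma ps_one_upto_exp (R : comUnitRingType) n (f : powser R) k :
  ps_one_upto n f -> ps_one_upto n (ps_exp f k).
Proof. by move=> f1; elim: k => //= k IHk; apply: ps_one_upto_mul. Qed.

Lemma ps_one_upto_inv (R : comUnitRingType) n (f : powser R) :
  ps_one_upto n f -> ps_one_upto n (ps_inv f).
Proof.
move=> f1 i lt_in.
have f0 : f 0%N = 1 by rewrite f1 // (leq_ltn_trans _ lt_in).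
have Uf : f 0%N \is a GRing.unit by rewrite f0 unitr1.
rewrite -(ps_mulV Uf) /ps_mul big_ord_recl f0 mul1r subn0 -[LHS]addr0.
congr (_ + _); apply/esym/big1 => j _.
by rewrite f1 ?mul0r //= (leq_ltn_trans _ lt_in).
Qed.

Lemma ps_one_upto_oneBXn (R : comUnitRingType) n k :
  (n <= k)%N -> ps_one_upto n (ps_oneBXn R k).
Proof.
move=> le_nk i lt_in; rewrite /ps_oneBXn (ltn_eqF (leq_trans lt_in le_nk)).
exact: subr0.
Qed.

Lemma t_factorP n : ps_one_upto n (t_factor n).
Proof.
apply: ps_one_upto_mul; first apply: ps_one_upto_exp.
  by apply: ps_one_upto_oneBXn; rewrite leq_pmull.
by apply/ps_one_upto_inv/ps_one_upto_exp/ps_one_upto_oneBXn.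
Qed.

Lemma l_ser_exp_t0 k : l_ser (l_exp t k) 0%N = 1.
Proof.
elim: k => [|k IHk] //=.
by rewrite /ps_mul big_ord_recl big_ord0 addr0 subn0 IHk mulr1.
Qed.

Lemma l_coef_sub (R : comUnitRingType) (f g : laurent R) n :
  l_coef (l_sub f g) n = l_coef f n - l_coef g n.
Proof.
rewrite {1}/l_coef /=; case: (boolP (Num.min _ _ <= n)) => [le_vn|].
  by rewrite gez0_abs ?subr_ge0 // subrKC.
rewrite ge_min negb_or => /andP[Nf Ng].
by rewrite /l_coef (negPf Nf) (negPf Ng) subr0.
Qed.

Lemma l_coef_Lambda (R : comUnitRingType) (p : nat) (f : laurent R) n :
  (0 < p)%N -> l_coef (l_Lambda p f) n = l_coef f (n * p%:Z).
Proof.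
move=> p_gt0; rewrite {1}/l_coef /=; case: (boolP (_ <= n)) => [le_vn|].
  by rewrite gez0_abs ?subr_ge0 // subrKC.
rewrite -ltNge => lt_nv; rewrite /l_coef ifF //; apply/negbTE.
apply: contraL lt_nv; rewrite -leNgt => le_fn.
rewrite -(@mulzK n p%:Z) ?eqz_nat -?lt0n //.
exact: lez_pdiv2r.
Qed.

(* Main.v *)
(** C is the Eisenstein series of weight 5 for Gamma_0(3) and chi3 that is 1 at infinity
    and 0 at the cusp 0, and t is a Hauptmodul with its zero at infinity and its pole at 0.
    Hence the form f = C / t^(r p) and its Hecke image Lambda_p f + chi3(p) p^4 f(q^p), whose
    pole has order r p^2, have poles at infinity only. Subtracting an integral combination of
    the C / t^k, r <= k <= r p^2, leaves a form D of order >= 1 - r at infinity, whose image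
    D* under the Fricke involution has order >= r + 1. Let A and B be the Eisenstein series
    of weight 3 with A / B = t, which have no zeros in the upper half plane. Then
    (D D* )^3 / (A B)^5 is a holomorphic function, invariant under the Fricke involution and
    under translation, that vanishes at infinity, so it is 0, and D = 0. Modulo p^4 this
    equates Lambda_p f with a combination of the C / t^k, k >= r, and comparing principal
    parts leaves only C / t^r.

    The Fricke involution is understood through Lipschitz' formula, which turns the
    q-expansions of the Eisenstein series into lattice sums. The product t is compared with
    A / B through logarithmic derivatives; those of A and B come from Lambert series
    identities proved by Liouville's elementary method. *)
Require Import Defs.
From HB Require Import structures.
From mathcomp Require Import all_boot all_order all_algebra.
From mathcomp Require Import boolp classical_sets reals.
From mathcomp Require Import topology normedtype sequences derive realfun exp trigo.
From mathcomp Require Import complex.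
From mathcomp Require Import ring lra zify.
Set Implicit Arguments. Unset Strict Implicit. Unset Printing Implicit Defensive.
Import Order.TTheory GRing.Theory Num.Theory.
Local Open Scope ring_scope.

Notation normc := ComplexField.Normc.normc.
Notation Re := complex.Re.
Notation Im := complex.Im.

(** * Formal power series *)

(** Translations and the Fricke involution already move every point of the upper half plane to
    height at least 1/5, so the quotient has a single cusp, and a function invariant under both
    needs no valence formula: it is bounded, and if it vanishes at infinity, Schwarz' lemma improves
    any bound by a fixed factor, as often as desired. Cauchy's estimate is replaced by averages over
    roots of unity, so no contour integral occurs. The involution does not map D to a multiple of
    itself, hence the product D D*. The exponents 3 and 5 balance the weights, 3 (5 + 5) = 5 (3 +
    3), and leave a positive order at infinity, 3 ((1 - r) + (r + 1)) - 5 = 1. Invariance under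
    Gamma_0(3) serves only the Hecke operator, whose terms are permuted by the Fricke involution up
    to elements of this group. That A and B have no zeros is read off from their logarithmic
    derivatives: the formal inverse solves a linear equation as well, and therefore converges on the
    whole disc. *)

Definition fps (R : Type) := nat -> R.

HB.instance Definition _ (R : Type) := gen_eqMixin (fps R).
HB.instance Definition _ (R : Type) := gen_choiceMixin (fps R).

Section FpsRing.
Variable R : comNzRingType.
Implicit Types f g h : fps R.

Definition fps_zero : fps R := fun=> 0.
Definition fps_opp f : fps R := fun n => - f n.
Definition fps_add f g : fps R := fun n => f n + g n.
Definition fps_one : fps R := fun n => (n == 0)%:R.
Definition fps_mul f g : fps R := fun n => \sum_(i < n.+1) f i * g (n - i)%N.

Lemma fps_addA : associative fps_add.
Proof. by move=> f g h; apply/funext => n; apply: addrA. Qed.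
Lemma fps_addC : commutative fps_add.
Proof. by move=> f g; apply/funext => n; apply: addrC. Qed.
Lemma fps_add0 : left_id fps_zero fps_add.
Proof. by move=> f; apply/funext => n; apply: add0r. Qed.
Lemma fps_addN : left_inverse fps_zero fps_opp fps_add.
Proof. by move=> f; apply/funext => n; apply: addNr. Qed.

HB.instance Definition _ :=
  GRing.isZmodule.Build (fps R) fps_addA fps_addC fps_add0 fps_addN.

Definition fps_trunc N f : {poly R} := \poly_(i < N) f i.

(** A coefficient of a product involves only finitely many coefficients of the factors. The ring
    axioms for series are thereby inherited from polynomials. *)
Lemma fps_mul_trunc N f g n : (n < N)%N ->
  fps_mul f g n = (fps_trunc N f * fps_trunc N g)`_n.
Proof.
move=> nN; rewrite coefM; apply: eq_bigr => i _.
by rewrite !coef_poly (leq_ltn_trans (leq_subr _ _) nN) (leq_trans (ltn_ord i) nN).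
Qed.

Lemma fps_mulA : associative fps_mul.
Proof.
move=> f g h; apply/funext => n.
transitivity ((fps_trunc n.+1 f * fps_trunc n.+1 g * fps_trunc n.+1 h)`_n).
  rewrite -mulrA coefM; apply: eq_bigr => i _.
  have ni: (n - i < n.+1)%N by rewrite ltnS leq_subr.
  by rewrite coef_poly ltn_ord -(fps_mul_trunc g h ni).
rewrite coefM; apply: eq_bigr => i _.
by rewrite -(fps_mul_trunc f g (ltn_ord i)) coef_poly ltnS leq_subr.
Qed.

Lemma fps_mulC : commutative fps_mul.
Proof. by move=> f g; apply/funext => n; rewrite !(@fps_mul_trunc n.+1)// mulrC. Qed.

Lemma fps_mul1 : left_id fps_one fps_mul.
Proof.
move=> f; apply/funext => n; rewrite /fps_mul big_ord_recl mul1r subn0 big1 ?addr0//.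
by move=> i _; rewrite /fps_one/= mul0r.
Qed.

Lemma fps_mulD : left_distributive fps_mul fps_add.
Proof.
move=> f g h; apply/funext => n; rewrite /fps_mul /fps_add -big_split.
by apply: eq_bigr => i _; rewrite mulrDl.
Qed.

Lemma fps_one_neq0 : fps_one != fps_zero.
Proof. by apply/eqP => /(congr1 (@^~ 0%N)) /eqP; rewrite oner_eq0. Qed.

HB.instance Definition _ := GRing.Zmodule_isComNzRing.Build (fps R)
  fps_mulA fps_mulC fps_mul1 fps_mulD fps_one_neq0.

Lemma fpsD f g n : (f + g) n = f n + g n. Proof. by []. Qed.
Lemma fpsN f n : (- f) n = - f n. Proof. by []. Qed.
Lemma fpsB f g n : (f - g) n = f n - g n. Proof. by []. Qed.
Lemma fpsM f g n : (f * g) n = \sum_(i < n.+1) f i * g (n - i)%N.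
Proof. by []. Qed.
Lemma fps1 n : (1 : fps R) n = (n == 0)%:R. Proof. by []. Qed.
Lemma fps0 n : (0 : fps R) n = 0. Proof. by []. Qed.
Lemma fpsM0 f g : (f * g) 0%N = f 0%N * g 0%N.
Proof. by rewrite fpsM big_ord1. Qed.
Lemma fpsX0 f k : (f ^+ k) 0%N = f 0%N ^+ k.
Proof. by elim: k => [|k IH]; rewrite ?expr0// exprS fpsM0 IH exprS. Qed.
Lemma fps_sum I (r : seq I) (P : pred I) (F : I -> fps R) n :
  (\sum_(i <- r | P i) F i) n = \sum_(i <- r | P i) F i n.
Proof.
by apply: (big_morph (fun f : fps R => f n)); [move=> f g; rewrite fpsD|].
Qed.
Lemma fpsMn f k n : (f *+ k) n = f n *+ k.
Proof. by elim: k => // k IH; rewrite !mulrS fpsD IH. Qed.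

Lemma fps_natM k f n : ((k%:R : fps R) * f) n = k%:R * f n.
Proof. by rewrite !mulr_natl fpsMn. Qed.

Definition fpsC (c : R) : fps R := fun n => if n is 0%N then c else 0.
Lemma fpsCM c f n : (fpsC c * f) n = c * f n.
Proof. by rewrite fpsM big_ord_recl/= subn0 big1 ?addr0// => i _; rewrite mul0r. Qed.

Definition fpsXn k : fps R := fun n => (n == k)%:R.
Lemma fpsXnM k f n : (fpsXn k * f) n = if (k <= n)%N then f (n - k)%N else 0.
Proof.
rewrite fpsM; case: leqP => kn.
  rewrite (bigD1 (Ordinal (kn : (k < n.+1)%N)))//= {1}/fpsXn eqxx mul1r big1 ?addr0//.
  by move=> i; rewrite -val_eqE /fpsXn/= => /negPf->; rewrite mul0r.
rewrite big1// => i _; rewrite /fpsXn; case: eqP => [ik|]; last by rewrite mul0r.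
by move: (ltn_ord i); rewrite ik ltnS leqNgt kn.
Qed.
Lemma fpsXnD k l : fpsXn (k + l)%N = fpsXn k * fpsXn l.
Proof.
apply/funext => n; rewrite fpsXnM /fpsXn.
case: leqP => kn; first by congr (_%:R); lia.
by rewrite [n == _]ltn_eqF//; lia.
Qed.
Lemma fpsXnX k l : fpsXn k ^+ l = fpsXn (k * l)%N.
Proof. by elim: l => [|l IH]; [rewrite muln0|rewrite exprS IH -fpsXnD mulnS]. Qed.

Lemma fps_shiftE f k : (forall i, (i < k)%N -> f i = 0) ->
  f = fpsXn k * (fun n => f (n + k)%N).
Proof.
move=> f0; apply/funext => n; rewrite fpsXnM; case: leqP => [kn|/f0//].
by rewrite subnK.
Qed.

Lemma fpsXn_inj k f g : fpsXn k * f = fpsXn k * g -> f = g.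
Proof.
move=> E; apply/funext => n; have := congr1 (@^~ (n + k)%N) E.
by rewrite /= !fpsXnM leq_addl addnK.
Qed.

(** The derivation q d/dq, which does not shift exponents. *)
Definition fps_deriv f : fps R := fun n => n%:R * f n.
Local Notation D := fps_deriv.

Lemma fps_derivM f g : D (f * g) = D f * g + f * D g.
Proof.
apply/funext => n; rewrite fpsD {1}/fps_deriv !fpsM mulr_sumr -big_split.
apply: eq_bigr => i _; rewrite /fps_deriv /=.
rewrite -{1}(subnK (ltnSE (ltn_ord i))) natrD; ring.
Qed.
Lemma fps_deriv1 : D 1 = 0.
Proof. by apply/funext => -[|n]; rewrite /fps_deriv fps1 ?mul0r ?mulr0. Qed.
Lemma fps_derivX f k : D (f ^+ k.+1) = k.+1%:R * f ^+ k * D f.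
Proof.
elim: k => [|k IH]; first by rewrite expr1 expr0 !mul1r.
rewrite exprS fps_derivM IH exprS -[k.+2%:R]natr1; move: (k.+1%:R) (f ^+ k) => u v; ring.
Qed.
Lemma fps_derivXn k : D (fpsXn k) = k%:R * fpsXn k.
Proof.
by apply/funext => n; rewrite fps_natM /fps_deriv /fpsXn; case: eqP => [->//|_]; rewrite !mulr0.
Qed.

(** The operators U_p and V_p. The Hecke operator of weight 5 and character [chi3] is U_p + chi3(p)
    p^4 V_p. *)
Definition fps_Lam p f : fps R := fun n => f (n * p)%N.
Definition fps_V p f : fps R := fun n => if (p %| n)%N then f (n %/ p)%N else 0.

End FpsRing.

Notation fpsX := fpsXn.

Section FpsDomain.
Variable R : idomainType.

Lemma fps_mul_eq0 (f g : fps R) : f * g = 0 -> f = 0 \/ g = 0.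
Proof.
move=> fg0; case: (pselect (f = 0)) => [->|f0]; [by left|right].
have [i fi] : exists i, f i != 0.
  by apply: contrapT => /forallNP F; apply: f0; apply/funext => i; apply/eqP/negPn/negP/F.
pose m := ex_minn (ex_intro _ i fi : exists i, f i != 0).
have [fm mmin] : f m != 0 /\ forall j, (j < m)%N -> f j = 0.
  rewrite /m; case: ex_minnP => k fk kmin; split=> // j jk.
  by apply: contraTeq jk => /kmin; rewrite -leqNgt.
apply/funext; elim/ltn_ind => n IH.
have := congr1 (@^~ (n + m)%N) fg0; rewrite /= fpsM fps0.
have mn : (m < (n + m).+1)%N by rewrite ltnS leq_addl.
rewrite (bigD1 (Ordinal mn))//= addnK big1 => [|j /eqP jm].
  by rewrite addr0 => /eqP; rewrite mulf_eq0 (negPf fm)/= => /eqP.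
have [jm'|mj] := ltnP j m; first by rewrite mmin ?mul0r.
rewrite IH ?mulr0//.
have : (m != j :> nat)%N by apply/eqP => E; apply: jm; apply: val_inj.
by have := ltn_ord j; lia.
Qed.

(** As s has no constant term, coefficient n + 1 of s f involves only the coefficients of f up to n,
    so the equation determines n + 1 times the next coefficient. *)
Lemma fps_ode_uniq (s f g : fps R) : (forall n, n.+1%:R != 0 :> R) -> s 0%N = 0 ->
  fps_deriv f = s * f -> fps_deriv g = s * g -> f 0%N = g 0%N -> f = g.
Proof.
move=> nz s0 Df Dg fg0; apply/funext; elim/ltn_ind => -[//|n] IH.
apply: (mulfI (nz n)).
rewrite -[LHS]/(fps_deriv f n.+1) -[RHS]/(fps_deriv g n.+1) Df Dg !fpsM.
apply: eq_bigr => -[[|i] ip] _; rewrite ?s0 ?mul0r// IH//=; lia.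
Qed.
End FpsDomain.

Section FpsUnit.
Variable R : comUnitRingType.
Implicit Types f g : fps R.

Lemma ps_mulE (f g : powser R) : ps_mul f g = (f : fps R) * g. Proof. by []. Qed.
Lemma ps_expE (f : powser R) k : ps_exp f k = (f : fps R) ^+ k.
Proof. by elim: k => [|k IH]//; rewrite exprS -IH. Qed.
Lemma ps_mulV1 f : f 0%N = 1 -> f * (ps_inv f : fps R) = 1.
Proof. by move=> f0; apply/funext/ps_mulV; rewrite f0 unitr1. Qed.
End FpsUnit.

(** * Lambert series and the product t *)

Lemma chi3E n : chi3 n = [:: 0; 1; -1]`_(n %% 3).
Proof.
rewrite /chi3 /legendre /dvdn; have := ltn_pmod n (isT : 0 < 3)%N.
case: (n %% 3)%N (modn_mod n 3) => [|[|[|//]]] //= E _.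
  by case: existsP => // -[]; exists (inord 1); rewrite inordK// -[(n %% 3)%N]E.
by case: existsP => // -[[[|[|[|//]]] ? /=]]; rewrite -E.
Qed.

(** The Lambert series of [phi], that is, the double sum of [phi a x] q^(a x) over a, x >= 1. Every
    solution of a x = n lies in the box a, x <= n. *)
Definition lam (phi : nat -> nat -> int) : fps int := fun n =>
  \sum_(1 <= a < n.+1) \sum_(1 <= x < n.+1) if (a * x == n)%N then phi a x else 0.

Lemma lam_wide phi n N : (n <= N)%N -> lam phi n =
  \sum_(1 <= a < N.+1) \sum_(1 <= x < N.+1) if (a * x == n)%N then phi a x else 0.
Proof.
move=> nN; rewrite (big_cat_nat _ (n := n.+1))//= [X in _ + X]big1_seq ?addr0; last first.
  move=> a; rewrite mem_index_iota => /andP[_ /andP[na _]].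
  rewrite big1_seq// => x; rewrite mem_index_iota => /andP[_ /andP[x1 _]].
  by case: eqP => // E; nia.
apply: eq_big_nat => a /andP[a1 _].
rewrite [RHS](big_cat_nat _ (n := n.+1))//= [X in _ + X]big1_seq ?addr0// => x.
rewrite mem_index_iota => /andP[_ /andP[nx _]].
by case: eqP => // E; nia.
Qed.

Lemma lam0 phi : lam phi 0%N = 0. Proof. by rewrite /lam big_geq. Qed.

Lemma lam_dvd phi n : lam phi n =
  \sum_(1 <= a < n.+1) if (a %| n)%N then phi a (n %/ a)%N else 0.
Proof.
apply: eq_big_nat => a /andP[a1 an].
case: ifP => [/dvdnP[k nE]|ndv]; last first.
  apply: big1 => x _; case: eqP => // E; move: ndv; rewrite -E dvdn_mulr//.
have n0 : (0 < n)%N by lia.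
rewrite nE mulnK// (bigD1_seq k) ?iota_uniq ?mem_index_iota//=; last by nia.
rewrite mulnC eqxx big1 ?addr0// => x xk; case: eqP => // E; nia.
Qed.

Lemma lam_divisors phi n : (0 < n)%N ->
  \sum_(d <- divisors n) phi d (n %/ d)%N = lam phi n.
Proof.
move=> n0; rewrite lam_dvd -big_mkcond -[RHS]big_filter; apply: perm_big.
apply: uniq_perm; rewrite ?divisors_uniq ?filter_uniq ?iota_uniq// => d.
rewrite -dvdn_divisors// mem_filter mem_index_iota; case: (boolP (d %| n)%N) => //= dn.
by have := dvdn_gt0 n0 dn; have := dvdn_leq n0 dn; lia.
Qed.

Lemma lam_swap phi : lam phi = lam (fun a x => phi x a).
Proof.
apply/funext => n; rewrite /lam exchange_big/=; apply: eq_bigr => a _.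
by apply: eq_bigr => x _; rewrite mulnC.
Qed.

Lemma lamZ c phi n : c * lam phi n = lam (fun a x => c * phi a x) n.
Proof.
rewrite /lam mulr_sumr; apply: eq_bigr => a _; rewrite mulr_sumr.
by apply: eq_bigr => x _; case: ifP; rewrite ?mulr0.
Qed.

Lemma eq_lam phi psi : (forall a x, (0 < a)%N -> (0 < x)%N -> phi a x = psi a x) ->
  lam phi = lam psi.
Proof.
move=> E; apply/funext => n; apply: eq_big_nat => a /andP[a0 _].
by apply: eq_big_nat => x /andP[x0 _]; rewrite E.
Qed.

(** The expansion of k q^k / (1 - q^k), which is minus the logarithmic derivative of 1 - q^k. *)
Definition logser (k : nat) : fps int := fun n => if (0 < n)%N && (k %| n)%N then k%:R else 0.

Lemma logserP k : (0 < k)%N -> (1 - fpsX int k) * logser k = k%:R * fpsX int k.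
Proof.
move=> k0; rewrite mulrBl mul1r; apply/funext => n.
rewrite fpsB fpsXnM fps_natM /logser /fpsXn.
case: (leqP k n) => kn.
  rewrite dvdn_subl//; have -> : (0 < n)%N by lia.
  case: (eqVneq n k) => [->|nk]; first by rewrite dvdnn subnn subr0 mulr1.
  have -> : (0 < n - k)%N by lia.
  by case: ifP; rewrite subrr mulr0.
rewrite subr0 (ltn_eqF kn) mulr0; case: ifP => // /andP[n0 /(dvdn_leq n0)]; lia.
Qed.

Lemma oneBXnE k : (0 < k)%N -> ps_oneBXn int k = 1 - fpsX int k.
Proof. by []. Qed.

Lemma deriv_oneBXn k : (0 < k)%N ->
  fps_deriv (1 - fpsX int k) = - ((1 - fpsX int k) * logser k).
Proof.
move=> k0; rewrite logserP// -fps_derivXn; apply/funext => -[|n].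
  by rewrite /fps_deriv !mul0r fpsN /fps_deriv mul0r oppr0.
by rewrite fpsN /fps_deriv fpsB fps1 sub0r mulrN.
Qed.

Lemma fps_derivX_log (f s : fps int) k :
  fps_deriv f = s * f -> fps_deriv (f ^+ k) = (k%:R * s) * f ^+ k.
Proof.
move=> Df; case: k => [|k]; first by rewrite fps_deriv1 !mul0r.
by rewrite fps_derivX Df exprSr -!mulrA [X in _ * X]mulrCA.
Qed.

Lemma fps_derivM_log (f g s u : fps int) :
  fps_deriv f = s * f -> fps_deriv g = u * g -> fps_deriv (f * g) = (s + u) * (f * g).
Proof. by move=> Df Dg; rewrite fps_derivM Df Dg; ring. Qed.

Lemma fps_derivV_log (f g s : fps int) :
  f * g = 1 -> fps_deriv f = s * f -> fps_deriv g = - s * g.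
Proof.
move=> fg1 Df; have := congr1 (@fps_deriv int) fg1.
rewrite fps_derivM fps_deriv1 Df => E.
transitivity (g * (s * f * g + f * fps_deriv g) - s * g * (f * g) + (1 - f * g) * fps_deriv g).
  by ring.
by rewrite E fg1; ring.
Qed.

Lemma deriv_t_factor n : (0 < n)%N ->
  fps_deriv (t_factor n) = (12%:R * (logser n - logser (3 * n)%N)) * (t_factor n : fps int).
Proof.
move=> n0; have n3 : (0 < 3 * n)%N by rewrite muln_gt0.
have Dl k : (0 < k)%N -> fps_deriv (1 - fpsX int k) = - logser k * (1 - fpsX int k).
  by move=> k0; rewrite deriv_oneBXn// mulrC mulNr.
rewrite /t_factor ps_mulE !ps_expE !oneBXnE//.
have b0 : ((1 - fpsX int n) ^+ 12) 0%N = 1.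
  by rewrite fpsX0 fpsB fps1 /fpsXn/= (ltn_eqF n0) subr0 expr1n.
have Da := fps_derivX_log 12 (Dl _ n3).
have Dv := fps_derivV_log (ps_mulV1 b0) (fps_derivX_log 12 (Dl _ n0)).
rewrite (fps_derivM_log Da Dv); congr (_ * _).
by rewrite !mulrN opprK mulrBr addrC.
Qed.

(** The series [t] without its factor q, hence with constant term 1. *)
Definition ty : fps int := ps_prod t_factor.

Lemma ty0 : ty 0%N = 1. Proof. by []. Qed.

Lemma deriv_t_prodn N : fps_deriv (ps_prodn t_factor N : fps int) =
  (\sum_(1 <= n < N.+1) 12%:R * (logser n - logser (3 * n)%N)) * (ps_prodn t_factor N : fps int).
Proof.
elim: N => [|N IH]; first by rewrite big_geq// mul0r [LHS]fps_deriv1.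
rewrite /= ps_mulE fps_derivM IH deriv_t_factor// [in RHS]big_nat_recr//=.
have E (P T s S : fps int) : S * P * T + P * (s * T) = (S + s) * (P * T) by ring.
exact: E.
Qed.

(** The logarithmic derivative of [ty]. The factors 1 - q^(3 n) of the numerator cancel the terms of
    the denominator whose index is a multiple of 3. *)
Definition tlog : fps int := lam (fun a _ => if (3 %| a)%N then 0 else 12%:R * a%:R).

Lemma tlog_prodn N m : (m <= N)%N ->
  (\sum_(1 <= n < N.+1) 12%:R * (logser n - logser (3 * n)%N)) m = tlog m.
Proof.
move=> mN; rewrite fps_sum.
case: m mN => [|m] mN.
  rewrite /tlog lam0 big1// => n _; rewrite fps_natM fpsB /logser subrr mulr0//.
under eq_bigr do rewrite fps_natM fpsB mulrBr.
rewrite sumrB /tlog lam_dvd.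
have -> : \sum_(1 <= n < N.+1) 12%:R * logser n m.+1 =
   \sum_(1 <= a < m.+2) if (a %| m.+1)%N then 12%:R * a%:R else 0.
  rewrite (big_cat_nat _ (n := m.+2))//= [X in _ + X]big1_seq ?addr0 => [|a]; last first.
    rewrite mem_index_iota /logser/= => /andP[ma _].
    by case: ifP => [/dvdn_leq|]; [lia|rewrite mulr0].
  by apply: eq_bigr => a _; rewrite /logser/=; case: ifP; rewrite ?mulr0.
have -> : \sum_(1 <= n < N.+1) 12%:R * logser (3 * n) m.+1 =
   \sum_(1 <= a < m.+2) if (3 %| a)%N && (a %| m.+1)%N then 12%:R * a%:R else 0.
  rewrite -[RHS]big_mkcond /= -[RHS]big_filter.
  transitivity (\sum_(i <- [seq n <- index_iota 1 N.+1 | (3 * n %| m.+1)%N]) 12%:R * (3 * i)%:R : int).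
    rewrite big_filter [RHS]big_mkcond; apply: eq_bigr => a _.
    by rewrite /logser/=; case: ifP; rewrite ?mulr0.
  rewrite -(big_map (muln 3) predT (fun i => 12%:R * i%:R : int)); apply: perm_big.
  apply: uniq_perm.
  - rewrite map_inj_uniq ?filter_uniq ?iota_uniq// => x y; lia.
  - by rewrite filter_uniq ?iota_uniq.
  move=> a; rewrite mem_filter mem_index_iota; apply/mapP/idP.
    case=> b; rewrite mem_filter mem_index_iota => /andP[b3 /andP[b1 bN]] ->.
    rewrite b3 dvdn_mulr//=; have := dvdn_leq (isT : (0 < m.+1)%N) b3; lia.
  move=> /andP[/andP[/dvdnP[b aE] am] /andP[a1 aN]]; exists b; last by lia.
  rewrite mem_filter mem_index_iota; rewrite mulnC -aE am/=; lia.
rewrite -sumrB; apply: eq_bigr => a _.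
by case: (boolP (3 %| a)%N) => _; case: ifP => _; rewrite ?subrr ?subr0.
Qed.

Lemma ty_ode : fps_deriv ty = tlog * ty.
Proof.
have U n i : (i < n)%N -> t_factor n i = ps_one _ i by move=> /t_factorP.
apply/funext => n.
have E m : (m <= n)%N -> ty m = ps_prodn t_factor n m by apply: ps_prodE.
rewrite /fps_deriv E// -[LHS]/(fps_deriv (ps_prodn t_factor n) n) deriv_t_prodn !fpsM.
apply: eq_bigr => i _; rewrite (tlog_prodn (ltnSE (ltn_ord i))); congr (_ * _).
by rewrite -(E _ (leq_subr _ _)).
Qed.

(** * Convolutions of Lambert series *)

Definition box2 (n : nat) := [seq (a, b) | a <- iota 1 n, b <- iota 1 n].
Definition pairs2 (n : nat) := [seq u <- box2 n | u.1 * u.2 == n]%N.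
(** The solutions of a x + b y = n in positive integers, stored as ((a, b), (x, y)). They index the
    coefficient of q^n in a product of two Lambert series, see [lamM]. *)
Definition quads (n : nat) :=
  [seq q <- [seq (u, v) | u <- box2 n, v <- box2 n] |
    q.1.1 * q.2.1 + q.1.2 * q.2.2 == n]%N.

Lemma mem_box2 n a b : ((a, b) \in box2 n) = [&& 0 < a, a <= n, 0 < b & b <= n]%N.
Proof.
apply/allpairsP/idP => [[[a' b']/= [+ + [-> ->]]]|/and4P[a0 an b0 bn]].
  by rewrite !mem_iota; lia.
by exists (a, b); rewrite /= !mem_iota; split=> //; lia.
Qed.

Lemma box2_uniq n : uniq (box2 n).
Proof. by apply: allpairs_uniq; rewrite ?iota_uniq// => -[? ?] [? ?]. Qed.

Lemma mem_pairs2 n a b : ((a, b) \in pairs2 n) = [&& 0 < a, 0 < b & a * b == n]%N.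
Proof. by rewrite mem_filter mem_box2 /=; nia. Qed.

Lemma pairs2_uniq n : uniq (pairs2 n).
Proof. by rewrite filter_uniq ?box2_uniq. Qed.

Lemma mem_quads n a b x y : (((a, b), (x, y)) \in quads n) =
  [&& 0 < a, 0 < b, 0 < x, 0 < y & a * x + b * y == n]%N.
Proof.
rewrite mem_filter /= andbC; apply/andP/idP => [[/allpairsP[[u v]/= [+ + E]] e]|].
  by case: E => <- <-; rewrite !mem_box2; lia.
move=> /and5P[a0 b0 x0 y0 /eqP e]; rewrite e; split=> //.
apply/allpairsP; exists ((a, b), (x, y)); rewrite !mem_box2/=.
by split=> //; nia.
Qed.

Lemma quads_uniq n : uniq (quads n).
Proof.
by rewrite filter_uniq// allpairs_uniq ?box2_uniq// => -[? ?] [? ?].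
Qed.

Lemma lam_pairs2 phi n : lam phi n = \sum_(u <- pairs2 n) phi u.1 u.2.
Proof.
rewrite big_filter big_mkcond big_allpairs /lam /index_iota subSS subn0.
by apply: eq_bigr => a _; apply: eq_bigr.
Qed.

Lemma lamM phi psi n : (lam phi * lam psi) n =
  \sum_(q <- quads n) phi q.1.1 q.2.1 * psi q.1.2 q.2.2.
Proof.
rewrite big_filter big_mkcond big_allpairs /= /box2 big_allpairs /=.
rewrite fpsM; under [LHS]eq_bigr => i _.
  rewrite (lam_wide _ (ltnSE (ltn_ord i))) (lam_wide _ (leq_subr i n)) mulr_suml.
  under eq_bigr do rewrite mulr_sumr.
  over.
rewrite exchange_big /= /index_iota subSS subn0; apply: eq_bigr => a _.
rewrite exchange_big /=; apply: eq_bigr => b _.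
rewrite big_allpairs.
under eq_bigr do rewrite mulr_suml.
rewrite exchange_big /=; apply: eq_bigr => x _.
under eq_bigr do rewrite mulr_sumr.
rewrite exchange_big /=; apply: eq_bigr => y _ /=.
case: eqP => [e|ne].
  have an : (a * x < n.+1)%N by lia.
  rewrite (bigD1 (Ordinal an))//= eqxx big1 ?addr0; last first.
    by move=> i; rewrite -val_eqE/= eq_sym => /negPf->; rewrite mul0r.
  by have -> : (b * y == n - a * x)%N by lia.
rewrite big1// => i _; case: eqP => [ai|]; last by rewrite mul0r.
by case: eqP => [bi|]; [have := ltn_ord i; lia|rewrite mulr0].
Qed.

Definition qswap (q : (nat * nat) * (nat * nat)) := ((q.1.2, q.1.1), (q.2.2, q.2.1)).

Lemma sum_qswap n (P : pred _) (F : _ -> int) :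
  \sum_(q <- quads n | P q) F q = \sum_(q <- quads n | P (qswap q)) F (qswap q).
Proof.
rewrite -(big_map qswap P F); apply: perm_big; apply: uniq_perm; rewrite ?quads_uniq//.
  by rewrite map_inj_uniq ?quads_uniq// => -[[? ?] [? ?]] [[? ?] [? ?]] [-> -> -> ->].
move=> [[a b] [x y]]; apply/idP/mapP => [|[[[a' b'] [x' y']] + [-> -> -> ->]]].
  by rewrite mem_quads => e; exists ((b, a), (y, x)); rewrite ?mem_quads//; lia.
by rewrite !mem_quads; lia.
Qed.

Lemma sum_qslide n (F : _ -> int) :
  \sum_(q <- quads n | (q.2.2 < q.2.1)%N) F q =
  \sum_(q <- quads n | (q.1.1 < q.1.2)%N)
     F ((q.1.1, q.1.2 - q.1.1), (q.2.1 + q.2.2, q.2.2))%N.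
Proof.
pose h (q : (nat * nat) * (nat * nat)) :=
   ((q.1.1, q.1.2 - q.1.1), (q.2.1 + q.2.2, q.2.2))%N.
rewrite -[LHS]big_filter -[RHS]big_filter -(big_map h predT F); apply: perm_big.
apply: uniq_perm; first exact: filter_uniq (quads_uniq n).
  rewrite map_inj_in_uniq; first exact: filter_uniq (quads_uniq n).
  move=> [[? ?] [? ?]] [[? ?] [? ?]]; rewrite !mem_filter/= => /andP[? _] /andP[? _].
  by case=> ? ? ? ?; congr ((_, _), (_, _)); lia.
move=> [[a b] [x y]]; rewrite mem_filter; apply/idP/mapP => /=.
  rewrite mem_quads => /and5P[xy a0 b0 x0 /andP[y0 e]].
  exists ((a, a + b), (x - y, y))%N; last by rewrite /h/=; congr ((_, _), (_, _)); lia.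
  by rewrite mem_filter mem_quads/=; nia.
move=> [[[a' b'] [x' y']]]; rewrite mem_filter !mem_quads /h/=.
by move=> H [-> -> -> ->]; move: H; nia.
Qed.

(* The slide (a, b, x, y) -> (a, a + b, x - y, y) preserves a x + b y and maps
   the region y < x onto a < b. *)
Lemma quads_identity n (Phi Gam : (nat * nat) * (nat * nat) -> int) :
  (forall q, Phi (qswap q) = Phi q) -> (forall q, Gam (qswap q) = Gam q) ->
  (forall a b x y, (a < b)%N -> Phi ((a, b), (x, y)) - Phi ((a, b - a), (x + y, y))%N
     = Gam ((a, b), (x, y))) ->
  \sum_(q <- quads n) Gam q = \sum_(q <- quads n | q.2.1 == q.2.2) Phi q -
    \sum_(q <- quads n | q.1.1 == q.1.2) (Phi q - Gam q).
Proof.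
move=> PS GS E.
(* A symmetric sum is twice its part on one side of a diagonal plus the diagonal. Applied to [Phi]
   along y < x and along a < b, this gives two expressions for one sum; the slide evaluates the
   difference of the two half sums. *)
have split3 (H : _ -> int) (c : _ -> nat) : (forall q, H (qswap q) = H q) ->
  \sum_(q <- quads n) H q = (\sum_(q <- quads n | (c q < c (qswap q))%N) H q) *+ 2
   + \sum_(q <- quads n | c q == c (qswap q)) H q.
  move=> HS; rewrite (bigID (fun q => (c q < c (qswap q))%N)) /= mulr2n -addrA.
  congr (_ + _); rewrite (bigID (fun q => c q == c (qswap q))) /= addrC; congr (_ + _).
    rewrite [LHS]sum_qswap; apply: eq_big => [[[a b] [x y]]|q _]; rewrite /qswap/=; last exact: HS.
    set u := c (_, _, _); set v := c (_, _, _); lia.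
  apply: eq_bigl => -[[a b] [x y]] /=; set u := c _; set v := c _; lia.
have SPx := split3 Phi (fun q => q.2.2) PS.
have SPa := split3 Phi (fun q => q.1.1) PS.
have SGa := split3 Gam (fun q => q.1.1) GS.
rewrite /= in SPx SPa SGa.
have SL : \sum_(q <- quads n | (q.1.1 < q.1.2)%N) Phi q -
   \sum_(q <- quads n | (q.2.2 < q.2.1)%N) Phi q =
   \sum_(q <- quads n | (q.1.1 < q.1.2)%N) Gam q.
  rewrite sum_qslide -sumrB; apply: eq_bigr => -[[a b] [x y]] /= ab.
  by rewrite E.
have -> : \sum_(q <- quads n | q.2.1 == q.2.2) Phi q =
   \sum_(q <- quads n | q.2.2 == q.2.1) Phi q.
  by apply: eq_bigl => q; rewrite eq_sym.
rewrite sumrB SGa -SL; move: SPx; rewrite SPa !mulr2n.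
move: (\sum_(_ <- _ | _) _) (\sum_(_ <- _ | _) _) (\sum_(_ <- _ | _) _)
  (\sum_(_ <- _ | _) _) (\sum_(_ <- _ | _) _) => *; lia.
Qed.

(** With x = y the equation becomes c x = n for c = a + b, so the diagonal part is again a Lambert
    series. *)
Lemma sum_diag_x n (F : _ -> int) : \sum_(q <- quads n | q.2.1 == q.2.2) F q =
  lam (fun c x => \sum_(1 <= a < c) F ((a, c - a), (x, x))%N) n.
Proof.
rewrite lam_pairs2 -[LHS]big_filter.
pose h (u : nat * nat) (a : nat) := ((a, u.1 - a), (u.2, u.2))%N.
transitivity (\sum_(q <- [seq h u a | u <- pairs2 n, a <- index_iota 1 u.1]) F q);
  last by rewrite big_allpairs_dep.
apply: perm_big; apply: uniq_perm; first exact: filter_uniq (quads_uniq n).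
  apply: allpairs_uniq_dep; rewrite ?pairs2_uniq//; first by move=> *; apply: iota_uniq.
  move=> [[c x] a] [[c' x'] a'] /allpairsPdep[[c1 x1] [a1 [+ +]]] + /allpairsPdep[[c2 x2] [a2 [+ +]]].
  move=> _ + [-> -> ->] _ + [-> -> ->]; rewrite !mem_index_iota /= /h/= => H1 H2 [-> E -> _].
  by have -> : c1 = c2 by lia.
move=> [[a b] [x y]]; rewrite mem_filter mem_quads/=; apply/idP/allpairsPdep.
  move=> H; exists (a + b, x)%N, a; rewrite mem_pairs2 mem_index_iota /h/=.
  by split; [nia|lia|congr ((_, _), (_, _)); lia].
move=> [[c x'] [a' [+ +]]]; rewrite mem_pairs2 mem_index_iota /h/= => H1 H2 [-> -> -> ->].
by move: H1 H2; nia.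
Qed.

(** With a = b the equation becomes a w = n for w = x + y. *)
Lemma sum_diag_a n (F : _ -> int) : \sum_(q <- quads n | q.1.1 == q.1.2) F q =
  lam (fun a w => \sum_(1 <= x < w) F ((a, a), (x, w - x))%N) n.
Proof.
rewrite lam_swap lam_pairs2 -[LHS]big_filter.
pose h (u : nat * nat) (x : nat) := ((u.2, u.2), (x, u.1 - x))%N.
transitivity (\sum_(q <- [seq h u a | u <- pairs2 n, a <- index_iota 1 u.1]) F q);
  last by rewrite big_allpairs_dep.
apply: perm_big; apply: uniq_perm; first exact: filter_uniq (quads_uniq n).
  apply: allpairs_uniq_dep; rewrite ?pairs2_uniq//; first by move=> *; apply: iota_uniq.
  move=> [[c x] a] [[c' x'] a'] /allpairsPdep[[c1 x1] [a1 [+ +]]] + /allpairsPdep[[c2 x2] [a2 [+ +]]].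
  move=> _ + [-> -> ->] _ + [-> -> ->]; rewrite !mem_index_iota /= /h/= => H1 H2 [-> _ -> E].
  by have -> : c1 = c2 by lia.
move=> [[a b] [x y]]; rewrite mem_filter mem_quads/=; apply/idP/allpairsPdep.
  move=> H; exists (x + y, a)%N, x; rewrite mem_pairs2 mem_index_iota /h/=.
  by split; [nia|lia|congr ((_, _), (_, _)); lia].
move=> [[c x'] [a' [+ +]]]; rewrite mem_pairs2 mem_index_iota /h/= => H1 H2 [-> -> -> ->].
by move: H1 H2; nia.
Qed.

Lemma mod3P n : [\/ n %% 3 = 0, n %% 3 = 1 | n %% 3 = 2]%N.
Proof.
have := ltn_pmod n (isT : 0 < 3)%N.
by case: (n %% 3)%N => [|[|[|//]]] _; [apply: Or31|apply: Or32|apply: Or33].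
Qed.

Definition tab3 (T : seq (seq int)) (x y : nat) : int := (nth [::] T (x %% 3))`_(y %% 3).

Definition tabA : seq (seq int) :=
  [:: [:: 0; -12%:Z; 12%:Z]; [:: -12%:Z; 6%:Z; -3%:Z]; [:: 12%:Z; 3%:Z; -6%:Z]].

(* Found by linear algebra: up to scaling, the only function of degree 3 in
   (a, b) with coefficients depending on (x, y) mod 3 that solves the
   hypotheses of quads_identity for GamA. *)
Definition PhiA (q : (nat * nat) * (nat * nat)) : int :=
  let a := q.1.1%:Z in let b := q.1.2%:Z in
  - 2 * chi3 q.2.1 * a ^+ 3 - 2 * chi3 q.2.2 * b ^+ 3
  + tab3 tabA q.2.1 q.2.2 * a ^+ 2 * b + tab3 tabA q.2.2 q.2.1 * a * b ^+ 2.

(** This is 1 - 9 [3 | y], chosen so that three times the Lambert series of b psiA(y) is the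
    logarithmic derivative of the product of (1 - q^(3 n))^9 / (1 - q^n)^3. *)
Definition psiA (y : nat) : int := if (3 %| y)%N then -8 else 1.

Definition GamA (q : (nat * nat) * (nat * nat)) : int :=
  let a := q.1.1%:Z in let b := q.1.2%:Z in
  3 * (a ^+ 2 * b * chi3 q.2.1 * psiA q.2.2 + b ^+ 2 * a * chi3 q.2.2 * psiA q.2.1).

Definition tabB : seq (seq int) :=
  [:: [:: 0; 1; -1]; [:: 3%:Z; 10%:Z; -1]; [:: -3%:Z; 1; -10%:Z]].
Definition tabB3 : seq (seq int) :=
  [:: [:: 0; 0; 0]; [:: 2%:Z; 0; 0]; [:: -2%:Z; 0; 0]].

(** The counterpart of [PhiA] for [GamB]. There the character sits on the variables that carry the
    powers, so the periodic coefficients depend on (a, b) mod 3, and x and y do not occur. *)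
Definition PhiB (q : (nat * nat) * (nat * nat)) : int :=
  let a := q.1.1%:Z in let b := q.1.2%:Z in
  tab3 tabB3 q.1.1 q.1.2 * a ^+ 3 + tab3 tabB3 q.1.2 q.1.1 * b ^+ 3
  + tab3 tabB q.1.1 q.1.2 * a ^+ 2 * b + tab3 tabB q.1.2 q.1.1 * a * b ^+ 2.

(** This is 3 b - b [3 | b], chosen so that -3 times its Lambert series is the logarithmic
    derivative of the product of (1 - q^n)^9 / (1 - q^(3 n))^3. *)
Definition psiB (b : nat) : int := if (3 %| b)%N then 2 * b%:Z else 3 * b%:Z.

Definition GamB (q : (nat * nat) * (nat * nat)) : int :=
  let a := q.1.1%:Z in let b := q.1.2%:Z in
  3 * (chi3 q.1.1 * a ^+ 2 * psiB q.1.2 + chi3 q.1.2 * b ^+ 2 * psiB q.1.1).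

Lemma mod3D x y : ((x + y) %% 3 = (x %% 3 + y %% 3) %% 3)%N.
Proof. by rewrite modnDm. Qed.

Lemma PhiA_slide a b x y : (a < b)%N ->
  PhiA ((a, b), (x, y)) - PhiA ((a, b - a), (x + y, y))%N = GamA ((a, b), (x, y)).
Proof.
move=> /ltnW /subnK <-; move: (b - a)%N => c; rewrite addnK.
rewrite /PhiA /GamA /psiA /tab3 /= !chi3E /dvdn ?(mod3D x y) PoszD.
by case: (mod3P x) => ->; case: (mod3P y) => -> /=; ring.
Qed.

Lemma PhiA_swap q : PhiA (qswap q) = PhiA q.
Proof. by rewrite /PhiA /=; ring. Qed.
Lemma GamA_swap q : GamA (qswap q) = GamA q.
Proof. by rewrite /GamA /=; ring. Qed.
Lemma PhiB_swap q : PhiB (qswap q) = PhiB q.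
Proof. by rewrite /PhiB /=; ring. Qed.
Lemma GamB_swap q : GamB (qswap q) = GamB q.
Proof. by rewrite /GamB /=; ring. Qed.

Lemma PhiB_slide a b x y : (a < b)%N ->
  PhiB ((a, b), (x, y)) - PhiB ((a, b - a), (x + y, y))%N = GamB ((a, b), (x, y)).
Proof.
move=> /ltnW /subnK <-; move: (b - a)%N => c; rewrite addnK.
rewrite /PhiB /GamB /psiB /tab3 /= !chi3E /dvdn ?(mod3D x y) ?(mod3D c a) PoszD.
by case: (mod3P a) => ->; case: (mod3P c) => -> /=; ring.
Qed.

Lemma sumPhiA_x c x : (0 < c)%N -> \sum_(1 <= a < c) PhiA ((a, c - a), (x, x))%N =
  - 2 * chi3 x * (c%:Z ^+ 2 - c%:Z ^+ 3).
Proof.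
move=> c0.
(* Partial sums that start at a = 0 are polynomial in m and c. At m = c the bracket collapses to
   c^2, and removing the term a = 0 accounts for the c^3. *)
have H m : (m <= c)%N -> \sum_(0 <= a < m) PhiA ((a, c - a), (x, x))%N =
  - 2 * chi3 x * (m%:Z * c%:Z ^+ 3 - 3 * c%:Z ^+ 2 * m%:Z * (m%:Z - 1)
     + c%:Z * m%:Z * (m%:Z - 1) * (2 * m%:Z - 1)).
  elim: m => [|m IH] mc; first by rewrite big_nil; ring.
  rewrite big_nat_recr//= IH 1?ltnW//.
  rewrite /PhiA /tab3 /= !chi3E -(subnKC (ltnW mc)); move: (c - m)%N => d.
  rewrite addKn -addn1 !PoszD.
  by case: (mod3P x) => -> /=; ring.
have := H c (leqnn c); rewrite big_ltn//= => E.
apply: (addrI (PhiA ((0, c - 0), (x, x)))%N); rewrite E /PhiA /tab3/= subn0; ring.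
Qed.

Lemma GamA_diag a x y : PhiA ((a, a), (x, y)) - GamA ((a, a), (x, y)) =
  - 2 * chi3 (x + y)%N * a%:Z ^+ 3.
Proof.
rewrite /PhiA /GamA /psiA /tab3 /= !chi3E /dvdn ?(mod3D x y) ?(mod3D c a).
by case: (mod3P x) => ->; case: (mod3P y) => -> /=; ring.
Qed.

Lemma GamB_diag a x y : PhiB ((a, a), (x, y)) - GamB ((a, a), (x, y)) =
  2 * chi3 a * a%:Z ^+ 3.
Proof.
rewrite /PhiB /GamB /psiB /tab3 /= !chi3E /dvdn.
by case: (mod3P a) => -> /=; ring.
Qed.

Lemma sum_nat3 (F : nat -> int) m : \sum_(0 <= a < m * 3) F a =
  \sum_(0 <= k < m) (F (k * 3 + 0)%N + F (k * 3 + 1)%N + F (k * 3 + 2)%N).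
Proof.
elim: m => [|m IH]; first by rewrite !big_nil.
have -> : (m.+1 * 3 = (m * 3).+3)%N by lia.
by rewrite !big_nat_recr//= -IH addn0 addn1 addn2 !addrA.
Qed.

Lemma PhiB_mod i j k l x y : (i < 3)%N -> (j < 3)%N ->
  PhiB ((k * 3 + i, l * 3 + j), (x, y))%N =
  let a := 3 * k%:Z + i%:Z in let b := 3 * l%:Z + j%:Z in
  (nth [::] tabB3 i)`_j * a ^+ 3 + (nth [::] tabB3 j)`_i * b ^+ 3
  + (nth [::] tabB i)`_j * a ^+ 2 * b + (nth [::] tabB j)`_i * a * b ^+ 2.
Proof.
move=> i3 j3; rewrite /PhiB /tab3 /= !modnMDl !modn_small// !PoszD !PoszM.
by rewrite ![_ * 3%:Z]mulrC.
Qed.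

Lemma sumPhiB c x : 3 * (\sum_(0 <= a < c) PhiB ((a, c - a), (x, x))%N) = 2 * psiB c.
Proof.
rewrite /psiB /dvdn (divn_eq c 3); move: (c %/ 3)%N => l; rewrite modnMDl modn_mod.
(* For c = 3 l + j the sum over the first m blocks of three consecutive a is polynomial in m and l,
   with one polynomial for each residue j. The j terms that remain after m = l are added at the
   end. *)
pose H (j : nat) (m l : int) : int := match j with
 | 0%N => 4 * m - 9 * m * l ^+ 2 + 27%:Z * m ^+ 2 * l - 18%:Z * m ^+ 3
 | 1%N => - 3 * m + 45%:Z * m * l ^+ 2 + 54%:Z * m * l ^+ 3 - 9 * m ^+ 2
    - 81%:Z * m ^+ 2 * l - 162%:Z * m ^+ 2 * l ^+ 2 + 36%:Z * m ^+ 3 + 108%:Z * m ^+ 3 * l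
 | _ => - 48%:Z * m - 180%:Z * m * l - 198%:Z * m * l ^+ 2 - 54%:Z * m * l ^+ 3
    + 108%:Z * m ^+ 2 + 270%:Z * m ^+ 2 * l + 162%:Z * m ^+ 2 * l ^+ 2
    - 72%:Z * m ^+ 3 - 108%:Z * m ^+ 3 * l end.
have step (j : nat) m : (j < 3)%N -> (m <= l)%N ->
   \sum_(0 <= a < m * 3) PhiB ((a, (l * 3 + j) - a), (x, x))%N = H j m l.
  move=> j3; rewrite sum_nat3; elim: m => [|m IH] ml.
    by rewrite big_nil /H; case: (j) => [|[|?]]; ring.
  rewrite big_nat_recr//= IH 1?ltnW// -(subnKC ml); move: (l - m.+1)%N => d.
  case: j j3 {IH} => [|[|[|//]]] _.
  - have -> : ((m.+1 + d) * 3 + 0 - (m * 3 + 0) = d.+1 * 3 + 0)%N by lia.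
    have -> : ((m.+1 + d) * 3 + 0 - (m * 3 + 1) = d * 3 + 2)%N by lia.
    have -> : ((m.+1 + d) * 3 + 0 - (m * 3 + 2) = d * 3 + 1)%N by lia.
    by rewrite !PhiB_mod//= ?PoszD !intS; ring.
  - have -> : ((m.+1 + d) * 3 + 1 - (m * 3 + 0) = d.+1 * 3 + 1)%N by lia.
    have -> : ((m.+1 + d) * 3 + 1 - (m * 3 + 1) = d.+1 * 3 + 0)%N by lia.
    have -> : ((m.+1 + d) * 3 + 1 - (m * 3 + 2) = d * 3 + 2)%N by lia.
    by rewrite !PhiB_mod//= ?PoszD !intS; ring.
  - have -> : ((m.+1 + d) * 3 + 2 - (m * 3 + 0) = d.+1 * 3 + 2)%N by lia.
    have -> : ((m.+1 + d) * 3 + 2 - (m * 3 + 1) = d.+1 * 3 + 1)%N by lia.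
    have -> : ((m.+1 + d) * 3 + 2 - (m * 3 + 2) = d.+1 * 3 + 0)%N by lia.
    by rewrite !PhiB_mod//= ?PoszD !intS; ring.
have S0 := step 0%N l isT (leqnn l); have S1 := step 1%N l isT (leqnn l).
have S2 := step 2%N l isT (leqnn l); clear step.
have P01 := @PhiB_mod 0 1 l 0 x x isT isT; have P02 := @PhiB_mod 0 2 l 0 x x isT isT.
have P11 := @PhiB_mod 1 1 l 0 x x isT isT.
rewrite !mul0n !add0n ?addn0 ?addn1 ?addn2 in S0 S1 S2 P01 P02 P11.
case: (mod3P c) => ->; rewrite /= ?addn0 ?addn1 ?addn2 ?big_nat_recr//=.
- by rewrite S0 /H; ring.
- by rewrite S1 subSnn P01 /H /= ?intS ?PoszM; ring.
- have -> : ((l * 3).+2 - (l * 3) = 2)%N by lia.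
  have -> : ((l * 3).+2 - (l * 3).+1 = 1)%N by lia.
  by rewrite S2 P02 P11 /H /= ?intS ?PoszM; ring.
Qed.

(** * Eisenstein series of weight 3 *)

(** For even k, [serA] is the Eisenstein series of weight k + 1 that vanishes at infinity; [serB]
    is, up to a factor, the nonconstant part of the one that does not. *)
Definition serA (k : nat) : fps int := lam (fun a x => chi3 x * a%:Z ^+ k).
Definition serB (k : nat) : fps int := lam (fun a x => chi3 a * a%:Z ^+ k).

Lemma lam_natM phi : lam (fun a x => (a * x)%:Z * phi a x) = fps_deriv (lam phi).
Proof.
apply/funext => n; rewrite /fps_deriv lamZ !lam_pairs2.
apply: eq_big_seq => -[a x]; rewrite mem_pairs2 => /and3P[_ _ /eqP /= ->].
by rewrite natz.
Qed.

(** [quads_identity] requires symmetric functions, whereas the convolutions are not symmetric; over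
    [quads], symmetrising merely doubles the sum. *)
Lemma sum_sym3 n (G : (nat * nat) * (nat * nat) -> int) :
  \sum_(q <- quads n) 3 * (G q + G (qswap q)) = 6 * \sum_(q <- quads n) G q.
Proof.
rewrite -mulr_sumr big_split /= -(sum_qswap _ predT); move: (\sum_(_ <- _) _) => z; lia.
Qed.

(** This is the equation of [eisA_ode] multiplied by q; the subtracted [serA 2] is the contribution
    of the factor q to the derivative. *)
Lemma serA_conv : 3 * (serA 2 * lam (fun b y => b%:Z * psiA y)) = fps_deriv (serA 2) - serA 2.
Proof.
suff E : 6 * (serA 2 * lam (fun b y => b%:Z * psiA y)) = 2 * (fps_deriv (serA 2) - serA 2).
  apply/funext => n; have := congr1 (@^~ n) E; rewrite /= !fps_natM; lia.
apply/funext => n; rewrite !fps_natM lamM -sum_sym3.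
transitivity (\sum_(q <- quads n) GamA q).
  by apply: eq_bigr => q _; rewrite /GamA /=; ring.
rewrite (quads_identity n PhiA_swap GamA_swap PhiA_slide) sum_diag_x sum_diag_a.
rewrite (@eq_lam _ (fun c x => - 2 * chi3 x * (c%:Z ^+ 2 - c%:Z ^+ 3))); last first.
  by move=> c x c0 _; apply: sumPhiA_x.
rewrite (@eq_lam (fun a w => \sum_(1 <= x < w) _)
   (fun a w => - 2 * chi3 w * a%:Z ^+ 3 * (w%:Z - 1))); last first.
  move=> a w _ w0.
  rewrite (eq_big_nat _ _ (F2 := fun _ => - 2 * chi3 w * a%:Z ^+ 3)); last first.
    by move=> x /andP[_ xw]; rewrite GamA_diag subnKC// ltnW.
  rewrite sumr_const_nat -[LHS]mulr_natr.
  by have -> : (w - 1)%:R = w%:Z - 1 :> int by rewrite natz; lia.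
rewrite fpsB -lam_natM /serA !lam_pairs2 -!sumrB mulr_sumr.
by apply: eq_bigr => u _; rewrite PoszM; ring.
Qed.

Lemma serB_conv : 9 * (serB 2 * lam (fun b _ => psiB b)) =
  lam (fun b _ => psiB b) - 3 * fps_deriv (serB 2).
Proof.
suff E : 18%:R * (serB 2 * lam (fun b _ => psiB b)) =
    2 * (lam (fun b _ => psiB b) - 3 * fps_deriv (serB 2)).
  apply/funext => n; have := congr1 (@^~ n) E; rewrite /= !fpsB !fps_natM fpsB fps_natM; lia.
apply/funext => n; rewrite !fps_natM fpsB fps_natM lamM.
have -> : 18%:R = 3 * 6 :> int by [].
rewrite -mulrA -sum_sym3.
have -> : \sum_(q <- quads n)
    3 * (chi3 q.1.1 * q.1.1%:Z ^+ 2 * psiB q.1.2 +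
         chi3 (qswap q).1.1 * (qswap q).1.1%:Z ^+ 2 * psiB (qswap q).1.2) =
    \sum_(q <- quads n) GamB q by [].
rewrite (quads_identity n PhiB_swap GamB_swap PhiB_slide) sum_diag_x sum_diag_a.
rewrite mulrBr !lamZ.
rewrite (@eq_lam (fun c x => 3 * _) (fun c _ => 2 * psiB c - 6 * chi3 c * c%:Z ^+ 3)); last first.
  move=> c x c0 _; rewrite -(sumPhiB c x) [in RHS]big_ltn//= mulrDr.
  suff -> : PhiB ((0, c - 0), (x, x))%N = 2 * chi3 c * c%:Z ^+ 3 by ring.
  rewrite /PhiB /tab3 subn0 chi3E /=.
  by case: (mod3P c) => -> /=; ring.
rewrite (@eq_lam (fun a w => 3 * _)
   (fun a w => 6 * chi3 a * a%:Z ^+ 3 * (w%:Z - 1))); last first.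
  move=> a w _ w0.
  rewrite (eq_big_nat _ _ (F2 := fun _ => 2 * chi3 a * a%:Z ^+ 3)); last first.
    by move=> x /andP[_ xw]; rewrite GamB_diag.
  rewrite sumr_const_nat -[X in 3 * X]mulr_natr.
  have -> : (w - 1)%:R = w%:Z - 1 :> int by rewrite natz; lia.
  by ring.
rewrite -lam_natM /serB !lam_pairs2 mulr_sumr -!sumrB mulr_sumr.
by apply: eq_bigr => u _; rewrite PoszM; ring.
Qed.

(** Both sides are the sum of 3 b q^(3 b z) over b and z: the factor 3 of the exponent moves from y
    to b. *)
Lemma lam_mod3 : lam (fun b y => if (3 %| y)%N then 3 * b%:Z else 0) =
  lam (fun b y => if (3 %| b)%N then b%:Z else 0).
Proof.
apply/funext => n; rewrite !lam_pairs2 -!big_mkcond -[LHS]big_filter -[RHS]big_filter.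
pose h (u : nat * nat) := (u.1 * 3, u.2 %/ 3)%N.
transitivity (\sum_(u <- [seq h u | u <- pairs2 n & (3 %| u.2)%N]) u.1%:Z).
  by rewrite big_map; apply: eq_bigr => u _; rewrite PoszM mulrC.
apply: perm_big; apply: uniq_perm; last first.
- move=> [a x]; rewrite mem_filter mem_pairs2; apply/mapP/idP => /=.
    case=> -[b y]; rewrite mem_filter mem_pairs2 /h /= => /andP[/dvdnP[z ->]] H [-> ->].
    by rewrite mulnK// dvdn_mull//; move: H; nia.
  move=> /andP[/dvdnP[z ->] H]; exists (z, x * 3)%N; last by rewrite /h /= mulnK.
  by rewrite mem_filter mem_pairs2 /= dvdn_mull//; nia.
- exact: filter_uniq (pairs2_uniq n).
rewrite map_inj_in_uniq; first exact: filter_uniq (pairs2_uniq n).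
move=> [a x] [a' x'].
rewrite !mem_filter /h /= => /andP[/dvdnP[z ->] _] /andP[/dvdnP[z' ->] _].
by rewrite !mulnK// => -[? ->]; congr (_, _); lia.
Qed.

(* The weight-3 Eisenstein series eta(q)^9 / eta(q^3)^3 and eta(q^3)^9 / (q eta(q)^3). *)
Definition eisB : fps int := 1 - 9 * serB 2.
Definition eisA : fps int := fun n => serA 2 (n + 1)%N.

Definition logB : fps int := - 3 * lam (fun b _ => psiB b).
Definition logA : fps int := 3 * lam (fun b y => b%:Z * psiA y).

Lemma serA0 k : serA k 0%N = 0. Proof. exact: lam0. Qed.
Lemma serB0 k : serB k 0%N = 0. Proof. exact: lam0. Qed.

Lemma serA1 k : serA k 1%N = 1.
Proof. by rewrite /serA /lam !big_nat1 /= expr1n chi3E. Qed.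

Lemma serA_eisA : serA 2 = fpsX int 1 * eisA.
Proof. by apply: fps_shiftE => -[|//] _; rewrite serA0. Qed.

Lemma eisB_ode : fps_deriv eisB = logB * eisB.
Proof.
have DB : fps_deriv eisB = - (9 * fps_deriv (serB 2)).
  apply/funext => n; rewrite fpsN fps_natM /fps_deriv /eisB fpsB fps_natM fps1.
  by case: n => [|n]; rewrite ?mul0r ?mulr0 ?oppr0//=; ring.
rewrite DB /eisB /logB; have := serB_conv.
set u := serB 2; set v := lam _; move: (fps_deriv u) => w E.
transitivity (- 3 * v + 3 * (9 * (u * v))); last by ring.
by rewrite E; ring.
Qed.

Lemma eisA_ode : fps_deriv eisA = logA * eisA.
Proof.
apply: (@fpsXn_inj _ 1); rewrite /logA mulrCA -serA_eisA -mulrA [lam _ * _]mulrC serA_conv.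
rewrite serA_eisA fps_derivM fps_derivXn; ring.
Qed.

Lemma eisA0 : eisA 0%N = 1. Proof. exact: serA1. Qed.
Lemma eisB00 : eisB 0%N = 1.
Proof. by rewrite /eisB fpsB fps_natM serB0 mulr0 subr0. Qed.

Lemma log_rel : logA = tlog + logB.
Proof.
rewrite /logA /logB /tlog.
have -> : lam (fun b y => b%:Z * psiA y) = lam (fun b y => b%:Z) -
   3 * lam (fun b y => if (3 %| y)%N then 3 * b%:Z else 0).
  apply/funext => n; rewrite fpsB fps_natM lamZ !lam_pairs2 -sumrB.
  by apply: eq_bigr => u _; rewrite /psiA; case: ifP => _; ring.
rewrite lam_mod3; apply/funext => n.
rewrite fpsD !fps_natM mulNr fpsN fps_natM fpsB fps_natM !lamZ !lam_pairs2 -!sumrB mulr_sumr.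
by apply: eq_bigr => u _; rewrite /psiB; case: ifP => _; ring.
Qed.

(** Both sides have constant term 1 and logarithmic derivative [logA]. This is t = A / B after
    division by q. *)
Lemma ty_eis : ty * eisB = eisA.
Proof.
apply: (@fps_ode_uniq _ logA).
- by move=> n; rewrite pnatr_eq0.
- by rewrite /logA fps_natM lam0 mulr0.
- by rewrite log_rel; apply: fps_derivM_log; [apply: ty_ode|apply: eisB_ode].
- exact: eisA_ode.
- by rewrite fpsM0 ty0 eisB00 eisA0.
Qed.

(** * Absolutely summable families of complex numbers *)

Section Norm.
Variable R : realType.
Local Notation C := R[i].
Implicit Types z w : C.

Lemma normc_ge0 z : 0 <= normc z.
Proof. by case: z => a b; apply: sqrtr_ge0. Qed.
Lemma normcM z w : normc (z * w) = normc z * normc w.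
Proof. exact: ComplexField.Normc.normcM. Qed.
Lemma normcV z : normc z^-1 = (normc z)^-1.
Proof. exact: ComplexField.Normc.normcV. Qed.
Lemma normc0 : normc (0 : C) = 0. Proof. exact: ComplexField.Normc.normc0. Qed.
Lemma normc1 : normc (1 : C) = 1. Proof. exact: ComplexField.Normc.normc1. Qed.
Lemma normc_eq0 z : (normc z == 0) = (z == 0).
Proof.
by apply/eqP/eqP => [/ComplexField.Normc.eq0_normc//|->]; rewrite normc0.
Qed.
Lemma normc_gt0 z : (0 < normc z) = (z != 0).
Proof. by rewrite lt0r normc_ge0 andbT normc_eq0. Qed.
Lemma normcX z n : normc (z ^+ n) = normc z ^+ n.
Proof. by elim: n => [|n IH]; [rewrite !expr0 normc1|rewrite !exprS normcM IH]. Qed.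
Lemma le_normcB z w : normc (z - w) <= normc z + normc w.
Proof. by rewrite -(normcN w) le_normcD. Qed.
Lemma normcBC z w : normc (z - w) = normc (w - z).
Proof. by rewrite -normcN opprB. Qed.
Lemma le_normc_dist z w : normc z <= normc w + normc (z - w).
Proof. by rewrite -{1}[z](subrK w) addrC le_normcD. Qed.
Lemma normcR (x : R) : normc x%:C%C = `|x|.
Proof. by rewrite /normc /= expr0n /= addr0 sqrtr_sqr. Qed.
Lemma normc_int (n : int) : normc (n%:~R : C) = `|n|%:~R.
Proof.
have -> : (n%:~R : C) = (n%:~R)%:C%C by rewrite rmorph_int.
by rewrite normcR intr_norm.
Qed.
Lemma normc_nat (n : nat) : normc (n%:R : C) = n%:R.
Proof. by rewrite -[n%:R]/(n%:~R) normc_int. Qed.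
Lemma Re_le_normc z : `|Re z| <= normc z.
Proof.
by case: z => a b; rewrite -sqrtr_sqr /= ler_wsqrtr// lerDl sqr_ge0.
Qed.
Lemma Im_le_normc z : `|Im z| <= normc z.
Proof.
by case: z => a b; rewrite -sqrtr_sqr /= ler_wsqrtr// lerDr sqr_ge0.
Qed.
Lemma sqr_normc z : normc z ^+ 2 = Re z ^+ 2 + Im z ^+ 2.
Proof. by case: z => a b /=; rewrite sqr_sqrtr// addr_ge0// sqr_ge0. Qed.
Lemma normc_le_ReIm z : normc z <= `|Re z| + `|Im z|.
Proof.
rewrite -(@ler_pXn2r _ 2)// ?nnegrE ?normc_ge0// ?addr_ge0// sqr_normc.
rewrite sqrrD !real_normK ?num_real//; have := mulr_ge0 (normr_ge0 (Re z)) (normr_ge0 (Im z)); lra.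
Qed.
Lemma normc_sum I (s : seq I) (f : I -> C) :
  normc (\sum_(i <- s) f i) <= \sum_(i <- s) normc (f i).
Proof.
elim: s => [|i s IH]; first by rewrite !big_nil normc0.
by rewrite !big_cons; apply: le_trans (le_normcD _ _) _; rewrite lerD2l.
Qed.
End Norm.

Section Ccvg.
Variable R : realType.
Local Notation C := R[i].

Definition ccvg (u : nat -> C) (l : C) : Prop :=
  forall e : R, 0 < e -> exists N, forall n, (N <= n)%N -> normc (u n - l) < e.

Lemma ccvg_cst (c : C) : ccvg (fun=> c) c.
Proof. by move=> e e0; exists 0%N => n _; rewrite subrr normc0. Qed.

Lemma ccvg_ext (u v : nat -> C) l N0 :
  (forall n, (N0 <= n)%N -> u n = v n) -> ccvg u l -> ccvg v l.
Proof.
move=> uv ul e /ul[N H]; exists (maxn N N0) => n; rewrite geq_max => /andP[nN nN0].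
by rewrite -uv// H.
Qed.

Lemma ccvgD u v l m : ccvg u l -> ccvg v m -> ccvg (fun n => u n + v n) (l + m).
Proof.
move=> ul vm e e0; have e2 : 0 < e / 2 by lra.
have [N1 H1] := ul _ e2; have [N2 H2] := vm _ e2.
exists (maxn N1 N2) => n; rewrite geq_max => /andP[n1 n2].
have -> : u n + v n - (l + m) = (u n - l) + (v n - m) by ring.
by apply: le_lt_trans (le_normcD _ _) _; have := H1 n n1; have := H2 n n2; lra.
Qed.

Lemma ccvgM u v l m : ccvg u l -> ccvg v m -> ccvg (fun n => u n * v n) (l * m).
Proof.
move=> ul vm e e0; pose K := normc l + normc m + 1.
have K0 : 0 < K by have := normc_ge0 l; have := normc_ge0 m; rewrite /K; lra.
have e2 : 0 < e / (2 * K) by rewrite divr_gt0// mulr_gt0.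
have [N1 H1] := ul _ e2; have [N2 H2] := vm _ e2; have [N3 H3] := vm _ ltr01.
exists (maxn N1 (maxn N2 N3)) => n; rewrite !geq_max => /and3P[n1 n2 n3].
have -> : u n * v n - l * m = (u n - l) * v n + l * (v n - m) by ring.
apply: le_lt_trans (le_normcD _ _) _; rewrite !normcM.
have vK : normc (v n) <= K.
  by have := le_normc_dist (v n) m; have := H3 n n3; have := normc_ge0 l; rewrite /K; lra.
have lK : normc l <= K by have := normc_ge0 m; rewrite /K; lra.
have A : normc (u n - l) * normc (v n) < e / 2.
  apply: le_lt_trans (ler_wpM2l (normc_ge0 _) vK) _.
  by rewrite -ltr_pdivlMr// -mulrA -invfM H1.
have B : normc l * normc (v n - m) <= e / 2.
  apply: le_trans (ler_wpM2r (normc_ge0 _) lK) _.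
  by rewrite mulrC -ler_pdivlMr// -mulrA -invfM ltW// H2.
by lra.
Qed.

Lemma ccvgX u l k : ccvg u l -> ccvg (fun n => u n ^+ k) (l ^+ k).
Proof.
move=> ul; elim: k => [|k IH]; first exact: ccvg_cst.
by rewrite exprS; under eq_fun do rewrite exprS; apply: ccvgM.
Qed.

Lemma ccvgN u l : ccvg u l -> ccvg (fun n => - u n) (- l).
Proof.
move=> ul; rewrite -mulN1r; under eq_fun do rewrite -mulN1r.
by apply: ccvgM => //; apply: ccvg_cst.
Qed.

Lemma ccvgV u l : l != 0 -> ccvg u l -> ccvg (fun n => (u n)^-1) l^-1.
Proof.
move=> l0 ul e e0; have L0 : 0 < normc l by rewrite normc_gt0.
have e1 : 0 < e * normc l ^+ 2 / 2 by rewrite divr_gt0// mulr_gt0// exprn_gt0.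
have e2 : 0 < normc l / 2 by lra.
have [N1 H1] := ul _ e1; have [N2 H2] := ul _ e2.
exists (maxn N1 N2) => n; rewrite geq_max => /andP[n1 n2].
have uL : normc l / 2 < normc (u n).
  by have := le_normc_dist l (u n); have := H2 n n2; rewrite normcBC; lra.
have u0 : u n != 0 by rewrite -normc_gt0; lra.
have -> : (u n)^-1 - l^-1 = (l - u n) / (u n * l) by field; rewrite u0 l0.
rewrite normcM normcV normcM normcBC ltr_pdivrMr ?mulr_gt0 ?normc_gt0//.
apply: lt_le_trans (H1 n n1) _.
have := ler_wpM2l (ltW (mulr_gt0 e0 L0)) (ltW uL); rewrite expr2; lra.
Qed.

Lemma ccvg_sum (I : Type) (s : seq I) (u : nat -> I -> C) (l : I -> C) :
  (forall i, ccvg (u^~ i) (l i)) ->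
  ccvg (fun n => \sum_(i <- s) u n i) (\sum_(i <- s) l i).
Proof.
move=> H; elim: s => [|i s IH].
  by under eq_fun do rewrite big_nil; rewrite big_nil; apply: ccvg_cst.
by under eq_fun do rewrite big_cons; rewrite big_cons; apply: ccvgD.
Qed.

End Ccvg.

Section Summability.
Variable R : realType.
Local Notation C := R[i].

Lemma sum_subset (V : zmodType) (I : eqType) (A B : seq I) (f : I -> V) : uniq A -> uniq B ->
  {subset A <= B} -> \sum_(i <- B) f i = \sum_(i <- A) f i + \sum_(i <- B | i \notin A) f i.
Proof.
move=> uA uB AB; rewrite (bigID (mem A)) /=; congr (_ + _).
rewrite -big_filter; apply: perm_big; apply: uniq_perm; rewrite ?filter_uniq// => i.
by rewrite mem_filter andb_idr//; apply: AB.
Qed.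

Definition asum (I : eqType) (f : I -> C) : Prop :=
  exists M : R, forall B, uniq B -> \sum_(i <- B) normc (f i) <= M.

(** Convergence along the finite subsets of the index set. No enumeration enters, so a lattice sum
    can be reindexed by any bijection, see [hassum_bij]. *)
Definition hassum (I : eqType) (f : I -> C) (s : C) : Prop :=
  forall e : R, 0 < e -> exists A : seq I, forall B : seq I, uniq B -> {subset A <= B} ->
    normc (\sum_(i <- B) f i - s) < e.

Section OneIndex.
Variable I : eqType.
Implicit Types f g : I -> C.

Lemma hassum_uniq f s t : hassum f s -> hassum f t -> s = t.
Proof.
move=> fs ft; apply/eqP; rewrite -subr_eq0 -normc_eq0; apply: contraT => n0.
have e2 : 0 < normc (s - t) / 2 by rewrite divr_gt0// lt0r n0 normc_ge0.
have [A HA] := fs _ e2; have [B HB] := ft _ e2.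
have U := undup_uniq (A ++ B).
have sA : {subset A <= undup (A ++ B)} by move=> x xA; rewrite mem_undup mem_cat xA.
have sB : {subset B <= undup (A ++ B)} by move=> x xA; rewrite mem_undup mem_cat xA orbT.
have := HA _ U sA; have := HB _ U sB; set S := \sum_(_ <- _) _ => h1 h2.
have := le_normcB (S - t) (S - s).
have -> : S - t - (S - s) = s - t by ring.
lra.
Qed.

Lemma hassum_ext f g s : (forall i, f i = g i) -> hassum f s -> hassum g s.
Proof. by move=> /funext->. Qed.

Lemma hassumD f g s t : hassum f s -> hassum g t -> hassum (fun i => f i + g i) (s + t).
Proof.
move=> fs gt e e0; have e2 : 0 < e / 2 by lra.
have [A HA] := fs _ e2; have [B HB] := gt _ e2; exists (A ++ B) => D uD sD.
have /(HA _ uD) h1 : {subset A <= D} by move=> x xA; apply: sD; rewrite mem_cat xA.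
have /(HB _ uD) h2 : {subset B <= D} by move=> x xA; apply: sD; rewrite mem_cat xA orbT.
rewrite big_split /=; set u := \sum_(_ <- _) _ in h1 *; set v := \sum_(_ <- _) _ in h2 *.
have -> : u + v - (s + t) = (u - s) + (v - t) by ring.
by apply: le_lt_trans (le_normcD _ _) _; lra.
Qed.

Lemma hassumZ (c : C) f s : hassum f s -> hassum (fun i => c * f i) (c * s).
Proof.
move=> fs e e0; have K0 : 0 < normc c + 1 by have := normc_ge0 c; lra.
have [A HA] := fs _ (divr_gt0 e0 K0); exists A => B uB AB.
rewrite -mulr_sumr -mulrBr normcM; have := HA B uB AB; rewrite ltr_pdivlMr// mulrC.
by apply: le_lt_trans; rewrite ler_wpM2r ?normc_ge0//; lra.
Qed.

Lemma hassum0 : hassum (fun _ : I => 0) 0.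
Proof. by move=> e e0; exists [::] => B _ _; rewrite big1// subrr normc0. Qed.

Lemma hassum_sum (J : Type) (r : seq J) (f : J -> I -> C) (s : J -> C) :
  (forall j, hassum (f j) (s j)) -> hassum (fun i => \sum_(j <- r) f j i) (\sum_(j <- r) s j).
Proof.
move=> H; elim: r => [|j r IH].
  by apply: hassum_ext (fun i => esym (big_nil _ _ _ _)) _; rewrite big_nil; apply: hassum0.
rewrite big_cons; apply: hassum_ext (hassumD (H j) IH) => i.
by rewrite big_cons.
Qed.

Lemma hassum_fin f (A : seq I) : uniq A -> (forall i, i \notin A -> f i = 0) ->
  hassum f (\sum_(i <- A) f i).
Proof.
move=> uA f0 e e0; exists A => B uB AB.
rewrite (sum_subset _ uA uB AB).
have -> : \sum_(i <- B | i \notin A) f i = 0 by apply: big1 => i /f0.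
by rewrite addr0 subrr normc0.
Qed.

Lemma hassum_le f s (M : R) : hassum f s ->
  (forall B, uniq B -> \sum_(i <- B) normc (f i) <= M) -> normc s <= M.
Proof.
move=> fs H; apply/ler_addgt0Pr => e e0; have [A HA] := fs _ e0.
have U := undup_uniq A.
have {HA} h := HA _ U (fun x xA => eq_ind_r is_true xA (mem_undup A x)).
have := le_normc_dist s (\sum_(i <- undup A) f i); rewrite normcBC.
have := normc_sum (undup A) f; have := H _ U; lra.
Qed.

Lemma asum_tail f : asum f -> forall e : R, 0 < e -> exists2 A : seq I, uniq A &
  forall B, uniq B -> (forall i, i \in B -> i \notin A) -> \sum_(i <- B) normc (f i) < e.
Proof.
move=> [M HM] e e0.
pose E := [set x | exists2 B, uniq B & x = \sum_(i <- B) normc (f i)]%classic.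
have hE : has_sup E.
  split; first by exists (\sum_(i <- [::]) normc (f i)); exists [::].
  by exists M => _ [B uB ->]; apply: HM.
have [_ [A uA ->] hA] := sup_adherent e0 hE; exists A => // B uB dB.
have uAB : uniq (A ++ B).
  rewrite cat_uniq uA uB andbT /=; apply/hasPn => x /dB //.
have : \sum_(i <- A ++ B) normc (f i) <= sup E.
  by apply: ub_le_sup; [case: hE|exists (A ++ B)].
by rewrite big_cat /=; lra.
Qed.

Lemma asum_le f g (c : R) : 0 <= c -> asum g -> (forall i, normc (f i) <= c * normc (g i)) -> asum f.
Proof.
move=> c0 [M HM] fg; exists (c * M) => B uB.
apply: (@le_trans _ _ (\sum_(i <- B) c * normc (g i))).
  exact: ler_sum.
by rewrite -mulr_sumr ler_wpM2l// HM.
Qed.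

Lemma hassum_pos (g : I -> R) : (forall i, 0 <= g i) -> asum (fun i => (g i)%:C%C) ->
  exists s, hassum (fun i => (g i)%:C%C) s.
Proof.
move=> g0 [M HM].
have nE B : \sum_(i <- B) normc (g i)%:C%C = \sum_(i <- B) g i.
  by apply: eq_bigr => i _; rewrite normcR ger0_norm.
pose E := [set x | exists2 B, uniq B & x = \sum_(i <- B) g i]%classic.
have hE : has_sup E.
  split; first by exists (\sum_(i <- [::]) g i); exists [::].
  by exists M => _ [B uB ->]; rewrite -nE; apply: HM.
exists (sup E)%:C%C => e e0; have [_ [A uA ->] hA] := sup_adherent e0 hE.
exists A => B uB AB; rewrite -rmorph_sum -rmorphB normcR.
have : \sum_(i <- B) g i <= sup E by apply: ub_le_sup; [case: hE|exists B].
have : \sum_(i <- A) g i <= \sum_(i <- B) g i.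
  by rewrite (sum_subset _ uA uB AB) lerDl sumr_ge0.
by move=> h1 h2; rewrite ler0_norm ?subr_le0//; lra.
Qed.

Lemma hassum_exists f : asum f -> exists s, hassum f s.
Proof.
move=> af.
have P (h : I -> R) : (forall i, `|h i| <= normc (f i)) -> exists s, hassum (fun i => (h i)%:C%C) s.
  move=> hf.
  have Q (k : I -> R) : (forall i, 0 <= k i) -> (forall i, k i <= `|h i| *+ 2) ->
      exists s, hassum (fun i => (k i)%:C%C) s.
    move=> k0 kh; apply: hassum_pos => //; apply: (@asum_le _ f 2) => // i.
    by rewrite normcR ger0_norm//; have := kh i; have := hf i; lra.
  have [s1 H1] : exists s, hassum (fun i => (`|h i| + h i)%:C%C) s.
    apply: Q => i; last by rewrite mulr2n lerD2l ler_norm.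
    by have := ler_norm (- h i); rewrite normrN; lra.
  have [s2 H2] : exists s, hassum (fun i => `|h i|%:C%C) s.
    by apply: Q => i //; rewrite mulr2n lerDl.
  exists (s1 + -1 * s2); apply: hassum_ext (hassumD H1 (hassumZ (-1) H2)) => i.
  by rewrite rmorphD /=; ring.
have [s H] := P (fun i => Re (f i)) (fun i => Re_le_normc _).
have [t K] := P (fun i => Im (f i)) (fun i => Im_le_normc _).
exists (s + 'i%C * t); apply: hassum_ext (hassumD H (hassumZ 'i%C K)) => i.
by rewrite -complexE.
Qed.

(** Dominated convergence for finite sums of growing length. Outside a finite set the tails of [f]
    and of all [F N] are controlled by [g]; on a finite set pointwise convergence suffices, so
    domination may fail on [A0] and before [N0]. *)
Lemma tannery (f : I -> C) (F : nat -> I -> C) (B : nat -> seq I) (S : nat -> C) (l : C)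
    (g : I -> C) (A0 : seq I) (N0 : nat) :
  (forall i, ccvg (F^~ i) (f i)) -> asum g ->
  (forall N i, (N0 <= N)%N -> i \notin A0 -> normc (F N i) <= normc (g i)) ->
  (forall N, uniq (B N)) -> (forall N i, i \notin B N -> F N i = 0) ->
  (forall N, (N0 <= N)%N -> \sum_(i <- B N) F N i = S N) -> ccvg S l -> hassum f l.
Proof.
move=> Ff ag Fg uB F0 FS Sl e e0; have e4 : 0 < e / 4%:R by lra.
have [A1 uA1 HA1] := asum_tail ag e4; exists (A0 ++ A1) => D uD AD.
have [N1 H1] := Sl _ e4; have [N2 H2] := ccvg_sum D Ff e4.
pose N := maxn N0 (maxn N1 N2).
have n0 : (N0 <= N)%N by rewrite leq_maxl.
have n1 : (N1 <= N)%N by rewrite !leq_max leqnn orbT.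
have n2 : (N2 <= N)%N by rewrite !leq_max leqnn !orbT.
have {H1} := H1 _ n1; rewrite -FS// => h1; have {H2} h2 := H2 _ n2.
have E : \sum_(i <- B N) F N i - \sum_(i <- D) F N i = \sum_(i <- B N | i \notin D) F N i.
  have Z : \sum_(i <- D | i \notin B N) F N i = 0 by apply: big1 => i /F0.
  rewrite (bigID (fun i => i \in D)) [X in _ - X](bigID (fun i => i \in B N)) /= Z addr0.
  suff -> : \sum_(i <- B N | i \in D) F N i = \sum_(i <- D | i \in B N) F N i by ring.
  rewrite -big_filter -[RHS]big_filter; apply: perm_big; apply: uniq_perm; rewrite ?filter_uniq// => i.
  by rewrite !mem_filter andbC.
have h3 : normc (\sum_(i <- B N) F N i - \sum_(i <- D) F N i) < e / 4%:R.
  rewrite E -big_filter; apply: le_lt_trans (normc_sum _ _) _.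
  apply: (@le_lt_trans _ _ (\sum_(i <- [seq i <- B N | i \notin D]) normc (g i))).
    rewrite !big_filter; apply: ler_sum => i iD; apply: Fg => //.
    by apply: contra iD => iA; apply: AD; rewrite mem_cat iA.
  apply: HA1; rewrite ?filter_uniq// => i; rewrite mem_filter => /andP[iD _].
  by apply: contra iD => iA; apply: AD; rewrite mem_cat iA orbT.
move: (\sum_(i <- D) f i) (\sum_(i <- D) F N i) (\sum_(i <- B N) F N i) h1 h2 h3 => x y z h1 h2 h3.
have -> : x - l = (z - l) - (z - y) - (y - x) by ring.
apply: le_lt_trans (le_normcB _ _) _.
by have := le_normcB (z - l) (z - y); lra.
Qed.

End OneIndex.
End Summability.

Section TwoIndex.
Variable R : realType.
Local Notation C := R[i].

Lemma hassum_inj (I J : eqType) (h : I -> J) (F : J -> C) s : injective h ->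
  (forall j, F j != 0 -> exists i, h i = j) -> hassum (F \o h) s -> hassum F s.
Proof.
move=> hI hF hs e e0; have [A HA] := hs e e0; exists (map h A) => B uB AB.
pose g j := if pselect (exists i, h i = j) is left E then Some (projT1 (cid E)) else None.
have gh : pcancel h g.
  move=> i; rewrite /g; case: pselect => [E|]; last by case; exists i.
  by congr Some; apply: hI; case: cid.
have og : ocancel g h by move=> j; rewrite /g; case: pselect => //= E; case: cid.
have -> : \sum_(j <- B) F j = \sum_(i <- pmap g B) (F \o h) i.
  elim: (B) => [|j D IH]; first by rewrite /= !big_nil.
  rewrite big_cons IH /= /g; case: pselect => [E|nE] /=.
    by rewrite big_cons /=; case: cid => i /= ->.
  by case: (eqVneq (F j) 0) => [->|/hF//]; rewrite add0r.
apply: HA; first exact: (pmap_uniq og).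
move=> i iA; rewrite mem_pmap; apply/mapP; exists (h i); rewrite ?gh//.
by apply/AB/map_f.
Qed.

Lemma hassum_bij (I J : eqType) (h : I -> J) (k : J -> I) (F : J -> C) s :
  cancel h k -> cancel k h -> hassum (F \o h) s -> hassum F s.
Proof. by move=> hk kh; apply: hassum_inj (can_inj hk) _ => j _; exists (k j). Qed.

Lemma hassum_fubini (I J : eqType) (f : I * J -> C) (g : I -> C) s :
  hassum f s -> (forall i, hassum (fun j => f (i, j)) (g i)) -> hassum g s.
Proof.
move=> fs fg e e0; have e2 : 0 < e / 2 by lra.
have [A HA] := fs _ e2; exists (map fst A) => B uB AB.
(* The error allowed in each row, so that the rows in [B] together contribute at most e / 2. *)
pose d := e / 2 / (size B).+1%:R.
have d0 : 0 < d by rewrite divr_gt0.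
have H i : exists D : seq J, [/\ uniq D, {subset map snd A <= D} &
    normc (\sum_(j <- D) f (i, j) - g i) < d].
  have [D HD] := fg i _ d0; exists (undup (map snd A ++ D)).
  split; first exact: undup_uniq.
    by move=> j jA; rewrite mem_undup mem_cat jA.
  by apply: HD (undup_uniq _) _ => j jD; rewrite mem_undup mem_cat jD orbT.
have [D HD] := choice H.
have uU : uniq [seq (i, j) | i <- B, j <- D i].
  apply: allpairs_uniq_dep => //; first by move=> i _; case: (HD i).
  by move=> [? ?] [? ?] _ _ /= [-> ->].
have /(HA _ uU) : {subset A <= [seq (i, j) | i <- B, j <- D i]}.
  move=> [i j] ijA; apply/allpairsPdep; exists i, j; split=> //.
    by apply: AB; apply/mapP; exists (i, j).
  by have [_ + _] := HD i; apply; apply/mapP; exists (i, j).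
rewrite big_allpairs_dep => h1.
have h2 : normc (\sum_(i <- B) (\sum_(j <- D i) f (i, j) - g i)) <= e / 2.
  apply: le_trans (normc_sum _ _) _.
  apply: (@le_trans _ _ (\sum_(i <- B) d)).
    by apply: ler_sum => i _; case: (HD i) => _ _ /ltW.
  rewrite big_const_seq count_predT iter_addr_0 -[leLHS]mulr_natr /d.
  by rewrite mulrAC ler_pdivrMr// ler_wpM2l ?ltW// ltr_nat.
move: h1 h2; rewrite sumrB; move: (\sum_(i <- B) g i) (\sum_(i <- B) _) => u v h1 h2.
have -> : u - s = (v - s) - (v - u) by ring.
by apply: le_lt_trans (le_normcB _ _) _; lra.
Qed.

Lemma hassum_rows (I J : eqType) (f : I * J -> C) (g : I -> C) s : asum f ->
  (forall i, hassum (fun j => f (i, j)) (g i)) -> hassum g s -> hassum f s.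
Proof.
move=> af fg gs; have [t ft] := hassum_exists af.
by rewrite (hassum_uniq gs (hassum_fubini ft fg)).
Qed.

Lemma asum_prod (I J : eqType) (u : I -> C) (v : J -> C) : asum u -> asum v ->
  asum (fun p : I * J => u p.1 * v p.2).
Proof.
move=> [M HM] [N HN]; exists (M * N) => B uB.
pose BI := undup (map fst B); pose BJ := undup (map snd B).
have uU : uniq [seq (i, j) | i <- BI, j <- BJ].
  by rewrite allpairs_uniq ?undup_uniq// => -[? ?] [? ?].
have sU : {subset B <= [seq (i, j) | i <- BI, j <- BJ]}.
  move=> [i j] ijB; apply/allpairsP; exists (i, j); rewrite !mem_undup /=.
  by split=> //; apply/mapP; exists (i, j).
apply: (@le_trans _ _ (\sum_(p <- [seq (i, j) | i <- BI, j <- BJ]) normc (u p.1 * v p.2))).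
  by rewrite (sum_subset _ uB uU sU) lerDl sumr_ge0// => *; apply: normc_ge0.
rewrite big_allpairs /=.
have -> : \sum_(i <- BI) \sum_(j <- BJ) normc (u i * v j) =
   (\sum_(i <- BI) normc (u i)) * (\sum_(j <- BJ) normc (v j)).
  rewrite mulr_suml; apply: eq_bigr => i _; rewrite mulr_sumr.
  by apply: eq_bigr => j _; rewrite normcM.
apply: ler_pM; rewrite ?sumr_ge0 ?HM ?HN ?undup_uniq// => *; exact: normc_ge0.
Qed.

Lemma hassumM (I J : eqType) (u : I -> C) (v : J -> C) s t : asum u -> asum v ->
  hassum u s -> hassum v t -> hassum (fun p : I * J => u p.1 * v p.2) (s * t).
Proof.
move=> au av us vt; apply: (@hassum_rows _ _ _ (fun i => u i * t)).
- exact: asum_prod.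
- by move=> i /=; apply: hassumZ.
- rewrite mulrC; apply: hassum_ext (hassumZ t us) => i; exact: mulrC.
Qed.

Lemma asum_nat (f : nat -> C) (M : R) :
  (forall N, \sum_(0 <= n < N) normc (f n) <= M) -> asum f.
Proof.
move=> H; exists M => B uB; pose N := (\max_(n <- B) n).+1.
have sB : {subset B <= index_iota 0 N}.
  by move=> n nB; rewrite mem_index_iota /= ltnS; apply: leq_bigmax_seq.
apply: le_trans (H N); rewrite (sum_subset _ uB (iota_uniq _ _) sB) lerDl sumr_ge0// => *.
exact: normc_ge0.
Qed.

Lemma asum_int (f : int -> C) :
  asum (fun n : nat => f (Posz n)) -> asum (fun n : nat => f (Negz n)) -> asum f.
Proof.
move=> [M HM] [N HN]; exists (M + N) => B uB.
pose gP (z : int) := if z is Posz n then Some n else None.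
pose gN (z : int) := if z is Negz n then Some n else None.
have -> : \sum_(z <- B) normc (f z) =
   \sum_(n <- pmap gP B) normc (f (Posz n)) + \sum_(n <- pmap gN B) normc (f (Negz n)).
  elim: (B) => [|[n|n] D IH] /=; rewrite ?big_nil ?addr0// !big_cons IH; ring.
apply: lerD.
  by apply/HM/(@pmap_uniq _ _ gP Posz) => // -[].
by apply/HN/(@pmap_uniq _ _ gN Negz) => // -[].
Qed.

Lemma hassum_int (f : int -> C) s t :
  hassum (fun n : nat => f n.+1%:Z) s -> hassum (fun n : nat => f (- n.+1%:Z)) t ->
  hassum f (f 0 + s + t).
Proof.
move=> fs ft.
pose fp (z : int) := if 0 < z then f z else 0.
pose fn (z : int) := if z < 0 then f z else 0.
pose f0 (z : int) := if z == 0 then f z else 0.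
have H0 : hassum f0 (f 0).
  have := @hassum_fin _ _ f0 [:: 0] isT; rewrite big_seq1 /f0 eqxx; apply.
  by move=> i; rewrite inE => /negPf->.
have Hp : hassum fp s.
  apply: (@hassum_inj _ _ (fun n : nat => n.+1%:Z) fp) => [m n []//|j|].
    rewrite /fp; case: ifP => [j0 _|]; last by rewrite eqxx.
    by exists (`|j|.-1)%N; lia.
  by apply: hassum_ext fs => n /=.
have Hn : hassum fn t.
  apply: (@hassum_inj _ _ (fun n : nat => - n.+1%:Z) fn) => [m n /oppr_inj[]//|j|].
    rewrite /fn; case: ifP => [j0 _|]; last by rewrite eqxx.
    by exists (`|j|.-1)%N; lia.
  by apply: hassum_ext ft => n /=.
apply: hassum_ext (hassumD (hassumD H0 Hp) Hn) => z; rewrite /f0 /fp /fn.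
by case: ltrgt0P => [z0|z0|->]; rewrite ?addr0 ?add0r.
Qed.

End TwoIndex.

Section Geom.
Variable R : realType.
Implicit Types r : R.

Lemma geom_le r N : 0 <= r -> r < 1 -> \sum_(0 <= n < N) r ^+ n <= (1 - r)^-1.
Proof.
move=> r0 r1; rewrite -[leRHS]mul1r ler_pdivlMr ?subr_gt0//.
have -> : (\sum_(0 <= n < N) r ^+ n) * (1 - r) = 1 - r ^+ N.
  elim: N => [|N IH]; first by rewrite big_nil mul0r expr0 subrr.
  by rewrite big_nat_recr//= mulrDl IH exprS; ring.
by rewrite gerBl exprn_ge0.
Qed.

End Geom.

(** * Power series on the unit disc *)

Section Conv.
Variable R : realType.
Local Notation C := R[i].
Implicit Types f g : fps C.

(** Radius of convergence at least 1. Boundedness at every r < 1 is easier to carry through the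
    operations than summability, which follows by comparison with a slightly larger radius, see
    [conv_bound]. *)
Definition conv f : Prop :=
  forall r : R, 0 < r -> r < 1 -> exists M : R, forall n, normc (f n) * r ^+ n <= M.

Lemma conv_le f g (c : R) : conv g -> (forall n, normc (f n) <= c * normc (g n)) -> conv f.
Proof.
move=> cg fg r r0 r1; have [M HM] := cg r r0 r1; exists (`|c| * `|M|) => n.
apply: le_trans (ler_wpM2r (exprn_ge0 _ (ltW r0)) (fg n)) _.
rewrite -mulrA; apply: le_trans (ler_wpM2r _ (ler_norm c)) _.
  by rewrite mulr_ge0 ?normc_ge0// exprn_ge0// ltW.
by rewrite ler_wpM2l// (le_trans (HM n))// ler_norm.
Qed.

Lemma natM_exprn_le (r : R) n : 0 <= r -> r < 1 -> n.+1%:R * r ^+ n <= (1 - r)^-1.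
Proof.
move=> r0 r1; apply: le_trans (geom_le n.+1 r0 r1).
rewrite mulr_natl -[X in _ *+ X](subn0 n.+1) -sumr_const_nat; apply: ler_sum_nat => i /andP[_].
by rewrite ltnS => ni; rewrite ler_wiXn2l// ltW.
Qed.

Lemma conv_natM f : conv f -> conv (fun n => n.+1%:R * f n).
Proof.
move=> cf r r0 r1; pose s := (1 + r) / 2.
have s0 : 0 < s by rewrite /s; lra.
have s1 : s < 1 by rewrite /s; lra.
have [M HM] := cf s s0 s1; pose q := r / s.
have q0 : 0 <= q by rewrite divr_ge0// ltW.
have q1 : q < 1 by rewrite ltr_pdivrMr// mul1r /s; lra.
exists ((1 - q)^-1 * `|M|) => n.
have -> : r = q * s by rewrite divfK// gt_eqF.
rewrite normcM normc_nat exprMn.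
have -> : n.+1%:R * normc (f n) * (q ^+ n * s ^+ n) = (n.+1%:R * q ^+ n) * (normc (f n) * s ^+ n).
  by ring.
apply: ler_pM; rewrite ?mulr_ge0 ?exprn_ge0 ?normc_ge0 ?natM_exprn_le ?(ltW s0)//.
by rewrite (le_trans (HM n))// ler_norm.
Qed.

Lemma conv_cst (c : C) : conv (fun=> c).
Proof.
move=> r r0 r1; exists (normc c) => n.
by rewrite ler_piMr ?normc_ge0// exprn_ile1// ltW.
Qed.

Lemma conv_natX (k : nat) : conv (fun n => (n.+1%:R) ^+ k).
Proof.
elim: k => [|k IH]; first exact: conv_cst.
by apply: (conv_le (c := 1) (conv_natM IH)) => n; rewrite mul1r exprS.
Qed.

Lemma conv1 : conv 1.
Proof.
apply: (conv_le (c := 1) (conv_cst 1)) => n.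
by rewrite mul1r normc1 fps1; case: eqP; rewrite ?normc1// normc0.
Qed.

Lemma conv0 : conv 0. Proof. exact: (conv_cst 0). Qed.

Lemma convX k : conv (fpsX C k).
Proof.
apply: (conv_le (c := 1) (conv_cst 1)) => n.
by rewrite mul1r normc1 /fpsXn; case: eqP; rewrite ?normc1// normc0.
Qed.

Lemma convD f g : conv f -> conv g -> conv (f + g).
Proof.
move=> cf cg r r0 r1; have [M HM] := cf r r0 r1; have [N HN] := cg r r0 r1.
exists (M + N) => n; rewrite fpsD.
apply: le_trans (ler_wpM2r (exprn_ge0 _ (ltW r0)) (le_normcD _ _)) _.
by rewrite mulrDl lerD.
Qed.

Lemma convM f g : conv f -> conv g -> conv (f * g).
Proof.
move=> cf cg r r0 r1; pose s := (1 + r) / 2.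
have s0 : 0 < s by rewrite /s; lra.
have s1 : s < 1 by rewrite /s; lra.
have [M HM] := cf s s0 s1; have [N HN] := cg s s0 s1; pose q := r / s.
have q0 : 0 <= q by rewrite divr_ge0// ltW.
have q1 : q < 1 by rewrite ltr_pdivrMr// mul1r /s; lra.
exists ((1 - q)^-1 * (`|M| * `|N|)) => n.
have -> : r = q * s by rewrite divfK// gt_eqF.
have H : normc ((f * g) n) * s ^+ n <= n.+1%:R * (`|M| * `|N|).
  rewrite fpsM; apply: le_trans (ler_wpM2r (exprn_ge0 _ (ltW s0)) (normc_sum _ _)) _.
  rewrite mulr_suml.
  apply: (@le_trans _ _ (\sum_(i < n.+1) (`|M| * `|N|))); last first.
    by rewrite sumr_const card_ord [leRHS]mulr_natl.
  apply: ler_sum => i _.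
  have -> : s ^+ n = s ^+ i * s ^+ (n - i) by rewrite -exprD subnKC ?(ltnSE (ltn_ord i)).
  rewrite normcM mulrACA; apply: ler_pM; rewrite ?mulr_ge0 ?normc_ge0 ?exprn_ge0 ?(ltW s0)//.
    by rewrite (le_trans (HM i))// ler_norm.
  by rewrite (le_trans (HN _))// ler_norm.
rewrite exprMn mulrCA; apply: le_trans (ler_wpM2l (exprn_ge0 _ q0) H) _.
have := ler_wpM2r (mulr_ge0 (normr_ge0 M) (normr_ge0 N)) (natM_exprn_le n q0 q1).
by rewrite [n.+1%:R * _]mulrC -mulrA.
Qed.

Lemma conv_expr f k : conv f -> conv (f ^+ k).
Proof.
by move=> cf; elim: k => [|k IH]; [exact: conv1|rewrite exprS; apply: convM].
Qed.

Lemma convC (c : C) f : conv f -> conv (fpsC c * f).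
Proof.
by move=> cf; apply: (conv_le (c := normc c) cf) => n; rewrite fpsCM normcM.
Qed.

Lemma conv_sum I (r : seq I) (F : I -> fps C) : (forall i, conv (F i)) ->
  conv (\sum_(i <- r) F i).
Proof.
move=> H; elim: r => [|i r IH]; first by rewrite big_nil; apply: conv0.
by rewrite big_cons; apply: convD.
Qed.

Lemma convN f : conv f -> conv (- f).
Proof. by move=> cf; apply: (conv_le (c := 1) cf) => n; rewrite mul1r fpsN normcN. Qed.

(* r is replaced by a p-th root bound: r <= s ^ p for some s < 1. *)
Lemma conv_Lam p f : (0 < p)%N -> conv f -> conv (fps_Lam p f).
Proof.
move=> p0 cf r r0 r1; pose s := 1 - (1 - r) / p%:R.
have p0' : 0 < p%:R :> R by rewrite ltr0n.
have p1 : 1 <= p%:R :> R by rewrite ler1n.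
have d0 : 0 < (1 - r) / p%:R by rewrite divr_gt0 ?subr_gt0.
have d1 : (1 - r) / p%:R < 1 by rewrite ltr_pdivrMr// mul1r; lra.
have s0 : 0 < s by rewrite /s; lra.
have s1 : s < 1 by rewrite /s; lra.
have rs : r <= s ^+ p.
  have bern k : 1 - k%:R * ((1 - r) / p%:R) <= s ^+ k.
    elim: k => [|k IH]; first by rewrite mul0r subr0.
    rewrite exprSr; apply: le_trans (ler_wpM2r (ltW s0) IH).
    rewrite /s -natr1; set d := (1 - r) / _ in d0 d1 *.
    have := mulr_ge0 (mulr_ge0 (ler0n R k) (ltW d0)) (ltW d0).
    by lra.
  by apply: le_trans (bern p); rewrite mulrC divfK ?gt_eqF//; lra.
have [M HM] := cf s s0 s1; exists M => n; apply: le_trans (HM (n * p)%N).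
by rewrite /fps_Lam ler_wpM2l ?normc_ge0// mulnC exprM lerXn2r// nnegrE ?exprn_ge0 ?ltW.
Qed.

Lemma conv_V p f : (0 < p)%N -> conv f -> conv (fps_V p f).
Proof.
move=> p0 cf r r0 r1; have [M HM] := cf r r0 r1; exists `|M| => n.
rewrite /fps_V; case: ifP => [/dvdnP[k ->]|]; last by rewrite normc0 mul0r.
rewrite mulnK//; apply: (@le_trans _ _ (normc (f k) * r ^+ k)).
  by rewrite ler_wpM2l ?normc_ge0// ler_wiXn2l ?ltW// leq_pmulr.
by rewrite (le_trans (HM k))// ler_norm.
Qed.

(* A solution of q f' = s f grows at most polynomially relative to s. *)
Lemma conv_ode (s f : fps C) : s 0%N = 0 -> fps_deriv f = s * f -> conv s -> conv f.
Proof.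
move=> s00 Df cs r r0 r1; pose t := (1 + r) / 2.
have t0 : 0 < t by rewrite /t; lra.
have t1 : t < 1 by rewrite /t; lra.
have [M HM] := cs t t0 t1.
pose K := (Num.truncn `|M|).+1.
have MK n : normc (s n) * t ^+ n <= K%:R.
  apply: le_trans (HM n) _; apply: le_trans (ler_norm _) _.
  by apply: ltW; rewrite /K; apply: truncnS_gt.
pose g n := normc (f n) * t ^+ n.
have g0 n : 0 <= g n by rewrite mulr_ge0 ?normc_ge0// exprn_ge0// ltW.
have rec n : n.+1%:R * g n.+1 <= K%:R * \sum_(0 <= i < n.+1) g i.
  have : normc (n.+1%:R * f n.+1) = normc ((s * f) n.+1) by rewrite -Df.
  rewrite normcM normc_nat => E; rewrite /g mulrA E fpsM big_ord_recl s00 mul0r add0r.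
  apply: le_trans (ler_wpM2r (exprn_ge0 _ (ltW t0)) (normc_sum _ _)) _.
  rewrite mulr_suml mulr_sumr big_nat_rev /= add0n big_mkord; apply: ler_sum => i _.
  rewrite /= normcM /bump /= add1n !subSS.
  have -> : t ^+ n.+1 = t ^+ i.+1 * t ^+ (n - i) by rewrite -exprD addSn subnKC// -ltnS.
  by rewrite mulrACA; apply: (ler_wpM2r (g0 (n - i)%N) (MK i.+1)).
(* A discrete Gronwall argument: [rec] multiplies the partial sum by at most 1 + K / (n + 1), which
   Bernoulli's inequality bounds by ((n + 2) / (n + 1))^K, and these factors telescope. For this K
   is a natural number. *)
have sumle n : \sum_(0 <= i < n.+1) g i <= g 0%N * n.+1%:R ^+ K.
  elim: n => [|n IH]; first by rewrite big_nat1 expr1n mulr1.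
  rewrite big_nat_recr//=; set S := \sum_(_ <= _ < _) _ in IH rec *.
  have n1 : 0 < n.+1%:R :> R by rewrite ltr0n.
  have h1 : g n.+1 <= K%:R / n.+1%:R * S.
    by have := rec n; rewrite -/S mulrAC ler_pdivlMr// mulrC.
  have S0 : 0 <= S by rewrite sumr_ge0.
  apply: (@le_trans _ _ (S * (1 + K%:R / n.+1%:R))); first by rewrite mulrDr mulr1 lerD2l mulrC.
  have bern k : 1 + k%:R / n.+1%:R <= (n.+2%:R / n.+1%:R : R) ^+ k.
    elim: k => [|k IHk]; first by rewrite mul0r addr0.
    have q0 : 0 <= n.+2%:R / n.+1%:R :> R by rewrite divr_ge0.
    rewrite exprSr; apply: le_trans (ler_wpM2r q0 IHk).
    have -> : n.+2%:R / n.+1%:R = 1 + n.+1%:R^-1 :> R.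
      by rewrite -natr1 mulrDl divff ?gt_eqF// mul1r.
    set d := n.+1%:R^-1; have d0 : 0 <= d by rewrite invr_ge0.
    rewrite -natr1; have := mulr_ge0 (mulr_ge0 (ler0n R k) d0) d0.
    by lra.
  apply: le_trans (ler_pM S0 _ IH (bern K)) _; first by rewrite addr_ge0// divr_ge0.
  by rewrite -mulrA -exprMn [n.+1%:R * _]mulrC divfK ?gt_eqF.
have fin n : normc (f n) * t ^+ n <= g 0%N * n.+1%:R ^+ K.
  apply: le_trans (sumle n); rewrite big_nat_recr//= lerDr sumr_ge0//.
pose q := r / t.
have q0 : 0 < q by rewrite divr_gt0.
have q1 : q < 1 by rewrite ltr_pdivrMr// mul1r /t; lra.
have [N HN] := conv_natX K q0 q1; exists (g 0%N * N) => n.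
have -> : r = q * t by rewrite divfK// gt_eqF.
rewrite exprMn mulrCA; apply: le_trans (ler_wpM2l (exprn_ge0 _ (ltW q0)) (fin n)) _.
rewrite mulrCA ler_wpM2l// mulrC.
by have := HN n; rewrite normcX normc_nat.
Qed.

Lemma conv_bound f (x : R) : conv f -> 0 <= x -> x < 1 -> exists2 M : R, 0 <= M &
  exists2 q : R, 0 <= q < 1 & forall n, normc (f n) * x ^+ n <= M * q ^+ n.
Proof.
move=> cf x0 x1; pose r := (1 + x) / 2.
have r0 : 0 < r by rewrite /r; lra.
have r1 : r < 1 by rewrite /r; lra.
have [M HM] := cf r r0 r1; exists `|M| => //; exists (x / r).
  rewrite divr_ge0 ?(ltW r0)//= ltr_pdivrMr// mul1r /r; lra.
move=> n; have {1}-> : x = x / r * r by rewrite divfK// gt_eqF.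
have q0 : 0 <= x / r by apply: divr_ge0 => //; exact: ltW.
rewrite exprMn mulrCA [leRHS]mulrC ler_wpM2l ?exprn_ge0//.
by rewrite (le_trans (HM n))// ler_norm.
Qed.

Lemma asum_conv f (x : C) : conv f -> normc x < 1 -> asum (fun n => f n * x ^+ n).
Proof.
move=> cf x1; have [M M0 [q /andP[q0 q1] H]] := conv_bound cf (normc_ge0 x) x1.
apply: (@asum_nat _ _ (M * (1 - q)^-1)) => N.
apply: (@le_trans _ _ (\sum_(0 <= n < N) M * q ^+ n)).
  by apply: ler_sum => n _; rewrite normcM normcX.
by rewrite -mulr_sumr ler_wpM2l// geom_le.
Qed.

(** The value of the series at x, with default 0 if it is not summable; [evP] excludes the default
    inside the disc. *)
Definition ev f (x : C) : C := xget 0 [set s | hassum (fun n => f n * x ^+ n) s]%classic.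

Lemma evE f x s : hassum (fun n => f n * x ^+ n) s -> ev f x = s.
Proof. by move=> H; apply: xget_unique => // t Ht; apply: hassum_uniq Ht H. Qed.

Lemma evP f x : conv f -> normc x < 1 -> hassum (fun n => f n * x ^+ n) (ev f x).
Proof.
by move=> cf x1; have [s H] := hassum_exists (asum_conv cf x1); rewrite (evE H).
Qed.

Lemma evD f g x : conv f -> conv g -> normc x < 1 -> ev (f + g) x = ev f x + ev g x.
Proof.
move=> cf cg x1; apply: evE; apply: hassum_ext (hassumD (evP cf x1) (evP cg x1)) => n.
by rewrite fpsD mulrDl.
Qed.

Lemma evCM c f x : conv f -> normc x < 1 -> ev (fpsC c * f) x = c * ev f x.
Proof.
move=> cf x1; apply: evE; apply: hassum_ext (hassumZ c (evP cf x1)) => n.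
by rewrite fpsCM mulrA.
Qed.

Lemma ev0 x : ev 0 x = 0.
Proof. by apply: evE; apply: hassum_ext (@hassum0 R _) => n; rewrite fps0 mul0r. Qed.

Lemma ev_sum I (r : seq I) (F : I -> fps C) x : (forall i, conv (F i)) -> normc x < 1 ->
  ev (\sum_(i <- r) F i) x = \sum_(i <- r) ev (F i) x.
Proof.
move=> H x1; elim: r => [|i r IH]; first by rewrite !big_nil ev0.
by rewrite !big_cons evD ?IH//; apply: conv_sum.
Qed.

Lemma evXn k x : ev (fpsX C k) x = x ^+ k.
Proof.
apply: evE; have := @hassum_fin R _ (fun n => fpsX C k n * x ^+ n) [:: k] isT.
have E : fpsX C k k = 1 by rewrite /fpsXn eqxx.
rewrite big_seq1 E mul1r; apply=> n; rewrite inE /fpsXn => /negPf->.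
by rewrite mul0r.
Qed.

Lemma ev1 x : ev 1 x = 1. Proof. exact: (evXn 0). Qed.

Lemma evM f g x : conv f -> conv g -> normc x < 1 -> ev (f * g) x = ev f x * ev g x.
Proof.
move=> cf cg x1; apply: evE.
have H := hassumM (asum_conv cf x1) (asum_conv cg x1) (evP cf x1) (evP cg x1).
(* The pair (i, j) is recorded as (i + j, i), so that summing over the second entry first yields the
   coefficients of the Cauchy product. *)
pose h (p : nat * nat) := (p.1 + p.2, p.1)%N.
pose F (p : nat * nat) := if (p.2 <= p.1)%N then f p.2 * g (p.1 - p.2)%N * x ^+ p.1 else 0.
have HF : hassum F (ev f x * ev g x).
  apply: (@hassum_inj _ _ _ h).
  - by move=> [a b] [c d] [/= E1 E2]; congr (_, _); lia.
  - move=> [n i]; rewrite /F /=; case: leqP => ni; last by rewrite eqxx.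
    by exists (i, n - i)%N; rewrite /h /= subnKC.
  apply: hassum_ext H => -[i j]; rewrite /F /h /= leq_addr addKn exprD; ring.
apply: hassum_fubini HF _ => n.
rewrite fpsM mulr_suml.
have := @hassum_fin R _ (fun i => F (n, i)) (iota 0 n.+1) (iota_uniq _ _).
rewrite -[iota 0 n.+1]/(index_iota 0 n.+1) big_mkord.
have -> : \sum_(i < n.+1) F (n, i : nat) = \sum_(i < n.+1) f i * g (n - i)%N * x ^+ n.
  by apply: eq_bigr => i _; rewrite /F /= -ltnS ltn_ord.
by apply=> i; rewrite mem_index_iota /= ltnS /F /= => /negPf->.
Qed.

Lemma evX f k x : conv f -> normc x < 1 -> ev (f ^+ k) x = ev f x ^+ k.
Proof.
move=> cf x1; elim: k => [|k IH]; first by rewrite !expr0 ev1.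
by rewrite !exprS evM ?IH//; apply: conv_expr.
Qed.

Lemma ev_V p f x : (0 < p)%N -> conv f -> normc x < 1 -> ev (fps_V p f) x = ev f (x ^+ p).
Proof.
move=> p0 cf x1; apply: evE; apply: (@hassum_inj _ _ _ (fun n => n * p)%N).
- by move=> a b /eqP; rewrite eqn_pmul2r// => /eqP.
- move=> n; rewrite /fps_V; case: ifP => [/dvdnP[k ->] _|]; first by exists k.
  by rewrite mul0r eqxx.
have xp : normc (x ^+ p) < 1.
  by rewrite normcX exprn_ilt1 ?normc_ge0 -?lt0n.
apply: hassum_ext (evP cf xp) => n; rewrite /= /fps_V dvdn_mull// mulnK//.
by rewrite mulnC exprM.
Qed.

Definition cfps (f : fps int) : fps C := fun n => (f n)%:~R.

Lemma cfpsD (f g : fps int) : cfps (f + g) = cfps f + cfps g.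
Proof. by apply/funext => n; rewrite /cfps fpsD intrD. Qed.
Lemma cfpsN (f : fps int) : cfps (- f) = - cfps f.
Proof. by apply/funext => n; rewrite /cfps fpsN intrN. Qed.
Lemma cfpsM (f g : fps int) : cfps (f * g) = cfps f * cfps g.
Proof.
apply/funext => n; rewrite /cfps !fpsM rmorph_sum /=.
by apply: eq_bigr => i _; rewrite intrM.
Qed.
Lemma cfps1 : cfps 1 = 1.
Proof. by apply/funext => n; rewrite /cfps !fps1 rmorph_nat. Qed.
Lemma cfpsX (f : fps int) k : cfps (f ^+ k) = cfps f ^+ k.
Proof. by elim: k => [|k IH]; rewrite ?cfps1// !exprS cfpsM IH. Qed.
Lemma cfpsXn k : cfps (fpsX int k) = fpsX C k.
Proof. by apply/funext => n; rewrite /cfps /fpsXn rmorph_nat. Qed.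
Lemma cfps_deriv (f : fps int) : cfps (fps_deriv f) = fps_deriv (cfps f).
Proof. by apply/funext => n; rewrite /cfps /fps_deriv intrM rmorph_nat. Qed.
Lemma cfps_sum I (r : seq I) (F : I -> fps int) :
  cfps (\sum_(i <- r) F i) = \sum_(i <- r) cfps (F i).
Proof.
elim: r => [|i r IH]; last by rewrite !big_cons cfpsD IH.
by rewrite !big_nil; apply/funext => n; rewrite /cfps.
Qed.
Lemma cfpsC c (f : fps int) : cfps (fpsC c * f) = fpsC c%:~R * cfps f.
Proof. by apply/funext => n; rewrite /cfps !fpsCM intrM. Qed.

Lemma conv_poly (f : fps int) (c k : nat) : (forall n, `|f n| <= c%:Z * (n.+1)%:Z ^+ k) ->
  conv (cfps f).
Proof.
move=> H; apply: (conv_le (c := c%:R) (conv_natX k)) => n.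
rewrite /cfps normc_int normcX normc_nat.
have := H n; rewrite -(ler_int R) intrM rmorphXn /=.
by [].
Qed.

Lemma conv_lam phi (c k : nat) :
  (forall a x, (0 < a)%N -> (0 < x)%N -> `|phi a x| <= c%:Z * (a * x)%:Z ^+ k) ->
  conv (cfps (lam phi)).
Proof.
move=> H; apply: (@conv_poly _ c k.+1) => n; rewrite lam_dvd.
apply: le_trans (ler_norm_sum _ _ _) _.
apply: (@le_trans _ _ (\sum_(1 <= a < n.+1) c%:Z * n%:Z ^+ k)).
  apply: ler_sum_nat => a /andP[a1 an]; case: ifP => [an'|_].
    have := H a (n %/ a)%N; rewrite divn_gt0// [(a * _)%N]mulnC divnK//; apply => //.
  by rewrite normr0 mulr_ge0// exprn_ge0.
rewrite sumr_const_nat subSS subn0 -[leLHS]mulr_natr natz exprSr mulrA ler_pM//.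
- by rewrite mulr_ge0// exprn_ge0.
- by rewrite ler_wpM2l// lerXn2r// ?nnegrE//; lia.
- lia.
Qed.

End Conv.

(** * The exponential and the upper half plane *)

Section Exponential.
Variable R : realType.
Local Notation C := R[i].
Implicit Types z w : C.

Definition tau2 : R := pi *+ 2.

(** The function exp (2 i pi z), so [ce z] is the q of the expansions. *)
Definition ce z : C :=
  Complex (expR (- (tau2 * Im z)) * cos (tau2 * Re z)) (expR (- (tau2 * Im z)) * sin (tau2 * Re z)).

Lemma tau2_gt0 : 0 < tau2. Proof. by rewrite /tau2 mulr2n addr_gt0// pi_gt0. Qed.

Lemma ceD z w : ce (z + w) = ce z * ce w.
Proof.
case: z w => [a b] [c d]; rewrite /ce /= !mulrDr opprD expRD cosD sinD.
by congr Complex; ring.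
Qed.

Lemma normc_ce z : normc (ce z) = expR (- (tau2 * Im z)).
Proof.
apply/eqP; rewrite -(@eqrXn2 _ 2)// ?normc_ge0 ?expR_ge0// sqr_normc /=.
by rewrite !exprMn -mulrDr cos2Dsin2 mulr1.
Qed.

Lemma ce_neq0 z : ce z != 0.
Proof. by rewrite -normc_gt0 normc_ce expR_gt0. Qed.

Lemma ce0 : ce 0 = 1.
Proof. by rewrite /ce /= !mulr0 oppr0 expR0 cos0 sin0 mulr0 mulr1. Qed.

Lemma ceN z : ce (- z) = (ce z)^-1.
Proof.
apply: (mulfI (ce_neq0 z)); rewrite -ceD subrr ce0 divff//; exact: ce_neq0.
Qed.

Lemma ceMn z n : ce (z * n%:R) = ce z ^+ n.
Proof.
elim: n => [|n IH]; first by rewrite mulr0 ce0 expr0.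
by rewrite -natr1 mulrDr mulr1 ceD IH exprSr.
Qed.

Lemma ce1 : ce 1 = 1.
Proof. by rewrite /ce /= mulr0 oppr0 expR0 mulr1 /tau2 cos2pi sin2pi mulr0 mulr1. Qed.

Lemma ce_nat n : ce n%:R = 1.
Proof. by rewrite -[n%:R]mul1r ceMn ce1 expr1n. Qed.

Lemma ce_int (n : int) : ce n%:~R = 1.
Proof. by case: n => n; [exact: ce_nat|rewrite NegzE intrN ceN ce_nat invr1]. Qed.

Lemma ceDint z (n : int) : ce (z + n%:~R) = ce z.
Proof. by rewrite ceD ce_int mulr1. Qed.

Lemma normc_ce_lt1 z : 0 < Im z -> normc (ce z) < 1.
Proof. by move=> z0; rewrite normc_ce expR_lt1 oppr_lt0 mulr_gt0// tau2_gt0. Qed.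

Lemma ce_real_neq1 (x : R) : 0 < x -> x < 1 -> ce x%:C%C != 1.
Proof.
move=> x0 x1; apply/eqP => /(congr1 (fun w : C => Re w)); rewrite /ce /= mulr0 oppr0 expR0 mul1r.
have -> : tau2 * x = (pi * x) *+ 2 by rewrite /tau2 mulrnAl.
rewrite cos_mulr2n cos2sin2 => E.
have : 0 < sin (pi * x).
  by apply: sin_gt0_pi; rewrite mulr_gt0 ?pi_gt0//= gtr_pMr// pi_gt0.
by move=> s0; have := exprn_gt0 2 s0; lra.
Qed.

Lemma ce_root_eq1 (d N : nat) : (0 < N)%N -> (ce (d%:R / N%:R) == 1) = (N %| d)%N.
Proof.
move=> N0; have N0' : N%:R != 0 :> C by rewrite pnatr_eq0 -lt0n.
rewrite {1}(divn_eq d N) natrD natrM mulrDl mulfK// ceD ce_nat mul1r.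
have [d0|d0] := eqVneq (d %% N)%N 0%N; first by rewrite d0 mul0r ce0 eqxx; apply/esym/eqP.
transitivity false; last by apply/esym/negbTE; rewrite /dvdn d0.
apply/negbTE.
have -> : (d %% N)%:R / N%:R = ((d %% N)%:R / N%:R : R)%:C%C.
  by rewrite rmorphM fmorphV !rmorph_nat.
apply: ce_real_neq1; first by apply: divr_gt0; rewrite ltr0n// lt0n.
by rewrite ltr_pdivrMr ?ltr0n// mul1r ltr_nat ltn_pmod.
Qed.

Lemma sum_roots (d N : nat) : (0 < N)%N ->
  \sum_(j < N) ce ((j * d)%:R / N%:R) = if (N %| d)%N then N%:R else 0.
Proof.
move=> N0; have N0' : N%:R != 0 :> C by rewrite pnatr_eq0 -lt0n.
have E (j : nat) : ce ((j * d)%:R / N%:R) = ce (d%:R / N%:R) ^+ j.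
  by rewrite -ceMn natrM; congr ce; ring.
under eq_bigr do rewrite E.
rewrite -(ce_root_eq1 d N0); case: eqP => [->|/eqP w1].
  by under eq_bigr do rewrite expr1n; rewrite sumr_const card_ord.
apply: (mulfI (_ : ce (d%:R / N%:R) - 1 != 0)); first by rewrite subr_eq0.
by rewrite -subrX1 mulr0 -ceMn divfK// ce_nat subrr.
Qed.

Lemma ImD z w : Im (z + w) = Im z + Im w. Proof. by case: z w => [? ?] []. Qed.
Lemma ReD z w : Re (z + w) = Re z + Re w. Proof. by case: z w => [? ?] []. Qed.
Lemma Im_nat n : Im (n%:R : C) = 0.
Proof. by rewrite -(rmorph_nat (real_complex R)). Qed.
Lemma Im_int (n : int) : Im (n%:~R : C) = 0.
Proof. by rewrite -(rmorph_int (real_complex R)). Qed.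
Lemma Re_int (n : int) : Re (n%:~R : C) = n%:~R.
Proof. by rewrite -(rmorph_int (real_complex R)). Qed.
Lemma ImMr z (x : R) : Im (z * x%:C%C) = Im z * x.
Proof. by case: z => a b /=; rewrite mulr0 add0r. Qed.
Lemma ReMr z (x : R) : Re (z * x%:C%C) = Re z * x.
Proof. by case: z => a b /=; rewrite mulr0 subr0. Qed.
Lemma ImMn z n : Im (z * n%:R) = Im z * n%:R.
Proof. by rewrite -(rmorph_nat (real_complex R)) ImMr. Qed.
Lemma ReMn z n : Re (z * n%:R) = Re z * n%:R.
Proof. by rewrite -(rmorph_nat (real_complex R)) ReMr. Qed.
Lemma Im_divn z n : Im (z / n%:R) = Im z / n%:R.
Proof. by rewrite -(rmorph_nat (real_complex R)) -fmorphV ImMr. Qed.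
Lemma Re_divn z n : Re (z / n%:R) = Re z / n%:R.
Proof. by rewrite -(rmorph_nat (real_complex R)) -fmorphV ReMr. Qed.

(** The points (z + j) / N give all N-th roots of q; by orthogonality of the roots of unity only the
    exponents divisible by N survive in the sum. *)
Lemma ev_Lam (f : fps C) z N : conv f -> 0 < Im z -> (0 < N)%N ->
  \sum_(j < N) ev f (ce ((z + j%:R) / N%:R)) = N%:R * ev (fps_Lam N f) (ce z).
Proof.
move=> cf z0 N0; have N0' : N%:R != 0 :> C by rewrite pnatr_eq0 -lt0n.
have zN (j : nat) : normc (ce ((z + j%:R) / N%:R)) < 1.
  by apply: normc_ce_lt1; rewrite Im_divn ImD Im_nat addr0 divr_gt0// ltr0n.
have H := @hassum_sum R _ _ (index_enum 'I_N) _ _ (fun j : 'I_N => evP cf (zN j)).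
apply: hassum_uniq H _.
have cL := conv_Lam N0 cf.
have := hassumZ N%:R (evP cL (normc_ce_lt1 z0)).
pose x := ce (z / N%:R).
have E l : \sum_(j < N) f l * ce ((z + j%:R) / N%:R) ^+ l =
   if (N %| l)%N then N%:R * (f l * x ^+ l) else 0.
  rewrite -[RHS](_ : f l * x ^+ l * (if (N %| l)%N then N%:R else 0) = _); last first.
    by case: ifP => _; rewrite ?mulr0//; ring.
  rewrite -sum_roots// mulr_sumr; apply: eq_bigr => j _.
  rewrite mulrDl ceD exprMn -/x mulrA; congr (_ * _).
  by rewrite -ceMn natrM; congr ce; rewrite mulrAC.
move=> HL; apply: (@hassum_inj _ _ _ (fun n => n * N)%N).
- by move=> a b /eqP; rewrite eqn_pmul2r// => /eqP.
- by move=> l; rewrite E; case: ifP => [/dvdnP[k ->] _|]; [exists k|rewrite eqxx].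
apply: hassum_ext HL => n; rewrite /= E dvdn_mull// /fps_Lam; congr (_ * (_ * _)).
by rewrite /x -ceMn natrM [n%:R * _]mulrC mulrA divfK// ceMn.
Qed.

(** Cauchy's estimate. A twisted average over the translates z + j / N keeps only the exponents
    congruent to n mod N. For N larger than n and than every element of a finite set [A], all of
    these except n lie in a tail of size at most e. At the end Im z tends to 0. *)
Lemma coef_le (f : fps C) (S : R) : conv f ->
  (forall z, 0 < Im z -> normc (ev f (ce z)) <= S) -> forall n, normc (f n) <= S.
Proof.
move=> cf fS n.
have H (y : R) : 0 < y -> normc (f n) * expR (- (tau2 * y)) ^+ n <= S.
  move=> y0; pose z : C := Complex 0 y; have z0 : 0 < Im z by [].
  pose x := ce z; have x1 : normc x < 1 by apply: normc_ce_lt1.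
  have nx : normc x = expR (- (tau2 * y)) by rewrite normc_ce.
  rewrite -nx -normcX -normcM; apply/ler_addgt0Pr => e e0.
  have [A uA HA] := asum_tail (asum_conv cf x1) e0.
  pose N := (n + \max_(l <- A) l).+1.
  have N0 : (0 < N)%N by [].
  have nN : (n < N)%N by rewrite ltnS leq_addr.
  have AN l : l \in A -> (l < N)%N.
    by move=> lA; rewrite ltnS; apply: leq_trans (leq_addl _ _); apply: leq_bigmax_seq.
  have N0' : N%:R != 0 :> C by rewrite pnatr_eq0.
  have zj (j : nat) : 0 < Im (z + j%:R / N%:R) by rewrite ImD Im_divn Im_nat mul0r addr0.
  (* A natural number congruent to - n mod N. *)
  pose m := (N.-1 * n)%N.
  have H := @hassum_sum R _ _ (index_enum 'I_N) _ _
    (fun j : 'I_N => hassumZ (ce ((j * m)%:R / N%:R)) (evP cf (normc_ce_lt1 (zj j)))).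
  set T := \sum_(_ <- _) _ in H.
  have TS : normc (N%:R^-1 * T) <= S.
    rewrite normcM normcV normc_nat mulrC ler_pdivrMr ?ltr0n//.
    apply: le_trans (normc_sum _ _) _.
    apply: (@le_trans _ _ (\sum_(j < N) S)); last by rewrite sumr_const card_ord mulr_natr.
    apply: ler_sum => j _; rewrite normcM normc_ce Im_divn Im_nat mul0r mulr0 oppr0 expR0 mul1r.
    exact: fS.
  have {}H := hassumZ N%:R^-1 H.
  have E l : N%:R^-1 * (\sum_(j < N) ce ((j * m)%:R / N%:R) * (f l * ce (z + j%:R / N%:R) ^+ l)) =
      if (N %| l + m)%N then f l * x ^+ l else 0.
    rewrite -[RHS](_ : N%:R^-1 * (f l * x ^+ l * (if (N %| l + m)%N then N%:R else 0)) = _); last first.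
      by case: ifP => _; rewrite ?mulr0// mulrCA mulVf// mulr1.
    rewrite -sum_roots// !mulr_sumr; apply: eq_bigr => j _; congr (_ * _).
    have -> : ce ((j * (l + m))%:R / N%:R) = ce ((j * m)%:R / N%:R) * ce (j%:R / N%:R) ^+ l.
      by rewrite -ceMn -ceD; congr ce; rewrite mulnDr natrD !natrM; ring.
    by rewrite ceD exprMn -/x; ring.
  have {}H : hassum (fun l => if (N %| l + m)%N then f l * x ^+ l else 0) (N%:R^-1 * T).
    by apply: hassum_ext H => l; rewrite E.
  have Hn : hassum (fun l => if l == n then f l * x ^+ l else 0) (f n * x ^+ n).
    have := @hassum_fin R _ (fun l => if l == n then f l * x ^+ l else 0) [:: n] isT.
    by rewrite big_seq1 eqxx; apply=> l; rewrite inE => /negPf->.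
  have {Hn} := hassumD H (hassumZ (-1) Hn); rewrite mulN1r => Hd.
  have bnd : normc (N%:R^-1 * T - f n * x ^+ n) <= e.
    apply: hassum_le Hd _ => B uB.
    apply: (@le_trans _ _ (\sum_(l <- [seq l <- B | l \notin A]) normc (f l * x ^+ l))); last first.
      by apply/ltW/HA; rewrite ?filter_uniq// => l; rewrite mem_filter => /andP[].
    rewrite big_filter [leRHS]big_mkcond; apply: ler_sum => l _.
    have mod_n : (N %| l + m)%N = (l %% N == n %% N)%N.
      rewrite -(eqn_modDr m) /dvdn /m -mulSn prednK// modnMr.
      by [].
    rewrite mod_n; case: (boolP (l \in A)) => [/AN lN|_].
      rewrite !modn_small//; case: eqP => _; rewrite ?mulr0 ?addr0 ?normc0//.
      by rewrite mulN1r subrr normc0.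
    case: (l =P n) => [->|_]; last by case: ifP => _; rewrite mulr0 addr0 ?normc0// normc_ge0.
    by rewrite eqxx mulN1r subrr normc0 normc_ge0.
  have := le_normc_dist (f n * x ^+ n) (N%:R^-1 * T); rewrite normcBC.
  by lra.
(* Since |q|^n >= 1 - [tau2] y n, replacing |q|^n by 1 costs at most [c] y, and y = e / ([c] + 1)
   makes this at most e. *)
apply/ler_addgt0Pr => e e0; pose c := normc (f n) * (tau2 * n%:R).
have c0 : 0 <= c by rewrite mulr_ge0 ?normc_ge0// mulr_ge0// ltW// tau2_gt0.
have y0 : 0 < e / (c + 1) by rewrite divr_gt0// ltr_wpDl.
have := H _ y0; set y := e / (c + 1) in y0 *; rewrite -expRM_natr => h1.
have h2 : normc (f n) * (1 - tau2 * y * n%:R) <= normc (f n) * expR (- (tau2 * y) * n%:R).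
  by rewrite ler_wpM2l ?normc_ge0//; have := expR_ge1Dx (- (tau2 * y) * n%:R); lra.
have h3 : c * y <= e.
  by rewrite /y mulrCA ger_pMr// ler_pdivrMr ?ltr_wpDl//; lra.
rewrite /c in h3; move: h1 h2 h3; set u := normc _; set v := expR _; lra.
Qed.

End Exponential.

(** * Functions invariant under the Fricke involution *)

Section Liouville.
Variable R : realType.
Local Notation C := R[i].
Implicit Types z w : C.

Lemma ImV z : Im z^-1 = - Im z / normc z ^+ 2.
Proof. by rewrite sqr_normc; case: z => a b; rewrite /GRing.inv /= mulNr. Qed.
Lemma ImN z : Im (- z) = - Im z. Proof. by case: z. Qed.

Definition fricke z : C := - (3%:R * z)^-1.

Lemma Im_fricke z : Im (fricke z) = Im z / (3%:R * normc z ^+ 2).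
Proof.
rewrite /fricke ImN ImV normcM normc_nat [_ * z]mulrC ImMn exprMn.
have [->|z0] := eqVneq z 0; first by rewrite normc0 expr0n /= !mulr0 invr0 !mulr0 oppr0.
have n0 : normc z != 0 by rewrite normc_eq0.
have n3 : 3%:R != 0 :> R by rewrite pnatr_eq0.
field; by rewrite n0.
Qed.

Lemma Im_gt0_neq0 z : 0 < Im z -> z != 0.
Proof. by apply: contraTneq => ->; rewrite /= ltxx. Qed.

Lemma Im_fricke_gt0 z : 0 < Im z -> 0 < Im (fricke z).
Proof.
move=> z0; rewrite Im_fricke divr_gt0// mulr_gt0// exprn_gt0// normc_gt0.
exact: Im_gt0_neq0.
Qed.

Lemma frickeK z : z != 0 -> fricke (fricke z) = z.
Proof.
move=> z0; rewrite /fricke; have n3 : 3%:R != 0 :> C by rewrite pnatr_eq0.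
by field; rewrite ?z0 ?n3.
Qed.

Section Reduction.
Variables (K : C -> R) (S : R).
Hypothesis K_shift : forall z (n : int), K (z + n%:~R) = K z.
Hypothesis K_fricke : forall z, 0 < Im z -> K (fricke z) = K z.
Hypothesis K_high : forall z, 1 / 5%:R <= Im z -> K z <= S.

(** After a translation, |Re w| <= 1/2. If still Im w < 1/5, then 3 |w|^2 <= 3 (1/4 + 1/25) = 87/100
    < 7/8, so the Fricke involution raises the imaginary part by a factor of at least 8/7. *)
Lemma reduce_step n z : (7%:R / 8%:R) ^+ n / 5%:R <= Im z -> K z <= S.
Proof.
elim: n z => [|n IH] z; first by rewrite expr0 => /K_high.
move=> zn; pose m := Num.floor (Re z + 1 / 2).
pose w := z + (- m)%:~R; rewrite -(K_shift z (- m)) -/w.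
have wI : Im w = Im z by rewrite /w ImD Im_int addr0.
have [/K_high//|wlt] := leP (1 / 5%:R) (Im w).
have z0 : 0 < Im z by apply: lt_le_trans zn; rewrite divr_gt0// exprn_gt0// divr_gt0.
have w0 : 0 < Im w by rewrite wI.
have Rw : -(1/2) <= Re w <= 1/2.
  rewrite /w ReD Re_int intrN; have := floor_itv (Re z + 1 / 2).
  rewrite -/m intrD => /andP[]; lra.
rewrite -(K_fricke w0); apply: IH; rewrite Im_fricke sqr_normc.
set a := Re w in Rw *; set b := Im w in wI wlt w0 *.
have a2 : a ^+ 2 <= 1 / 4%:R by rewrite expr2; nra.
have b2 : b ^+ 2 <= 1 / 25%:R by rewrite expr2; nra.
have d0 : 0 < 3%:R * (a ^+ 2 + b ^+ 2).
  by rewrite mulr_gt0// ltr_wpDl ?sqr_ge0// exprn_gt0.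
rewrite ler_pdivlMr//; move: zn; rewrite exprS -wI.
set q := (7%:R / 8%:R) ^+ n => zn.
have q0 : 0 <= q by rewrite exprn_ge0// divr_ge0.
apply: le_trans zn.
have h : 3%:R * (a ^+ 2 + b ^+ 2) <= 7%:R / 8%:R by lra.
have := ler_wpM2l (_ : 0 <= q / 5%:R) h; rewrite divr_ge0// => /(_ isT); lra.
Qed.

Lemma reduce_all z : 0 < Im z -> K z <= S.
Proof.
(* From n > 2 / Im z and (8/7)^n >= 1 + n / 7 it follows that (7/8)^n / 5 <= Im z, because 2/7 >
   1/5. *)
move=> z0; pose n := (Num.truncn (2%:R / Im z)).+1.
apply: (@reduce_step n).
have hn : 2%:R / Im z < n%:R by apply: truncnS_gt.
have B (k : nat) : 1 + k%:R / 7%:R <= (8%:R / 7%:R) ^+ k :> R.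
  elim: k => [|k IH]; first by rewrite mul0r addr0.
  rewrite exprSr -natr1; have := ler0n R k; nra.
have := B n; set q := (8%:R / 7%:R) ^+ n => Bn.
have -> : (7%:R / 8%:R) ^+ n = q^-1 :> R by rewrite /q -exprVn invf_div.
have q0 : 0 < q by rewrite exprn_gt0// divr_gt0.
rewrite ler_pdivrMr// -[_^-1]mul1r ler_pdivrMr//.
have := hn; rewrite ltr_pdivrMr//; nra.
Qed.

End Reduction.

(** Otherwise (a / b)^N would be unbounded. Passing to powers in this way removes the constant
    factor from an estimate. *)
Lemma pow_bound (a b c : R) : 0 <= a -> 0 <= b -> (forall N, a ^+ N <= c * b ^+ N) -> a <= b.
Proof.
move=> a0 b0 H; rewrite leNgt; apply/negP => ba.
have a0' : 0 < a by apply: le_lt_trans ba.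
have [b00|b00] := eqVneq b 0.
  by have := H 1%N; rewrite b00 !expr1 mulr0 leNgt a0'.
have b0' : 0 < b by rewrite lt0r b00.
pose d := a / b - 1; have d0 : 0 < d by rewrite subr_gt0 ltr_pdivlMr// mul1r.
have B (k : nat) : 1 + k%:R * d <= (a / b) ^+ k.
  elim: k => [|k IH]; first by rewrite mul0r addr0.
  have ab0 : 0 <= a / b by rewrite divr_ge0// ltW.
  rewrite exprSr; apply: le_trans (ler_wpM2r ab0 IH).
  have -> : a / b = 1 + d by rewrite /d addrC subrK.
  by rewrite -natr1; have := mulr_ge0 (mulr_ge0 (ler0n R k) (ltW d0)) (ltW d0); lra.
pose N := (Num.truncn (`|c| / d)).+1.
have : `|c| / d < N%:R by apply: truncnS_gt.
rewrite ltr_pdivrMr// => h1; have := B N; have := H N.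
rewrite -ler_pdivrMr ?exprn_gt0// -expr_div_n; have := ler_norm c; lra.
Qed.

Lemma powX_low (f : fps C) N : f 0%N = 0 -> forall l, (l < N)%N -> (f ^+ N) l = 0.
Proof.
move=> f0; have -> : f = fpsX C 1 * (fun n => f (n + 1)%N).
  by apply: fps_shiftE => -[].
by move=> l lN; rewrite exprMn fpsXnX mul1n fpsXnM leqNgt lN.
Qed.

(** A bound on the region Im z >= 1/5 is a bound everywhere, by [reduce_all]. As k vanishes at q =
    0, a global bound S improves to S |q|, which is at most S [rho] on the region and hence
    everywhere. Iteration drives the bound to 0. *)
Lemma fricke_invariant_eq0 (k : fps C) : conv k -> k 0%N = 0 ->
  (forall z, 0 < Im z -> ev k (ce (fricke z)) = ev k (ce z)) -> k = 0.
Proof.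
move=> ck k0 kW.
pose K z := normc (ev k (ce z)).
have Ksh z (n : int) : K (z + n%:~R) = K z by rewrite /K ceDint.
have KW z : 0 < Im z -> K (fricke z) = K z by move=> z0; rewrite /K kW.
pose rho := expR (- (tau2 R * (1 / 5%:R))).
have rho0 : 0 <= rho by apply: expR_ge0.
have rho1 : rho < 1 by rewrite expR_lt1 oppr_lt0 mulr_gt0 ?tau2_gt0 ?divr_gt0.
have q_le z : 1 / 5%:R <= Im z -> normc (ce z) <= rho.
  by move=> z5; rewrite normc_ce ler_expR lerN2 ler_pM2l ?tau2_gt0.
have [M M0 [q /andP[q0 q1] kb]] := conv_bound ck rho0 rho1.
have high z : 1 / 5%:R <= Im z -> K z <= M / (1 - q).
  move=> z5; have x1 := le_lt_trans (q_le z z5) rho1.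
  apply: hassum_le (evP ck x1) _ => B uB.
  pose N := (\max_(n <- B) n).+1.
  have sB : {subset B <= index_iota 0 N}.
    by move=> n nB; rewrite mem_index_iota /= ltnS; apply: leq_bigmax_seq.
  apply: (@le_trans _ _ (\sum_(0 <= n < N) M * q ^+ n)).
    apply: (@le_trans _ _ (\sum_(n <- B) M * q ^+ n)).
      apply: ler_sum => n _; rewrite normcM normcX; apply: le_trans (kb n).
      by rewrite ler_wpM2l ?normc_ge0// lerXn2r ?nnegrE ?normc_ge0// q_le.
    rewrite (sum_subset _ uB (iota_uniq _ _) sB) lerDl sumr_ge0// => n _.
    by rewrite mulr_ge0// exprn_ge0.
  by rewrite -mulr_sumr ler_wpM2l// geom_le.
(* Schwarz's lemma, obtained by bounding the coefficients of the powers of k. *)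
have improve (S : R) : (forall z, 0 < Im z -> K z <= S) ->
    forall z, 0 < Im z -> K z <= S * normc (ce z).
  move=> KS z z0; have x1 := normc_ce_lt1 z0.
  have S0 : 0 <= S by apply: le_trans (normc_ge0 _) (KS z z0).
  (* The coefficients of k^N vanish below N and are at most S^N by [coef_le], so |k|^N is at most (S
     |q|)^N times the geometric series of |q|. *)
  apply: (@pow_bound _ _ (1 - normc (ce z))^-1); rewrite ?normc_ge0 ?mulr_ge0 ?normc_ge0// => N.
  have ckN := conv_expr N ck.
  have cfN : forall n, normc ((k ^+ N) n) <= S ^+ N.
    apply: coef_le ckN _ => w w0; rewrite evX ?normc_ce_lt1// normcX lerXn2r ?nnegrE ?normc_ge0//.
    exact: KS.
  rewrite /K -normcX -evX//; apply: hassum_le (evP ckN x1) _ => B uB.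
  pose N2 := (\max_(n <- B) n).+1.
  have sB : {subset B <= index_iota 0 N2}.
    by move=> n nB; rewrite mem_index_iota /= ltnS; apply: leq_bigmax_seq.
  set x := normc (ce z) in x1 *; have x0 : 0 <= x by apply: normc_ge0.
  pose g n := if (n < N)%N then 0 else S ^+ N * x ^+ n.
  have g0 n : 0 <= g n by rewrite /g; case: ifP => // _; rewrite mulr_ge0 ?exprn_ge0.
  apply: (@le_trans _ _ (\sum_(0 <= n < N2) g n)).
    apply: (@le_trans _ _ (\sum_(n <- B) g n)).
      apply: ler_sum => n _; rewrite normcM normcX /g; case: ifP => nN.
        by rewrite powX_low// normc0 mul0r.
      by rewrite ler_wpM2r ?exprn_ge0.
    by rewrite (sum_subset _ uB (iota_uniq _ _) sB) lerDl sumr_ge0.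
  apply: (@le_trans _ _ (\sum_(0 <= n < N + N2) g n)).
    by rewrite [leRHS](big_cat_nat _ (n := N2)) ?leq_addl//= lerDl sumr_ge0.
  rewrite (big_cat_nat _ (n := N)) ?leq_addr//= big_nat big1 ?add0r => [|n /andP[_ nN]]; last first.
    by rewrite /g nN.
  rewrite -{1}[N]add0n big_addn addKn.
  apply: (@le_trans _ _ (\sum_(0 <= n < N2) (S * x) ^+ N * x ^+ n)).
    apply: ler_sum_nat => n _; rewrite /g ltnNge leq_addl /= exprMn addnC exprD mulrA//.
  by rewrite -mulr_sumr mulrC ler_wpM2r ?exprn_ge0 ?mulr_ge0// geom_le.
have bnd (j : nat) z : 0 < Im z -> K z <= M / (1 - q) * rho ^+ j.
  elim: j z => [|j IH] z z0.
    by rewrite expr0 mulr1; apply: (reduce_all Ksh KW high).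
  apply: (reduce_all Ksh KW _ z0) => w w5.
  have w0 : 0 < Im w by apply: lt_le_trans w5; rewrite divr_gt0.
  apply: le_trans (improve _ IH w w0) _; rewrite exprSr mulrA ler_wpM2l ?q_le//.
  by rewrite mulr_ge0 ?exprn_ge0// divr_ge0// subr_ge0 ltW.
have K0 z : 0 < Im z -> normc (ev k (ce z)) <= 0.
  move=> z0; rewrite -/(K z); pose c := M / (1 - q) * (1 - rho)^-1.
  have c0 : 0 <= c by rewrite mulr_ge0 ?divr_ge0 ?invr_ge0 ?subr_ge0 ?(ltW q1) ?(ltW rho1).
  apply/ler_addgt0Pr => e e0; rewrite add0r.
  pose j := Num.truncn (c / e).
  have hj : c / e < j.+1%:R by apply: truncnS_gt.
  apply: le_trans (bnd j z z0) _.
  have := natM_exprn_le j rho0 rho1; rewrite mulrC -ler_pdivlMr// => h.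
  have M1 : 0 <= M / (1 - q) by rewrite divr_ge0 ?subr_ge0 ?(ltW q1).
  apply: le_trans (ler_wpM2l M1 h) _; rewrite mulrA -/c ler_pdivrMr//.
  by move: hj; rewrite ltr_pdivrMr// mulrC => /ltW.
apply/funext => n; apply/eqP; rewrite -normc_eq0 eq_le normc_ge0 andbT.
exact: coef_le ck K0 n.
Qed.

Lemma ev_eq0 (k : fps C) : conv k -> (forall z, 0 < Im z -> ev k (ce z) = 0) -> k = 0.
Proof.
move=> ck H; apply/funext => n; apply/eqP; rewrite -normc_eq0 eq_le normc_ge0 andbT.
by apply: coef_le ck _ n => z /H ->; rewrite normc0.
Qed.

End Liouville.

(** * The Lipschitz formula *)

Section ExpBounds.
Import numFieldNormedType.Exports.
Variable R : realType.
Local Notation C := R[i].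
Implicit Types z w x : C.

Lemma within_cont (f : R -> R) (a b : R) : continuous f ->
  {within `[a, b], continuous f}%classic.
Proof. exact: continuous_subspaceT. Qed.

Lemma trig_bounds_ge0 (s : R) : 0 <= s ->
  [/\ `|sin s| <= s, `|cos s - 1| <= s ^+ 2 & `|sin s - s| <= s ^+ 2].
Proof.
move=> s0.
have sinle (c : R) : 0 <= c -> `|sin c| <= c.
  move=> c0; have [d _] := MVT_segment c0 (fun u _ => is_derive_sin u)
    (within_cont (@continuous_sin R)).
  rewrite sin0 !subr0 => ->; rewrite normrM (ger0_norm c0) ler_piMl//; exact: cos_max.
have cosle (c : R) : 0 <= c -> exists2 d, 0 <= d <= c & cos c - 1 = - sin d * c.
  move=> c0; have [d] := MVT_segment c0 (fun u _ => is_derive_cos u)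
    (within_cont (@continuous_cos R)).
  by rewrite in_itv /= cos0 subr0 => dc ->; exists d.
split; first exact: sinle.
  have [d /andP[d0 ds] ->] := cosle s s0.
  rewrite normrM normrN (ger0_norm s0) expr2 ler_wpM2r//.
  exact: le_trans (sinle d d0) ds.
have [c] := MVT_segment s0 (fun u _ => is_derive_sin u)
    (within_cont (@continuous_sin R)).
rewrite in_itv /= => /andP[c0 cs]; rewrite sin0 !subr0 => ->.
have [d _ E] := cosle c c0.
have -> : cos c * s - s = (cos c - 1) * s by ring.
rewrite E normrM normrM normrN (ger0_norm s0) (ger0_norm c0) expr2 ler_wpM2r//.
by apply: le_trans cs; rewrite ler_piMl// sin_max.
Qed.

Lemma trig_bounds (s : R) :
  [/\ `|sin s| <= `|s|, `|cos s - 1| <= s ^+ 2 & `|sin s - s| <= s ^+ 2].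
Proof.
have [s0|/ltW s0] := leP 0 s; first by rewrite (ger0_norm s0); apply: trig_bounds_ge0.
have := @trig_bounds_ge0 (- s); rewrite oppr_ge0 sinN cosN sqrrN -opprD !normrN (ler0_norm s0).
by apply.
Qed.

Lemma expR_bounds (r : R) : `|r| <= 1 / 2 ->
  [/\ expR r <= 2 & `|expR r - 1 - r| <= 2 * r ^+ 2].
Proof.
rewrite ler_norml => /andP[r1 r2].
have h1 := expR_ge1Dx r; have h2 := expR_ge1Dx (- r).
have e0 := expR_gt0 r; have eN : expR r * expR (- r) = 1 by rewrite expRxMexpNx_1.
have h3 : expR r * (1 - r) <= 1 by have := ler_wpM2l (ltW e0) h2; rewrite eN.
have h4 : expR r <= 2 by nra.
split=> //; rewrite ger0_norm; first by nra.
lra.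
Qed.

(* - 2 i pi, the derivative of 1 - ce at 0 *)
Definition kap : C := Complex 0 (- tau2 R).

Lemma kap_neq0 : kap != 0.
Proof. by rewrite eq_complex /= oppr_eq0 negb_and orbC gt_eqF ?tau2_gt0. Qed.

Lemma ce_approx x : tau2 R * normc x <= 1 / 2 ->
  normc (1 - ce x - kap * x) <= 6%:R * (tau2 R * normc x) ^+ 2.
Proof.
move=> x1; have t0 := tau2_gt0 R; set t := tau2 R in x1 t0 *.
apply: le_trans (normc_le_ReIm _) _.
have hs := sqr_normc x; have hr := Re_le_normc x; have hi := Im_le_normc x.
move: hs hr hi x1; case: x => a b /=; set n := Num.sqrt _ => hs hr hi x1.
set r := - (t * b); set s := t * a.
have ra : `|r| <= 1 / 2.
  by rewrite normrN normrM (gtr0_norm t0); apply: le_trans x1; rewrite ler_wpM2l// ltW.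
have sa : `|s| <= 1 / 2.
  by rewrite normrM (gtr0_norm t0); apply: le_trans x1; rewrite ler_wpM2l// ltW.
have [h1 h2 h3] := trig_bounds s; have [h4 h5] := expR_bounds ra.
have e0 := expR_gt0 r.
have -> : 1 - expR r * cos s + - (0 * a - - t * b) =
  - (expR r * (cos s - 1)) - (expR r - 1 - r) by rewrite /r; ring.
have -> : 0 - expR r * sin s - (0 * b + - tau2 R * a) =
  - (expR r * (sin s - s)) - s * (expR r - 1 - r) - s * r by rewrite /s -/t; ring.
have g1 : `|- (expR r * (cos s - 1)) - (expR r - 1 - r)| <= 2 * s ^+ 2 + 2 * r ^+ 2.
  apply: le_trans (ler_normB _ _) _; rewrite normrN normrM (gtr0_norm e0) lerD//.
  by rewrite ler_pM// ltW.
have g2 : `|- (expR r * (sin s - s)) - s * (expR r - 1 - r) - s * r| <=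
    2 * s ^+ 2 + r ^+ 2 + `|s| * `|r|.
  apply: le_trans (ler_normB _ _) _; rewrite [`|s * r|]normrM lerD2r.
  apply: le_trans (ler_normB _ _) _; rewrite normrN [`|expR r * _|]normrM [`|s * (_ - _)|]normrM (gtr0_norm e0) lerD//.
    by rewrite ler_pM// ltW.
  have := ler_pM (normr_ge0 s) (normr_ge0 (expR r - 1 - r)) sa h5; lra.
have g3 : `|s| * `|r| <= s ^+ 2 + r ^+ 2.
  rewrite -(real_normK (num_real s)) -(real_normK (num_real r)).
  have := sqr_ge0 (`|s| - `|r|); nra.
have -> : (t * n) ^+ 2 = s ^+ 2 + r ^+ 2 by rewrite exprMn hs /s /r; ring.
have := sqr_ge0 s; have := sqr_ge0 r; lra.
Qed.

(* |1 - u| >= |1 - u^j| / j for |u| <= 1; choose j so that u^j lies in the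
   left half plane. *)
Lemma ce_away x : 0 <= Im x -> `|Re x| <= 3%:R / 4%:R -> `|Re x| <= normc (1 - ce x).
Proof.
move=> x0 x1; have [->|a0] := eqVneq (Re x) 0; first by rewrite normr0 normc_ge0.
set a := `|Re x| in x1 *; have {}a0 : 0 < a by rewrite normr_gt0.
have u1 : normc (ce x) <= 1.
  by rewrite normc_ce expR_le1 oppr_le0 mulr_ge0// ltW// tau2_gt0.
have left (j : nat) : 1 / 4%:R <= j%:R * a <= 3%:R / 4%:R -> 1 <= normc (1 - ce x ^+ j).
  move=> /andP[ja1 ja2]; rewrite -ceMn; apply: le_trans (le_trans (ler_norm _) (Re_le_normc _)).
  rewrite ReD /= ReMn.
  suff : cos (tau2 R * (Re x * j%:R)) <= 0.
    by have := expR_ge0 (- (tau2 R * Im (x * j%:R))); nra.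
  have -> : cos (tau2 R * (Re x * j%:R)) = cos (tau2 R * (j%:R * a)).
    rewrite -cos_norm; congr cos.
    by rewrite !normrM (ger0_norm (ltW (tau2_gt0 R))) normr_nat [_ * j%:R]mulrC.
  have -> : tau2 R * (j%:R * a) = (tau2 R * (j%:R * a) - pi) + pi by rewrite subrK.
  rewrite cosDpi oppr_le0; apply: cos_ge0_pihalf.
  have p1 := ler_wpM2l (ltW (pi_gt0 R)) ja1; have p2 := ler_wpM2l (ltW (pi_gt0 R)) ja2.
  have -> : tau2 R = 2 * pi by rewrite /tau2 mulr_natl.
  by apply/andP; split; lra.
have pw (j : nat) : normc (1 - ce x ^+ j) <= j%:R * normc (1 - ce x).
  elim: j => [|j IH]; first by rewrite expr0 subrr normc0 mul0r.
  have -> : 1 - ce x ^+ j.+1 = (1 - ce x ^+ j) + ce x ^+ j * (1 - ce x) by rewrite exprSr; ring.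
  apply: le_trans (le_normcD _ _) _; rewrite -natr1 mulrDl mul1r lerD// normcM normcX.
  by rewrite ler_piMl ?normc_ge0// exprn_ile1// normc_ge0.
have [j /andP[j1 j2]] : exists j : nat, 1 / 4%:R <= j%:R * a <= 3%:R / 4%:R.
  have [a1|a1] := leP (1 / 4%:R) a; first by exists 1%N; apply/andP; rewrite [_ * a]mul1r.
  (* For j the integral part of 1 / (2 a), the product j a lies between 1/2 - a and 1/2, and here a
     < 1/4. *)
  pose t := (2 * a)^-1; have t0 : 0 <= t by rewrite invr_ge0 mulr_ge0// ltW.
  have ta : t * (2 * a) = 1 by rewrite mulVf// mulf_neq0// ?gt_eqF// pnatr_eq0.
  exists (Num.truncn t); have := truncn_itv t0; set j : R := (Num.truncn t)%:R.
  rewrite -natr1 => /andP[h1 h2]; nra.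
have := le_trans (left j _) (pw j); rewrite j1 j2 => /(_ isT) h.
have j0 : 0 < j%:R :> R by nra.
have n0 := normc_ge0 (1 - ce x); nra.
Qed.

End ExpBounds.

Section Lipschitz.
Variable R : realType.
Local Notation C := R[i].
Implicit Types z w x : C.

(* (1 + |n|)^(-3/2) *)
Definition wt (n : int) : R := ((1 + `|n|%:~R) * Num.sqrt (1 + `|n|%:~R))^-1.

Lemma wt_gt0 n : 0 < wt n.
Proof.
have h : 0 < 1 + `|n|%:~R :> R by rewrite ltr_wpDr// ler0z.
by rewrite invr_gt0 mulr_gt0// sqrtr_gt0.
Qed.

Lemma wtN n : wt (- n) = wt n. Proof. by rewrite /wt normrN. Qed.

Lemma sum_wt N : \sum_(0 <= n < N) wt n%:Z <= 3%:R.
Proof.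
case: N => [|N]; first by rewrite big_nil.
(* The bound is sharpened by the tail of the integral of x^(-3/2), so that the induction step is the
   inequality t^(-3) <= 2 / s - 2 / t for t^2 = s^2 + 1. *)
suff H : \sum_(0 <= n < N.+1) wt n%:Z <= 3%:R - 2 / Num.sqrt N.+1%:R.
  by apply: le_trans H _; rewrite gerBl divr_ge0// sqrtr_ge0.
elim: N => [|N IH].
  by rewrite big_nat1 /wt normr0 addr0 sqrtr1 mulr1 invr1; lra.
rewrite big_nat_recr//=; have E : 1 + `|N.+1%:Z|%:~R = N.+2%:R :> R.
  by rewrite -[N.+2%:R]natr1 addrC.
have -> : wt N.+1%:Z = (N.+2%:R * Num.sqrt N.+2%:R)^-1 by rewrite /wt E.
set s := Num.sqrt N.+1%:R in IH *; set t := Num.sqrt N.+2%:R.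
have s0 : 0 < s by rewrite sqrtr_gt0 ltr0n.
have t0 : 0 < t by rewrite sqrtr_gt0 ltr0n.
have ss : s ^+ 2 = N.+1%:R by rewrite sqr_sqrtr.
have tt : t ^+ 2 = N.+2%:R by rewrite sqr_sqrtr.
have ts : t ^+ 2 = s ^+ 2 + 1 by rewrite ss tt -natr1.
have st : s <= t by rewrite ler_sqrt// ler_nat.
suff H : (N.+2%:R * t)^-1 <= 2 / s - 2 / t.
  by move: ((_ * t)^-1) (\sum_(_ <= _ < _) _) IH H => u v IH H; lra.
rewrite -tt.
have -> : 2 / s - 2 / t = 2 / (s * t * (s + t)).
  rewrite (_ : 2 / (s * t * (s + t)) = 2 * (t ^+ 2 - s ^+ 2) / (s * t * (s + t))).
    by field; rewrite !gt_eqF ?addr_gt0.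
  by rewrite ts addrAC subrr add0r mulr1.
rewrite ler_pdivlMr ?mulr_gt0 ?addr_gt0// mulrC ler_pdivrMr ?mulr_gt0 ?exprn_gt0//.
nra.
Qed.

Lemma asum_wt : asum (fun n : int => (wt n)%:C%C).
Proof.
apply: asum_int.
  apply: (@asum_nat _ _ 3%:R) => N; apply: le_trans (sum_wt N).
  by apply: ler_sum => n _; rewrite normcR ger0_norm// ltW// wt_gt0.
apply: (@asum_nat _ _ 3%:R) => N; apply: le_trans (sum_wt N.+1).
rewrite big_nat_recl//; apply: ler_wpDl; first exact: ltW (wt_gt0 _).
by apply: ler_sum => n _; rewrite normcR ger0_norm ?NegzE ?wtN// ltW// wt_gt0.
Qed.

Lemma wt_ge (n : int) (k : nat) : (2 <= k)%N -> n != 0 -> (`|n|%:~R ^- k : R) <= 4%:R * wt n.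
Proof.
move=> k2 n0; have n1 : 1 <= `|n|%:~R :> R by rewrite ler1z; lia.
set a := `|n|%:~R in n1 *; rewrite /wt -/a.
have a0 : 0 < a by apply: lt_le_trans n1.
have h : (a ^- k : R) <= a ^- 2.
  by rewrite lef_pV2 ?posrE ?exprn_gt0// ler_weXn2l.
apply: le_trans h _; set s := Num.sqrt (1 + a).
have s0 : 0 < s by rewrite sqrtr_gt0; lra.
have ss : s ^+ 2 = 1 + a by rewrite sqr_sqrtr//; lra.
have sa : s <= 2 * a.
  rewrite -(@ler_pXn2r _ 2)// ?nnegrE ?(ltW s0) ?mulr_ge0 ?(ltW a0)// ss exprMn; nra.
rewrite -[_^-1]mul1r ler_pdivrMr ?exprn_gt0// mulrAC ler_pdivlMr ?mulr_gt0//; last by lra.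
nra.
Qed.

Lemma ccvg_ninv (c : C) : ccvg (fun n => c / n.+1%:R) 0.
Proof.
move=> e e0; exists (Num.truncn (normc c / e)) => n hn.
rewrite subr0 normcM normcV normc_nat ltr_pdivrMr ?ltr0n// mulrC -ltr_pdivrMr//.
by apply: lt_le_trans (truncnS_gt _) _; rewrite ler_nat.
Qed.

Lemma ccvg_ce_sub (w : nat -> C) (l : C) : ccvg w l ->
  ccvg (fun n => n.+1%:R * (1 - ce (w n / n.+1%:R))) (kap R * l).
Proof.
move=> wl; have t0 := tau2_gt0 R.
pose K := normc l + 1; have K0 : 0 < K by have := normc_ge0 l; rewrite /K; lra.
have [N0 wK] : exists N0, forall n, (N0 <= n)%N -> normc (w n) <= K.
  have [N0 H] := wl _ ltr01; exists N0 => n /H; have := le_normc_dist (w n) l; rewrite /K; lra.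
suff H : ccvg (fun n => n.+1%:R * (1 - ce (w n / n.+1%:R)) - kap R * w n) 0.
  have := ccvgD H (ccvgM (ccvg_cst (kap R)) wl); rewrite add0r.
  by apply: (@ccvg_ext _ _ _ _ 0) => n _; rewrite subrK.
move=> e e0; pose c : R := 6%:R * (tau2 R * K) ^+ 2.
have [N1 H1] := ccvg_ninv c%:C%C e0.
have h2 : 0 < 1 / 2 :> R by lra.
have [N2 H2] := ccvg_ninv (tau2 R * K)%:C%C h2.
exists (maxn N0 (maxn N1 N2)) => n; rewrite !geq_max => /and3P[n0 n1 n2].
have {H1} := H1 n n1; have {H2} := H2 n n2; have {wK} := wK n n0.
rewrite !subr0 !normcM !normcV !normc_nat !normcR.
have m0 : 0 < n.+1%:R :> R by rewrite ltr0n.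
set m : R := n.+1%:R in m0 * => wK.
have tK : 0 <= tau2 R * K by rewrite mulr_ge0// ltW.
have c0 : 0 <= c by rewrite mulr_ge0// sqr_ge0.
rewrite (ger0_norm tK) (ger0_norm c0) => H2 H1.
have nx : tau2 R * normc (w n / n.+1%:R) <= tau2 R * K / m.
  by rewrite normcM normcV normc_nat mulrA ler_wpM2r ?invr_ge0 ?(ltW m0)// ler_wpM2l// ltW.
have x1 : tau2 R * normc (w n / n.+1%:R) <= 1 / 2 by apply: le_trans nx (ltW H2).
have A := ce_approx x1.
have -> : n.+1%:R * (1 - ce (w n / n.+1%:R)) - kap R * w n =
   n.+1%:R * (1 - ce (w n / n.+1%:R) - kap R * (w n / n.+1%:R)).
  by rewrite [in RHS]mulrBr; congr (_ - _); rewrite mulrCA [_ * (w n / _)]mulrC divfK ?pnatr_eq0.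
rewrite normcM normc_nat -/m; apply: le_lt_trans H1.
apply: le_trans (ler_wpM2l (ltW m0) A) _.
have B : (tau2 R * normc (w n / n.+1%:R)) ^+ 2 <= (tau2 R * K / m) ^+ 2.
  have p1 : 0 <= tau2 R * normc (w n / n.+1%:R) by rewrite mulr_ge0 ?normc_ge0 ?ltW.
  have p2 : 0 <= tau2 R * K / m by apply: divr_ge0 => //; apply: ltW.
  by rewrite lerXn2r.
apply: (@le_trans _ _ (m * (6%:R * (tau2 R * K / m) ^+ 2))).
  by rewrite ler_wpM2l ?(ltW m0)// ler_wpM2l.
rewrite /c (_ : m * _ = 6%:R * (tau2 R * K) ^+ 2 / m)//.
have F (a b : R) : b != 0 -> b * (6%:R * (a / b) ^+ 2) = 6%:R * a ^+ 2 / b.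
  by move=> b0; field.
exact: F (lt0r_neq0 m0).
Qed.

Lemma ccvg_ce (w : nat -> C) (l : C) : ccvg w l ->
  ccvg (fun n => ce (w n / n.+1%:R)) 1.
Proof.
move=> /ccvg_ce_sub H; have := ccvgM (ccvg_ninv 1) H; rewrite mul0r => {}H.
have := ccvgD (ccvg_cst 1) (ccvgN H); rewrite oppr0 addr0.
apply: (@ccvg_ext _ _ _ _ 0) => n _; rewrite mul1r mulKf ?pnatr_eq0//; ring.
Qed.

Definition pw (m : nat) : fps C := fun n => n%:R ^+ m.

Lemma conv_pw m : conv (pw m).
Proof.
apply: (@conv_le R (pw m) _ 1 (conv_natX m)) => n; rewrite mul1r !normcX !normc_nat.
by rewrite lerXn2r ?nnegrE// ler_nat.
Qed.

Section Kernel.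
(* P u / (1 - u)^k is the closed form of sum_n n^(k-1) u^n. *)
Variables (k : nat) (P : C -> C) (Pb : R).
Hypothesis k2 : (2 <= k)%N.
Hypothesis P_cvg : forall u l, ccvg u l -> ccvg (fun n => P (u n)) (P l).
Hypothesis P_bound : forall u, normc u <= 1 -> normc (P u) <= Pb.
Hypothesis P_series : forall u, normc u < 1 -> (1 - u) ^+ k * ev (pw k.-1) u = P u.

Lemma P_ev u : normc u < 1 -> P u / (1 - u) ^+ k = ev (pw k.-1) u.
Proof.
move=> u1; rewrite -P_series// mulrC mulKf// expf_neq0// subr_eq0.
by apply: contraTneq u1 => <-; rewrite normc1 ltxx.
Qed.

(** The operator U_N multiplies the series of n^(k-1) u^n by N^(k-1), and [ev_Lam] expresses U_N
    through the points (z + j) / N. *)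
Lemma P_dist z N : 0 < Im z -> (0 < N)%N ->
  \sum_(j < N) N%:R ^- k * (P (ce ((z + j%:R) / N%:R)) / (1 - ce ((z + j%:R) / N%:R)) ^+ k) =
  P (ce z) / (1 - ce z) ^+ k.
Proof.
move=> z0 N0; have N0' : N%:R != 0 :> C by rewrite pnatr_eq0 -lt0n.
have zN (j : nat) : normc (ce ((z + j%:R) / N%:R)) < 1.
  by apply: normc_ce_lt1; rewrite Im_divn ImD Im_nat addr0 divr_gt0// ltr0n.
under eq_bigr do rewrite P_ev//.
rewrite -mulr_sumr ev_Lam//; last exact: conv_pw.
rewrite P_ev ?normc_ce_lt1//.
have -> : fps_Lam N (pw k.-1) = fpsC (N%:R ^+ k.-1) * pw k.-1.
  by apply/funext => n; rewrite fpsCM /fps_Lam /pw natrM exprMn mulrC.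
rewrite evCM ?normc_ce_lt1//; last exact: conv_pw.
by rewrite [N%:R * (_ * _)]mulrA -exprS prednK ?(leq_trans _ k2)// mulrA mulVf ?expf_neq0// mul1r.
Qed.

(** In [P_dist] with j in a symmetric residue system, each term tends to [P 1] / ([kap] (z + n))^k
    as N grows, because 1 - [ce] has derivative [kap] at 0; [tannery] exchanges limit and sum. Real
    z is needed for the constant terms of the Eisenstein series, so z is approached through z + i /
    N, where [P_dist] applies. *)
Lemma lipschitz z : 0 <= Im z -> ce z != 1 ->
  hassum (fun n : int => P 1 / (kap R * (z + n%:~R)) ^+ k) (P (ce z) / (1 - ce z) ^+ k).
Proof.
move=> z0 z1.
pose N (M : nat) := (M + M).+1.
pose zM (M : nat) : C := z + Complex 0 1 / (N M)%:R.
pose B (M : nat) := [seq (i%:Z - M%:Z)%R | i <- iota 0 (N M)].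
pose G (M : nat) (n : int) : C :=
  (N M)%:R ^- k * (P (ce ((zM M + n%:~R) / (N M)%:R)) / (1 - ce ((zM M + n%:~R) / (N M)%:R)) ^+ k).
pose Fn (M : nat) (n : int) := if n \in B M then G M n else 0.
have memB M (n : int) : (n \in B M) = (`|n| <= M%:Z).
  apply/mapP/idP => [[j]|nM]; first by rewrite mem_iota /N => ? ->; lia.
  by exists (absz (n + M%:Z)); [rewrite mem_iota /N; lia|lia].
have ImzM M : 0 < Im (zM M).
  by rewrite /zM ImD Im_divn /= ltr_wpDl// divr_gt0// ltr0n.
have sub_id (M : nat) : (M <= M + M)%N by rewrite leq_addr.
have zMl : ccvg zM z.
  move=> e e0; have [M0 H] := ccvg_ninv (Complex 0 1) e0; exists M0 => M hM.
  have := H (M + M)%N (leq_trans hM (sub_id M)); rewrite /zM subr0.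
  by rewrite addrC addKr.
have sub_ccvg (u : nat -> C) l : ccvg u l -> ccvg (fun M => u (M + M)%N) l.
  by move=> ul e /ul[M0 H]; exists M0 => M hM; apply: H; apply: leq_trans hM (sub_id M).
have ceM_l : ccvg (fun M => ce (zM M)) (ce z).
  have := ccvgM (ccvg_cst (ce z)) (sub_ccvg _ _ (ccvg_ce (ccvg_cst (Complex 0 1)))).
  by rewrite mulr1; apply: (@ccvg_ext _ _ _ _ 0) => M _; rewrite /zM ceD.
have zn0 (n : int) : z + n%:~R != 0.
  apply: contra_neq z1 => /eqP; rewrite addr_eq0 => /eqP->.
  by rewrite ceN ce_int invr1.
pose L := (Num.truncn (2 * `|Re z|)).+2.
have hL : 2 * `|Re z| + 1 < L%:R.
  by have := truncnS_gt (2 * `|Re z|); rewrite /L -[_.+2%:R]natr1; lra.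
apply: (@tannery _ _ _ Fn B (fun M => P (ce (zM M)) / (1 - ce (zM M)) ^+ k) _
   (fun n => (Pb * 2 ^+ k * 4%:R * wt n)%:C%C) (B L) L).
- move=> n; have zn : ccvg (fun M => zM M + n%:~R) (z + n%:~R) by apply: ccvgD zMl (ccvg_cst _).
  have w_ext : exists w : nat -> C, ccvg w (z + n%:~R) /\ forall M, w (M + M)%N = zM M + n%:~R.
    exists (fun m => z + Complex 0 1 / m.+1%:R + n%:~R); split=> //.
    have := ccvgD (ccvgD (ccvg_cst z) (ccvg_ninv (Complex 0 1))) (ccvg_cst n%:~R).
    by rewrite addr0.
  have [w [wl wE]] := w_ext.
  have c1 := sub_ccvg _ _ (P_cvg (ccvg_ce wl)).
  have c2 := sub_ccvg _ _ (ccvgX k (ccvg_ce_sub wl)).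
  have nz : (kap R * (z + n%:~R)) ^+ k != 0 by rewrite expf_neq0// mulf_neq0 ?kap_neq0.
  have := ccvgM c1 (ccvgV nz c2); apply: (@ccvg_ext _ _ _ _ `|n|%N) => M hM.
  rewrite /Fn memB ifT; last by lia.
  by rewrite /G /N wE exprMn invfM mulrCA.
- have [M0 H] := asum_wt; apply: (@asum_le _ _ _ (fun n => (wt n)%:C%C) (`|Pb * 2 ^+ k * 4%:R|)) => //.
    by exists M0.
  by move=> n; rewrite !normcR normrM.
- move=> M n LM nA; rewrite /Fn; case: ifP => [|_]; last by rewrite normc0 normc_ge0.
  rewrite memB => nM; have nL : L%:Z < `|n| by move: nA; rewrite memB; lia.
  have nL' : L%:R < `|n|%:~R :> R by rewrite -[L%:R]/(L%:Z%:~R) ltr_int.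
  have nM' : `|n|%:~R <= M%:R :> R by rewrite -[M%:R]/(M%:Z%:~R) ler_int.
  have LM' : L%:R <= M%:R :> R by rewrite ler_nat.
  set x := (zM M + n%:~R) / (N M)%:R.
  have NR : (N M)%:R = 2 * M%:R + 1 :> R by rewrite /N -natr1 natrD; ring.
  have N0 : 0 < (N M)%:R :> R by rewrite ltr0n.
  have Rx : Re x = (Re z + n%:~R) / (N M)%:R.
    by rewrite /x Re_divn ReD Re_int /zM ReD Re_divn /= mul0r addr0.
  have an : `|n%:~R| = `|n|%:~R :> R by rewrite intr_norm.
  have ub : `|Re z + n%:~R| <= `|Re z| + `|n|%:~R by rewrite -an ler_normD.
  have lb : `|n|%:~R / 2 <= `|Re z + n%:~R|.
    have := ler_normB (Re z + n%:~R) (Re z); rewrite addrC addKr an; lra.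
  have aRx : `|Re x| = `|Re z + n%:~R| / (N M)%:R by rewrite Rx normrM normfV (gtr0_norm N0).
  have Rx34 : `|Re x| <= 3%:R / 4%:R by rewrite aRx ler_pdivrMr// NR; lra.
  have Imx : 0 <= Im x.
    by rewrite /x Im_divn divr_ge0// ImD Im_int addr0 ltW.
  have hx := ce_away Imx Rx34.
  have n0 : n != 0 by apply: contraTneq nL => ->; rewrite normr0 -leNgt.
  have n1 : 0 < `|n|%:~R :> R by rewrite ltr0z normr_gt0.
  have lo : `|n|%:~R / 2 <= (N M)%:R * normc (1 - ce x).
    apply: le_trans lb _; rewrite mulrC -ler_pdivrMr// -aRx//.
  have ux : normc (ce x) <= 1.
    by rewrite normc_ce expR_le1 oppr_le0 mulr_ge0// ltW// tau2_gt0.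
  have Pb0 : 0 <= Pb by apply: le_trans (normc_ge0 _) (P_bound ux).
  rewrite /G -/x normcM normcV normcX normc_nat normcM normcV normcX mulrCA -invfM -exprMn.
  rewrite normcR ger0_norm; last by rewrite !mulr_ge0 ?exprn_ge0 ?(ltW (wt_gt0 n)).
  apply: (@le_trans _ _ (Pb * (`|n|%:~R / 2) ^- k)).
    apply: ler_pM; rewrite ?normc_ge0 ?invr_ge0 ?exprn_ge0 ?mulr_ge0 ?normc_ge0 ?(ltW N0)//.
      exact: P_bound.
    rewrite lef_pV2 ?posrE ?exprn_gt0 ?divr_gt0//; last first.
      by apply: lt_le_trans lo; rewrite divr_gt0.
    by rewrite lerXn2r ?nnegrE ?divr_ge0 ?(ltW n1)// mulr_ge0 ?normc_ge0 ?(ltW N0).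
  rewrite -!mulrA ler_wpM2l// expr_div_n invf_div ler_wpM2l ?exprn_ge0//.
  exact: wt_ge.
- by move=> M; rewrite map_inj_uniq ?iota_uniq// => i j; lia.
- by move=> M n nB; rewrite /Fn (negPf nB).
- move=> M _; rewrite big_map.
  pose y := zM M + (- M%:Z)%:~R.
  have y0 : 0 < Im y by rewrite /y ImD Im_int addr0.
  have ceY : ce y = ce (zM M) by rewrite ceDint.
  rewrite -ceY -(@P_dist y (N M))//.
  rewrite -[iota 0 (N M)]/(index_iota 0 (N M)) big_mkord; apply: eq_bigr => i _.
  rewrite /Fn ifT; last by apply/mapP; exists (i : nat); rewrite // mem_iota/=.
  rewrite /G; have -> : zM M + (i%:Z - M%:Z)%:~R = y + i%:R by rewrite /y intrB intrN; ring.
  by [].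
have z1' : (1 - ce z) ^+ k != 0 by rewrite expf_neq0// subr_eq0 eq_sym.
apply: ccvgM; first exact: P_cvg.
by apply: ccvgV => //; apply: ccvgX; apply: ccvgD (ccvg_cst 1) (ccvgN _).
Qed.

End Kernel.
End Lipschitz.

(** * Lattice sums *)

Definition chz (n : int) : int :=
  if (n %% 3)%Z == 1 then 1 else if (n %% 3)%Z == 2 then -1 else 0.

Lemma chzE (n : int) : exists (q r : int), [/\ n = q * 3 + r, r \in [:: 0; 1; 2] &
  chz n = if r == 1 then 1 else if r == 2 then -1 else 0].
Proof.
exists (n %/ 3)%Z, (n %% 3)%Z; split=> //; first exact: divz_eq.
have := modz_ge0 n (isT : 3 != 0 :> int); have := ltz_mod n (isT : 3 != 0 :> int).
by rewrite !inE; lia.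
Qed.

Lemma chz_mod (n m k : int) : n = m + k * 3 -> chz n = chz m.
Proof. by move=> ->; rewrite /chz addrC modzMDl. Qed.

Lemma chzM m n : chz (m * n) = chz m * chz n.
Proof.
have [q [r [-> hr ->]]] := chzE m; have [q' [r' [-> hr' ->]]] := chzE n.
rewrite (@chz_mod _ (r * r') (q * (q' * 3) + q * r' + q' * r)); last by ring.
by move: hr hr'; rewrite !inE => /or3P[]/eqP-> /or3P[]/eqP->.
Qed.

Lemma chzN n : chz (- n) = - chz n.
Proof. by rewrite -mulN1r chzM mulN1r. Qed.

Lemma chz_nat (n : nat) : chz n%:Z = chi3 n.
Proof. by rewrite chi3E /chz modz_nat; case: (mod3P n) => ->. Qed.

Lemma chz_norm n : `|chz n| <= 1.
Proof. by rewrite /chz; case: ifP => // _; case: ifP. Qed.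

(** By N^2 <= 2 (M a + N)^2 + 2 a^2 M^2 and M^2 = (M b)^2 / b^2. For tau = a + b i this bounds |M
    tau + N| from below. *)
Lemma quad_low (R : realFieldType) (a b M N : R) : b != 0 ->
  M ^+ 2 + N ^+ 2 <= (2 + (1 + 2 * a ^+ 2) / b ^+ 2) * ((M * a + N) ^+ 2 + (M * b) ^+ 2).
Proof.
move=> b0; have b2 : 0 < b ^+ 2 by rewrite exprn_even_gt0.
have a2 := sqr_ge0 a.
have E : (2 + (1 + 2 * a ^+ 2) / b ^+ 2) * ((M * a + N) ^+ 2 + (M * b) ^+ 2) =
     2 * (M * a + N) ^+ 2 + (1 + 2 * a ^+ 2) * M ^+ 2
     + (1 + 2 * a ^+ 2) / b ^+ 2 * (M * a + N) ^+ 2 + 2 * (M * b) ^+ 2.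
  by field.
have p1 : 0 <= (1 + 2 * a ^+ 2) / b ^+ 2 * (M * a + N) ^+ 2.
  by apply: mulr_ge0; [apply: divr_ge0; [lra|exact: ltW]|exact: sqr_ge0].
have p2 : 0 <= 2 * (M * b) ^+ 2 by rewrite mulr_ge0 ?sqr_ge0.
have p3 := sqr_ge0 (2 * (M * a) + N).
rewrite E; move: p1 p2 p3; set X := _ / _ * _ => p1 p2 p3; nra.
Qed.

Section Lambert.
Variable R : realType.
Local Notation C := R[i].

Lemma hassum_lam (phi : nat -> nat -> int) (c j : nat) (x : C) :
  (forall a b, (0 < a)%N -> (0 < b)%N -> `|phi a b| <= c%:Z * (a * b)%:Z ^+ j) ->
  normc x < 1 ->
  hassum (fun p : nat * nat => (phi p.1.+1 p.2.+1)%:~R * x ^+ (p.1.+1 * p.2.+1))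
    (ev (cfps R (lam phi)) x).
Proof.
move=> H x1; set f := fun p : nat * nat => _.
have af : asum f.
  (* Since (a + 1) (b + 1) >= a + b, the family is dominated by a product of two one-variable series
     in |x|. *)
  pose rr : C := (normc x)%:C%C.
  have r1 : normc rr < 1 by rewrite normcR ger0_norm ?normc_ge0.
  have au := asum_conv (conv_natX j) r1.
  apply: (@asum_le _ _ _ _ c%:R _ (asum_prod au au)) => // -[a b].
  have -> : normc (f (a, b)) = `|phi a.+1 b.+1|%:~R * normc x ^+ (a.+1 * b.+1).
    by rewrite /f normcM normc_int normcX.
  have -> : normc ((a, b).1.+1%:R ^+ j * rr ^+ (a, b).1 * ((a, b).2.+1%:R ^+ j * rr ^+ (a, b).2)) =
     a.+1%:R ^+ j * normc x ^+ a * (b.+1%:R ^+ j * normc x ^+ b).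
    by rewrite !normcM !normcX !normc_nat normcR ger0_norm ?normc_ge0.
  have h1 : `|phi a.+1 b.+1|%:~R <= c%:R * (a.+1%:R ^+ j * b.+1%:R ^+ j) :> R.
    have := H a.+1 b.+1 isT isT; rewrite -(ler_int R) PoszM exprMn !rmorphM !rmorphXn /=.
    by [].
  have h2 : normc x ^+ (a.+1 * b.+1) <= normc x ^+ a * normc x ^+ b.
    by rewrite -exprD ler_wiXn2l ?normc_ge0 ?(ltW x1)//; nia.
  have := ler_pM _ _ h1 h2; rewrite ler0z normr_ge0 exprn_ge0 ?normc_ge0// => /(_ isT isT).
  by move=> h; apply: le_trans h _; rewrite le_eqVlt; apply/orP; left; apply/eqP; ring.
have [s fs] := hassum_exists af.
suff -> : ev (cfps R (lam phi)) x = s by [].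
apply: evE.
pose F (q : nat * (nat * nat)) := if (q.2.1.+1 * q.2.2.+1 == q.1)%N then f q.2 else 0.
have FS : hassum F s.
  apply: (@hassum_inj _ _ _ (fun p => ((p.1.+1 * p.2.+1)%N, p))) => [p q E|[n p]|].
  - exact: (congr1 snd E).
    by rewrite /F /=; case: (_ =P n) => [<- _|]; [exists p|rewrite eqxx].
  by apply: hassum_ext fs => p; rewrite /F /= eqxx.
apply: hassum_fubini FS _ => n.
pose A := [seq (u.1.-1, u.2.-1) | u <- pairs2 n].
have mA p : (p \in A) = (p.1.+1 * p.2.+1 == n)%N.
  apply/mapP/idP => [[[a b]]|e].
    by rewrite mem_pairs2 => /and3P[a0 b0 e] ->; rewrite /= !prednK.
  by exists (p.1.+1, p.2.+1); rewrite ?mem_pairs2//=; case: (p).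
have uA : uniq A.
  rewrite map_inj_in_uniq ?pairs2_uniq// => -[a b] [a' b'].
  by rewrite !mem_pairs2 => /and3P[a0 b0 _] /and3P[a0' b0' _] /= [e1 e2]; congr (_, _); lia.
have := @hassum_fin R _ (fun p => F (n, p)) A uA.
have -> : \sum_(p <- A) F (n, p) = cfps R (lam phi) n * x ^+ n.
  rewrite /cfps lam_pairs2 rmorph_sum mulr_suml big_map; apply: eq_big_seq => -[a b].
  rewrite mem_pairs2 => /and3P[a0 b0 /eqP e]; rewrite /F /f /= !prednK// e eqxx//.
by apply=> p; rewrite mA /F /= => /negPf->.
Qed.

End Lambert.

Section Lattice.
Variable R : realType.
Local Notation C := R[i].
Implicit Types z w x tau : C.
Variables (k : nat) (P : C -> C).
Hypothesis k3 : (3 <= k)%N.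
Hypothesis k_odd : odd k.

Definition at_ (w : C) : C := P 1 / (kap R * w) ^+ k.

Lemma at_M v w : at_ (v * w) = v ^- k * at_ w.
Proof. by rewrite /at_ [kap R * (v * w)]mulrCA exprMn invfM mulrCA. Qed.

Lemma at_N w : at_ (- w) = - at_ w.
Proof.
rewrite -mulN1r at_M -signr_odd k_odd expr1.
by rewrite invrN1 mulN1r.
Qed.

(** By the convention 0^-1 = 0 the origin contributes nothing, and lattice sums may run over all
    pairs. *)
Lemma at_0 : at_ 0 = 0.
Proof. by rewrite /at_ mulr0 expr0n gtn_eqF ?invr0 ?mulr0// (leq_trans _ k3). Qed.

(** Away from the origin (1 + |m|) (1 + |n|) is at most a constant times |m tau + n|^2. Raising this
    to the power 3/2 explains the exponent in [wt]: it is large enough for summability in m and n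
    separately, and k >= 3 covers it. *)
Lemma lattice_bound tau : 0 < Im tau -> exists2 c : R, 0 <= c &
  forall m n : int, normc (at_ (m%:~R * tau + n%:~R)) <= c * (wt R m * wt R n).
Proof.
move=> t0; pose a := Re tau; pose b := Im tau.
pose K := 2 + (1 + 2 * a ^+ 2) / b ^+ 2.
have b2 : 0 < b ^+ 2 by rewrite exprn_gt0.
have K0 : 0 < K by rewrite /K ltr_wpDr// divr_ge0 ?(ltW b2)//; have := sqr_ge0 a; lra.
pose T := tau2 R; have T0 : 0 < T := tau2_gt0 R.
pose c := normc (P 1) / T ^+ k * (4%:R * K) ^+ k.
have c0 : 0 <= c by rewrite !mulr_ge0 ?normc_ge0 ?invr_ge0 ?exprn_ge0 ?mulr_ge0 ?(ltW T0) ?(ltW K0).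
exists c => // m n; have [E|mn0] := boolP ((m == 0) && (n == 0)).
  case/andP: E => /eqP-> /eqP->; rewrite mul0r addr0 at_0 normc0.
  by apply: mulr_ge0 => //; apply: mulr_ge0; apply: ltW; apply: wt_gt0.
set w := m%:~R * tau + n%:~R.
have nw : normc w ^+ 2 = (m%:~R * a + n%:~R) ^+ 2 + (m%:~R * b) ^+ 2.
  rewrite sqr_normc /w ReD ImD Im_int Re_int addr0.
  have -> : (m%:~R : C) = (m%:~R)%:C%C by rewrite rmorph_int.
  by rewrite [_ * tau]mulrC ReMr ImMr [Re tau * _]mulrC [Im tau * _]mulrC.
pose u : R := `|m|%:~R; pose v : R := `|n|%:~R.
have u2 : u ^+ 2 = m%:~R ^+ 2 by rewrite /u intr_norm real_normK ?num_real.
have v2 : v ^+ 2 = n%:~R ^+ 2 by rewrite /v intr_norm real_normK ?num_real.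
have u0 : 0 <= u by rewrite ler0z. have v0 : 0 <= v by rewrite ler0z.
have uv : 1 <= u \/ 1 <= v.
  by move: mn0; rewrite negb_and => /orP[h|h]; [left|right]; rewrite ler1z; lia.
have low : u ^+ 2 + v ^+ 2 <= K * normc w ^+ 2.
  by rewrite nw u2 v2; apply: quad_low; rewrite gt_eqF.
pose A := (1 + u) * (1 + v).
have A0 : 0 < A by rewrite mulr_gt0//; lra.
have A1 : 1 <= A by rewrite /A; nra.
have Aw : A <= 4%:R * K * normc w ^+ 2.
  rewrite -mulrA; apply: (@le_trans _ _ (4%:R * (u ^+ 2 + v ^+ 2))); last by rewrite ler_wpM2l.
  have q1 := sqr_ge0 (u - v); have q2 := sqr_ge0 (1 - v); have q3 := sqr_ge0 (1 - u);
  have q4 := sqr_ge0 u; have q5 := sqr_ge0 v.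
  rewrite /A; case: uv => h.
    have := mulr_ge0 u0 (_ : 0 <= u - 1); rewrite subr_ge0 => /(_ h); lra.
  have := mulr_ge0 v0 (_ : 0 <= v - 1); rewrite subr_ge0 => /(_ h); lra.
have w0 : 0 < normc w.
  rewrite lt0r normc_ge0 andbT; apply: contraTneq Aw => ->.
  by rewrite expr0n mulr0 -ltNge.
pose s := Num.sqrt A.
have s0 : 0 < s by rewrite sqrtr_gt0.
have ss : s ^+ 2 = A by rewrite sqr_sqrtr ?ltW.
have s1 : 1 <= s by rewrite -(@ler_pXn2r _ 2)// ?nnegrE ?(ltW s0)// ss expr1n.
have wts : wt R m * wt R n = s ^- 3.
  rewrite /wt -invfM; congr (_^-1); rewrite -/u -/v mulrACA -sqrtrM; last by lra.
  by rewrite [RHS]exprSr ss.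
have K4 : 1 <= 4%:R * K.
  have a2 := sqr_ge0 a; have : 0 <= (1 + 2 * a ^+ 2) / b ^+ 2 by apply: divr_ge0; [lra|exact: ltW].
  by rewrite /K; move: (_ / _) => y y0; lra.
have sw : s <= 4%:R * K * normc w.
  rewrite -(@ler_pXn2r _ 2)// ?nnegrE ?(ltW s0) ?mulr_ge0 ?(ltW K0) ?(ltW w0)// ss.
  apply: le_trans Aw _; rewrite exprMn ler_wpM2r ?sqr_ge0// expr2 ler_peMl//; lra.
have kapn : normc (kap R) = T.
  rewrite /kap /normc /= expr0n add0r sqrrN sqrtr_sqr ger0_norm ?ltW//.
rewrite /at_ normcM normcV normcX normcM kapn wts /c -!mulrA ler_wpM2l ?normc_ge0//.
rewrite exprMn invfM ler_wpM2l ?invr_ge0 ?exprn_ge0 ?(ltW T0)//.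
have h3 : (4%:R * K) ^- k * s ^+ k <= normc w ^+ k.
  by rewrite ler_pdivrMl ?exprn_gt0 ?mulr_gt0// -exprMn lerXn2r ?nnegrE
    ?(ltW s0) ?mulr_ge0 ?(ltW w0) ?(ltW K0).
have s3 : s ^+ 3 <= s ^+ k by rewrite ler_weXn2l.
have KK : 0 < (4%:R * K) ^+ k by rewrite exprn_gt0// mulr_gt0.
rewrite -[_^-1]mul1r ler_pdivrMr ?exprn_gt0// mulrAC ler_pdivlMr ?exprn_gt0// mul1r.
apply: le_trans s3 _; move: h3; rewrite ler_pdivrMl// ; exact.
Qed.

End Lattice.

Section Lattice2.
Variable R : realType.
Local Notation C := R[i].
Implicit Types z w x tau : C.
Variables (k : nat) (P : C -> C) (Pb : R).
Hypothesis k3 : (3 <= k)%N.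
Hypothesis k_odd : odd k.
Hypothesis P_cvg : forall u l, ccvg u l -> ccvg (fun n => P (u n)) (P l).
Hypothesis P_bound : forall u, normc u <= 1 -> normc (P u) <= Pb.
Hypothesis P_series : forall u, normc u < 1 -> (1 - u) ^+ k * ev (pw R k.-1) u = P u.
Local Notation omega := (ce (3%:R^-1 : C)).
Local Notation del := (omega - omega^-1).

Let k2 : (2 <= k)%N := ltnW k3.
Local Notation a_ := (at_ k P).
Let a_N : forall w, a_ (- w) = - a_ w := at_N P k_odd.
Let Ls z := P (ce z) / (1 - ce z) ^+ k.
Let chc (n : int) : C := (chz n)%:~R.

(* Up to the factor P 1 / kap ^ k, the terms chi(n) / (3 m tau + n)^k and chi(m) / (m tau + n)^k
   of the two Eisenstein series of weight k for the character chi mod 3. *)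
Definition famG tau (p : int * int) : C := chc p.2 * a_ (3%:R * p.1%:~R * tau + p.2%:~R).
Definition famH tau (p : int * int) : C := chc p.1 * a_ (p.1%:~R * tau + p.2%:~R).

Lemma chc_norm n : normc (chc n) <= 1.
Proof. by rewrite normc_int lerz1 chz_norm. Qed.

Lemma normc_wt2 (p : int * int) :
  normc ((wt R p.1)%:C%C * (wt R p.2)%:C%C : C) = wt R p.1 * wt R p.2.
Proof.
by rewrite -rmorphM normcR ger0_norm//; apply: mulr_ge0; apply: ltW; apply: wt_gt0.
Qed.

Lemma asumH tau : 0 < Im tau -> asum (famH tau).
Proof.
move=> t0; have [c c0 H] := lattice_bound P k3 k_odd t0.
apply: (@asum_le _ _ _ _ c c0 (asum_prod (asum_wt R) (asum_wt R))) => -[m n].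
rewrite normc_wt2 /famH [normc (chc _ * _)]normcM.
apply: le_trans (H m n); rewrite ler_piMl ?normc_ge0//; exact: chc_norm.
Qed.

Lemma Im3 tau : 0 < Im tau -> 0 < Im (3%:R * tau).
Proof. by move=> t0; rewrite mulrC ImMn mulr_gt0. Qed.

Lemma asumG tau : 0 < Im tau -> asum (famG tau).
Proof.
move=> t0; have [c c0 H] := lattice_bound P k3 k_odd (Im3 t0).
apply: (@asum_le _ _ _ _ c c0 (asum_prod (asum_wt R) (asum_wt R))) => -[m n].
rewrite normc_wt2 /famG [normc (chc _ * _)]normcM /=.
rewrite (_ : 3%:R * m%:~R * tau = m%:~R * (3%:R * tau)); last by ring.
apply: le_trans (H m n); rewrite ler_piMl ?normc_ge0//; exact: chc_norm.
Qed.

Lemma ce_neq1 z : 0 < Im z -> ce z != 1.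
Proof.
by move=> z0; apply: contraTneq (normc_ce_lt1 z0) => ->; rewrite normc1 ltxx.
Qed.

Lemma hassum_shift (f : nat -> C) s : f 0%N = 0 -> hassum f s -> hassum (fun n => f n.+1) s.
Proof.
move=> f0 fs e e0; have [A HA] := fs e e0; exists (map predn A) => B uB AB.
pose D := 0%N :: map S B.
have uD : uniq D.
  rewrite /= map_inj_uniq ?uB ?andbT//; last by move=> x y [].
  by apply/mapP => -[].
have AD : {subset A <= D}.
  move=> [|n] nA; rewrite inE//=; apply/map_f/AB; apply/mapP; by exists n.+1.
by have := HA D uD AD; rewrite big_cons f0 add0r big_map.
Qed.

Lemma rowH tau m : 0 < Im tau -> (0 < m)%N ->
  hassum (fun n : int => a_ (m%:R * tau + n%:~R)) (ev (pw R k.-1) (ce tau ^+ m)).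
Proof.
move=> t0 m0; have z0 : 0 < Im (m%:R * tau) by rewrite mulrC ImMn mulr_gt0// ltr0n.
have := lipschitz k2 P_cvg P_bound P_series (ltW z0) (ce_neq1 z0).
rewrite (P_ev P_series (normc_ce_lt1 z0)).
by rewrite [m%:R * tau]mulrC ceMn.
Qed.

Lemma rowH_neg tau m : 0 < Im tau -> (0 < m)%N ->
  hassum (fun n : int => a_ (- m%:R * tau + n%:~R)) (- ev (pw R k.-1) (ce tau ^+ m)).
Proof.
move=> t0 m0; apply: (@hassum_bij _ _ _ -%R -%R); try exact: opprK.
have := hassumZ (-1) (rowH t0 m0); rewrite mulN1r => H; apply: hassum_ext H => n /=.
by rewrite mulN1r -a_N; congr a_; rewrite intrN; ring.
Qed.

(** By Lipschitz' formula the row m > 0 sums to the series of n^(k-1) q^(m n). The row - m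
    contributes the same, because k and the character are both odd, whence the factor 2; the
    character kills the row 0. *)
Lemma hassumH tau : 0 < Im tau ->
  hassum (famH tau) (2%:R * ev (cfps R (serA k.-1)) (ce tau)).
Proof.
move=> t0; pose q := ce tau; have q1 : normc q < 1 by apply: normc_ce_lt1.
pose g (m : int) : C := chc m * (if m == 0 then 0 else
   if 0 < m then ev (pw R k.-1) (q ^+ absz m) else - ev (pw R k.-1) (q ^+ absz m)).
have Hg : hassum (fun m : nat => g m.+1%:Z) (ev (cfps R (serA k.-1)) q).
  have B (a b : nat) : (0 < a)%N -> (0 < b)%N ->
      `|chi3 a * b%:Z ^+ k.-1| <= 1%:Z * (a * b)%:Z ^+ k.-1.
    move=> a0 b0; have ha : `|chi3 a| <= a%:Z ^+ k.-1.
      by rewrite -chz_nat; apply: le_trans (chz_norm _) _; rewrite exprn_ege1.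
    by rewrite normrM mul1r PoszM exprMn normrX ler_pM ?exprn_ge0.
  have := hassum_lam B q1; rewrite -[lam _]lam_swap -/(serA k.-1) => H.
  apply: hassum_fubini H _ => m.
  have qm : normc (q ^+ m.+1) < 1 by rewrite normcX exprn_ilt1 ?normc_ge0.
  have := hassum_shift _ (hassumZ (chc m.+1) (evP (@conv_pw R k.-1) qm)).
  rewrite /g /= => H'; apply: hassum_ext (H' _) => [n|].
    by rewrite /chc chz_nat /pw intrM rmorphXn /= -exprM mulrA.
  by rewrite /pw expr0n; case: (k) k3 => [|[|[]]]//= *; rewrite mul0r mulr0.
have gN m : g (- m.+1%:Z) = g m.+1%:Z.
  rewrite /g /chc chzN oppr_eq0 oppr_gt0 abszN /=.
  by rewrite intrN mulNr mulrN opprK.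
have := hassum_int Hg (hassum_ext (fun n => esym (gN n)) Hg).
have g0 : g 0 = 0 by rewrite /g eqxx mulr0.
rewrite g0 add0r -mulr2n mulr_natl.
move=> Hsum; apply: (@hassum_rows R _ _ (famH tau) g _ (asumH t0) _ Hsum) => m.
rewrite /famH /g /=; case: (ltrgtP m 0) => [m0|m0|->].
- have [n n0 ->] : exists2 n : nat, (0 < n)%N & m = - n%:Z by exists (absz m); lia.
  rewrite abszN intrN; apply: hassumZ; exact: rowH_neg.
- have [n n0 ->] : exists2 n : nat, (0 < n)%N & m = n%:Z by exists (absz m); lia.
  apply: hassumZ; exact: rowH.
- rewrite [X in hassum _ X]mulr0; apply: hassum_ext (@hassum0 R _) => n.
  by rewrite /chc /= mul0r.
Qed.

Lemma omega_cube : omega ^+ 3 = 1.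
Proof. by rewrite -ceMn mulVf ?pnatr_eq0// ce1. Qed.

(** [del] is the Gauss sum of the character; the formula produces chi(d) from the shifts of z by 1/3
    and -1/3. *)
Lemma omega_pow (d : nat) : omega ^+ d - (omega^-1) ^+ d = chc d * del.
Proof.
rewrite {1 2}(divn_eq d 3) !exprD ![(_ * 3)%N]mulnC !exprM exprVn omega_cube invr1 !expr1n !mul1r.
rewrite /chc chz_nat chi3E.
case: (mod3P d) => ->; rewrite /= ?expr0 ?expr1 ?mul1r ?mulN1r ?mul0r ?subrr//.
have o2 : omega ^+ 2 = omega^-1.
  by apply: (mulfI (ce_neq0 (3%:R^-1 : C))); rewrite -exprS omega_cube divff ?ce_neq0.
by rewrite exprVn o2 invrK opprB.
Qed.

Lemma a_3 w : a_ (3%:R * w) = 3%:R ^- k * a_ w.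
Proof. exact: at_M. Qed.

(** For n = 3 l + s with s = 1 or -1, 3 z + n = 3 ((z + s / 3) + l), so each residue class is a
    Lipschitz sum at z + s / 3. *)
Lemma hassum_chi (z : C) : 0 <= Im z -> ce (z + 3%:R^-1) != 1 -> ce (z - 3%:R^-1) != 1 ->
  hassum (fun n : int => chc n * a_ (3%:R * z + n%:~R))
    (3%:R ^- k * (Ls (z + 3%:R^-1) - Ls (z - 3%:R^-1))).
Proof.
move=> z0 h1 h2.
have n3 : 3%:R != 0 :> C by rewrite pnatr_eq0.
have I3 : Im (3%:R^-1 : C) = 0.
  by rewrite -(rmorph_nat (real_complex R)) -fmorphV.
have res (s : int) (y : C) : s \in [:: 1; -1] -> 3%:R * y = s%:~R -> Im y = 0 -> ce (z + y) != 1 ->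
    hassum (fun n : int => if (n %% 3)%Z == (s %% 3)%Z then a_ (3%:R * z + n%:~R) else 0)
      (3%:R ^- k * Ls (z + y)).
  move=> hs ys Iy hy.
  have H := hassumZ (3%:R ^- k) (lipschitz k2 P_cvg P_bound P_series
     (_ : 0 <= Im (z + y)) hy).
  apply: (@hassum_inj _ _ _ (fun l : int => l * 3 + s)).
  - by move=> l l' E; lia.
  - move=> n; case: (_ =P (s %% 3)%Z) => [E _|]; last by rewrite eqxx.
    by exists ((n - s) %/ 3)%Z; move: hs E; rewrite !inE => /orP[]/eqP->; lia.
  apply: hassum_ext (H _) => [l|]; last by rewrite ImD Iy addr0.
  rewrite /= modzMDl eqxx -[P 1 / _]/(a_ (z + y + l%:~R)) -a_3; congr a_.
  by rewrite intrD intrM -ys; ring.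
have H1 := res 1 3%:R^-1 isT (divff n3) I3 h1.
have H2 := res (-1) (- 3%:R^-1) isT.
have {}H2 := H2 (_ : 3%:R * - 3%:R^-1 = _) (_ : Im (- 3%:R^-1) = 0) h2.
rewrite mulrBr -[X in _ + X]mulN1r.
apply: hassum_ext (hassumD H1 (hassumZ (-1) (H2 _ _))) => [n| |].
- rewrite /chc /chz; have -> : (1 %% 3)%Z = 1 by [].
  have -> : (-1 %% 3)%Z = 2 by [].
  case: ((n %% 3)%Z =P 1) => [E|_].
    by rewrite E /= mulr0 addr0 mul1r.
  by case: ((n %% 3)%Z == 2); [rewrite add0r; congr (_ * _)|rewrite add0r mulr0 mul0r].
- by rewrite mulrN divff.
- by rewrite ImN I3 oppr0.
Qed.

End Lattice2.

Section Lattice3.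
Variable R : realType.
Local Notation C := R[i].
Implicit Types z w x tau : C.
Variables (k : nat) (P : C -> C) (Pb : R) (rho : int).
Hypothesis k3 : (3 <= k)%N.
Hypothesis k_odd : odd k.
Hypothesis P_cvg : forall u l, ccvg u l -> ccvg (fun n => P (u n)) (P l).
Hypothesis P_bound : forall u, normc u <= 1 -> normc (P u) <= Pb.
Hypothesis P_series : forall u, normc u < 1 -> (1 - u) ^+ k * ev (pw R k.-1) u = P u.
Local Notation omega := (ce (3%:R^-1 : C)).
Local Notation del := (omega - omega^-1).
Hypothesis rho0 : rho != 0.
Hypothesis P_omega :
  P omega / (1 - omega) ^+ k - P omega^-1 / (1 - omega^-1) ^+ k = 2%:R * del / rho%:~R.

Local Notation a_ := (at_ k P).
Local Notation chc n := ((chz n)%:~R : C).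
Let Ls z := P (ce z) / (1 - ce z) ^+ k.

(** The sum of the row m = 0, in essence the value at k of the L-series of the character. The rows m
    and - m together carry [cG] times [rho], so [rho] is the ratio of the q-series to the constant
    term. *)
Definition cG : C := 3%:R ^- k * (2%:R * del / rho%:~R).
Definition valG tau : C := cG * (1 + rho%:~R * ev (cfps R (serB k.-1)) (ce tau)).
Definition valH tau : C := 2%:R * ev (cfps R (serA k.-1)) (ce tau).

Lemma Im_third : Im (3%:R^-1 : C) = 0.
Proof. by rewrite -(rmorph_nat (real_complex R)) -fmorphV. Qed.

Lemma omega_neq1 : omega != 1.
Proof.
have -> : (3%:R^-1 : C) = (3%:R^-1)%:C%C by rewrite fmorphV rmorph_nat.
by apply: ce_real_neq1; lra.
Qed.

Lemma rowG tau m : 0 < Im tau -> (0 < m)%N ->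
  hassum (fun n : int => chc n * a_ (3%:R * (m%:R * tau) + n%:~R))
    (3%:R ^- k * (Ls (m%:R * tau + 3%:R^-1) - Ls (m%:R * tau - 3%:R^-1))).
Proof.
move=> t0 m0; have z0 : 0 < Im (m%:R * tau) by rewrite mulrC ImMn mulr_gt0// ltr0n.
have h1 : 0 < Im (m%:R * tau + 3%:R^-1) by rewrite ImD Im_third addr0.
have h2 : 0 < Im (m%:R * tau - 3%:R^-1) by rewrite ImD ImN Im_third oppr0 addr0.
exact: (hassum_chi k3 k_odd P_cvg P_bound P_series (ltW z0) (ce_neq1 h1) (ce_neq1 h2)).
Qed.

Lemma rowG0 : hassum (fun n : int => chc n * a_ n%:~R) cG.
Proof.
have h1 : ce (0 + 3%:R^-1 : C) != 1 by rewrite add0r omega_neq1.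
have h2 : ce (0 - 3%:R^-1 : C) != 1.
  by rewrite sub0r ceN; apply: contra_neq omega_neq1 => h; rewrite -[omega]invrK h invr1.
have := hassum_chi k3 k_odd P_cvg P_bound P_series (lexx 0 : 0 <= Im (0 : C)) h1 h2.
rewrite add0r sub0r ceN P_omega -/cG => H.
by apply: hassum_ext H => n; rewrite mulr0 add0r.
Qed.

Lemma hassumG tau : 0 < Im tau -> hassum (famG k P tau) (valG tau).
Proof.
move=> t0; pose q := ce tau; have q1 : normc q < 1 by apply: normc_ce_lt1.
pose r (m : nat) : C := 3%:R ^- k * (Ls (m%:R * tau + 3%:R^-1) - Ls (m%:R * tau - 3%:R^-1)).
pose g (m : int) : C := if m == 0 then cG else r (absz m).
have Hg : hassum (fun m : nat => g m.+1%:Z) (3%:R ^- k * del * ev (cfps R (serB k.-1)) q).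
  have B (a b : nat) : (0 < a)%N -> (0 < b)%N ->
      `|chi3 b * b%:Z ^+ k.-1| <= 1%:Z * (a * b)%:Z ^+ k.-1.
    move=> a0 b0; rewrite normrM mul1r PoszM exprMn normrX.
    have hb : `|chi3 b| <= 1 by rewrite -chz_nat chz_norm.
    by rewrite ler_pM ?exprn_ge0// (le_trans hb)// exprn_ege1.
  have := hassum_lam B q1; rewrite -[lam _]lam_swap -/(serB k.-1) => /(hassumZ (3%:R ^- k * del)) H.
  apply: hassum_fubini H _ => m; rewrite /g /= /r.
  have qm : normc (q ^+ m.+1) < 1 by rewrite normcX exprn_ilt1 ?normc_ge0.
  have o1 : normc omega = 1 by rewrite normc_ce Im_third mulr0 oppr0 expR0.
  have x1 : normc (q ^+ m.+1 * omega) < 1 by rewrite normcM o1 mulr1.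
  have x2 : normc (q ^+ m.+1 * omega^-1) < 1 by rewrite normcM normcV o1 invr1 mulr1.
  have cz : ce (m.+1%:R * tau) = q ^+ m.+1 by rewrite mulrC ceMn.
  rewrite /Ls !ceD ceN cz (P_ev P_series x1) (P_ev P_series x2).
  have cp := @conv_pw R k.-1.
  have := hassumD (evP cp x1) (hassumZ (-1) (evP cp x2)); rewrite mulN1r => {}H.
  have := hassum_shift _ (hassumZ (3%:R ^- k) H) => {}H.
  apply: hassum_ext (H _) => [n|].
    rewrite /pw mulN1r !exprMn -mulrBr -mulrBr omega_pow chz_nat intrM rmorphXn /= -exprM.
    rewrite -[(n.+1)%:~R]/(n.+1%:R); ring.
  by rewrite !expr0 mulN1r subrr mulr0.
have gN m : g (- m.+1%:Z) = g m.+1%:Z by rewrite /g oppr_eq0 abszN.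
have := hassum_int Hg (hassum_ext (fun n => esym (gN n)) Hg).
have -> : g 0 + 3%:R ^- k * del * ev (cfps R (serB k.-1)) q +
    3%:R ^- k * del * ev (cfps R (serB k.-1)) q
    = valG tau.
  rewrite /valG /g eqxx -/q /cG; have : rho%:~R != 0 :> C by rewrite intr_eq0.
  by move: (rho%:~R) (3%:R ^- k) (omega - _) => s t e s0; field.
move=> Hsum; apply: (@hassum_rows R _ _ (famG k P tau) g _ (asumG P k3 k_odd t0) _ Hsum) => m.
rewrite /famG /g /=; case: (ltrgtP m 0) => [m0|m0|->].
- have [n n0 ->] : exists2 n : nat, (0 < n)%N & m = - n%:Z by exists (absz m); lia.
  rewrite abszN; apply: (@hassum_bij _ _ _ -%R -%R); try exact: opprK.
  apply: hassum_ext (rowG t0 n0) => l /=.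
  rewrite chzN !intrN mulNr -mulrN -(at_N P k_odd); congr (_ * a_ _).
  by rewrite -[(n%:Z)%:~R]/(n%:R); ring.
- have [n n0 ->] : exists2 n : nat, (0 < n)%N & m = n%:Z by exists (absz m); lia.
  by apply: hassum_ext (rowG t0 n0) => l; rewrite mulrA.
- by apply: hassum_ext rowG0 => l; rewrite mulr0 mul0r add0r.
Qed.

(** For (m', n') = (- n, m), 3 m' fricke(tau) + n' = (m tau + n) / tau, and the character moves from
    the second index to the first. *)
Lemma valG_fricke tau : 0 < Im tau -> valG (fricke tau) = tau ^+ k * valH tau.
Proof.
move=> t0; have tn0 := Im_gt0_neq0 t0; have n3 : 3%:R != 0 :> C by rewrite pnatr_eq0.
apply: (hassum_uniq (hassumG (Im_fricke_gt0 t0))).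
apply: (@hassum_bij _ _ _ (fun p : int * int => (- p.2, p.1)) (fun p => (p.2, - p.1))).
- by move=> [a b] /=; rewrite opprK.
- by move=> [a b] /=; rewrite opprK.
apply: hassum_ext (hassumZ (tau ^+ k) (hassumH k3 k_odd P_cvg P_bound P_series t0)) => -[m n].
rewrite /famG /famH /= mulrCA; congr (_ * _).
have -> : 3%:R * (- n)%:~R * fricke tau + m%:~R = tau^-1 * (m%:~R * tau + n%:~R).
  by rewrite /fricke intrN; field.
by rewrite at_M exprVn invrK.
Qed.

(** The matrix permutes the index pairs. Modulo 3 the second index is multiplied by a, and chi(a) =
    chi(d) because a d = 1 mod 3. *)
Lemma valG_gamma0 tau (a b c d : int) : 0 < Im tau -> a * d - 3 * b * c = 1 ->
  3%:R * c%:~R * tau + d%:~R != 0 ->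
  0 < Im ((a%:~R * tau + b%:~R) / (3%:R * c%:~R * tau + d%:~R)) ->
  valG ((a%:~R * tau + b%:~R) / (3%:R * c%:~R * tau + d%:~R)) =
  chc d * (3%:R * c%:~R * tau + d%:~R) ^+ k * valG tau.
Proof.
move=> t0 det j0 g0; set j := 3%:R * _ * _ + _ in j0 g0 *.
apply: (hassum_uniq (hassumG g0)).
pose h (p : int * int) := (d * p.1 - c * p.2, - (3 * b * p.1) + a * p.2).
pose h' (p : int * int) := (a * p.1 + c * p.2, 3 * b * p.1 + d * p.2).
have detE (x : int) : (a * d - 3 * b * c) * x = x by rewrite det mul1r.
apply: (@hassum_bij _ _ _ h h').
- move=> [m n]; rewrite /h /h' /=; congr (_, _).
    by rewrite -[RHS]detE; ring.
  by rewrite -[RHS]detE; ring.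
- move=> [m n]; rewrite /h /h' /=; congr (_, _).
    by rewrite -[RHS]detE; ring.
  by rewrite -[RHS]detE; ring.
apply: hassum_ext (hassumZ (chc d * j ^+ k) (hassumG t0)) => -[m n].
rewrite /famG /h /=.
have chd : chz (- (3 * b * m) + a * n) = chz d * chz n.
  have -> : chz (- (3 * b * m) + a * n) = chz (a * n).
    by apply: (@chz_mod _ _ (- (b * m))); ring.
  rewrite chzM; congr (_ * _).
  have e : chz (a * d) = 1 by rewrite (@chz_mod _ 1 (b * c))//; lia.
  move: e; rewrite chzM /chz; do 2 (case: ifP => _; last case: ifP => _); done.
rewrite chd intrM.
have -> : 3%:R * (d * m - c * n)%:~R * ((a%:~R * tau + b%:~R) / j) + (- (3 * b * m) + a * n)%:~R
   = j^-1 * (3%:R * m%:~R * tau + n%:~R).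
  have detC : a%:~R * d%:~R - 3%:R * b%:~R * c%:~R = 1 :> C.
    by rewrite -[3%:R]/((3 : int)%:~R) -!intrM -intrB det.
  have -> : j^-1 * (3%:R * m%:~R * tau + n%:~R) =
     j^-1 * ((a%:~R * d%:~R - 3%:R * b%:~R * c%:~R) * (3%:R * m%:~R * tau + n%:~R)).
    by rewrite detC mul1r.
  have jj : (- (3 * b * m) + a * n)%:~R = j^-1 * (j * (- (3 * b * m) + a * n)%:~R).
    by rewrite mulKf.
  rewrite jj mulrA [_ * j^-1]mulrC -mulrDr; congr (_ * _).
  by rewrite /j; ring.
rewrite at_M exprVn invrK; ring.
Qed.

Lemma valH_gamma0 tau (a b c d : int) : 0 < Im tau -> a * d - 3 * b * c = 1 ->
  3%:R * c%:~R * tau + d%:~R != 0 ->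
  0 < Im ((a%:~R * tau + b%:~R) / (3%:R * c%:~R * tau + d%:~R)) ->
  valH ((a%:~R * tau + b%:~R) / (3%:R * c%:~R * tau + d%:~R)) =
  chc d * (3%:R * c%:~R * tau + d%:~R) ^+ k * valH tau.
Proof.
move=> t0 det j0 g0; set j := 3%:R * _ * _ + _ in j0 g0 *.
have HH z (z0 : 0 < Im z) := hassumH k3 k_odd P_cvg P_bound P_series z0.
apply: (hassum_uniq (HH _ g0)).
pose h (p : int * int) := (d * p.1 - 3 * c * p.2, - (b * p.1) + a * p.2).
pose h' (p : int * int) := (a * p.1 + 3 * c * p.2, b * p.1 + d * p.2).
have detE (x : int) : (a * d - 3 * b * c) * x = x by rewrite det mul1r.
apply: (@hassum_bij _ _ _ h h').
- move=> [m n]; rewrite /h /h' /=; congr (_, _).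
    by rewrite -[RHS]detE; ring.
  by rewrite -[RHS]detE; ring.
- move=> [m n]; rewrite /h /h' /=; congr (_, _).
    by rewrite -[RHS]detE; ring.
  by rewrite -[RHS]detE; ring.
apply: hassum_ext (hassumZ (chc d * j ^+ k) (HH _ t0)) => -[m n].
rewrite /famH /h /=.
have chd : chz (d * m - 3 * c * n) = chz d * chz m.
  by rewrite -chzM; apply: (@chz_mod _ _ (- (c * n))); ring.
rewrite chd intrM.
have -> : (d * m - 3 * c * n)%:~R * ((a%:~R * tau + b%:~R) / j) + (- (b * m) + a * n)%:~R
   = j^-1 * (m%:~R * tau + n%:~R).
  have detC : a%:~R * d%:~R - 3%:R * b%:~R * c%:~R = 1 :> C.
    by rewrite -[3%:R]/((3 : int)%:~R) -!intrM -intrB det.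
  have -> : j^-1 * (m%:~R * tau + n%:~R) =
     j^-1 * ((a%:~R * d%:~R - 3%:R * b%:~R * c%:~R) * (m%:~R * tau + n%:~R)) by rewrite detC mul1r.
  have jj : (- (b * m) + a * n)%:~R = j^-1 * (j * (- (b * m) + a * n)%:~R).
    by rewrite mulKf.
  rewrite jj mulrA [_ * j^-1]mulrC -mulrDr; congr (_ * _).
  by rewrite /j; ring.
rewrite at_M exprVn invrK; ring.
Qed.

End Lattice3.

(** * Modular forms of weight 3 and 5 *)

Section Kernels.
Variable R : realType.
Local Notation C := R[i].
Implicit Types z w u tau : C.
Local Notation omega := (ce (3%:R^-1 : C)).
Local Notation del := (omega - omega^-1).
Local Notation X := (fpsX C 1).

(** Apply q d/dq to the hypothesis and multiply by 1 - X; this is the recursion of the Eulerian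
    polynomials. *)
Lemma pw_step m (f : fps C) : (1 - X) ^+ m.+1 * pw R m = f ->
  (1 - X) ^+ m.+2 * pw R m.+1 = (1 - X) * fps_deriv f + m.+1%:R * X * f.
Proof.
move=> <- {f}; rewrite fps_derivM fps_derivX.
have -> : pw R m.+1 = fps_deriv (pw R m).
  by apply/funext => n; rewrite /pw /fps_deriv exprS.
have -> : fps_deriv (1 - X) = - X.
  apply/funext => n; rewrite /fps_deriv fpsB fpsN fps1 /fpsXn.
  by case: n => [|[|n]]; rewrite ?mul0r ?subrr ?sub0r ?mul1r ?mulr0 //= ?mulr0 ?oppr0.
rewrite (exprS _ m.+1) (exprS _ m); move: (pw R m) (fps_deriv _) (_ ^+ m) => f df D.
by ring.
Qed.

Lemma deriv_X n : fps_deriv (fpsX C n) = n%:R * fpsX C 1 ^+ n.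
Proof. by rewrite fps_derivXn fpsXnX mul1n. Qed.

Lemma derivD (f g : fps C) : fps_deriv (f + g) = fps_deriv f + fps_deriv g.
Proof. by apply/funext => n; rewrite /fps_deriv fpsD mulrDr. Qed.

Lemma deriv_natM n (f : fps C) : fps_deriv (n%:R * f) = n%:R * fps_deriv f.
Proof. by apply/funext => k; rewrite /fps_deriv !fps_natM mulrCA. Qed.

Lemma deriv_Xn n : fps_deriv (X ^+ n) = n%:R * X ^+ n.
Proof. by rewrite fpsXnX mul1n deriv_X fpsXnX mul1n. Qed.

Lemma pw0 : (1 - X) ^+ 1 * pw R 0 = 1.
Proof.
rewrite expr1 mulrBl mul1r; apply/funext => n; rewrite fpsB fpsXnM fps1 /pw.
by case: n => [|n]; rewrite ?subr0 //= !expr0 subrr.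
Qed.

Lemma pw1 : (1 - X) ^+ 2 * pw R 1 = X.
Proof. by rewrite (pw_step pw0) fps_deriv1 mulr0 add0r mul1r mulr1. Qed.

Lemma pw2 : (1 - X) ^+ 3 * pw R 2 = X + X ^+ 2.
Proof. by rewrite (pw_step pw1) fps_derivXn; ring. Qed.

Lemma pw4 : (1 - X) ^+ 5 * pw R 4 = X + 11%:R * X ^+ 2 + 11%:R * X ^+ 3 + X ^+ 4.
Proof.
have pw3 : (1 - X) ^+ 4 * pw R 3 = X + 4%:R * X ^+ 2 + X ^+ 3.
  by rewrite (pw_step pw2) !derivD fps_derivXn deriv_Xn; ring.
by rewrite (pw_step pw3) !derivD deriv_natM fps_derivXn !deriv_Xn; ring.
Qed.

(* The Eulerian polynomials: pw R k.-1 is the series of ker_k u / (1 - u) ^ k. *)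
Definition ker3 u : C := u + u ^+ 2.
Definition ker5 u : C := u + 11%:R * u ^+ 2 + 11%:R * u ^+ 3 + u ^+ 4.

Lemma conv_1X : conv (1 - X : fps C).
Proof. by apply: convD; [exact: conv1|apply/convN/convX]. Qed.

Lemma ev_1X u : normc u < 1 -> ev (1 - X : fps C) u = 1 - u.
Proof.
move=> u1; have cX : conv (X : fps C) by exact: convX.
have -> : 1 - X = 1 + fpsC (-1) * X :> fps C.
  by congr (_ + _); apply/funext => n; rewrite fpsCM mulN1r.
by rewrite evD ?evCM ?ev1 ?evXn ?mulN1r//; [exact: conv1|exact: convC].
Qed.

Lemma ev_pw k (f : fps C) u : (1 - X) ^+ k.+1 * pw R k = f -> normc u < 1 ->
  (1 - u) ^+ k.+1 * ev (pw R k) u = ev f u.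
Proof.
move=> <- u1; rewrite evM ?evX ?ev_1X//; [exact: conv_1X|exact/conv_expr/conv_1X|exact: conv_pw].
Qed.

Lemma ev_natM n (f : fps C) u : conv f -> normc u < 1 -> ev (n%:R * f) u = n%:R * ev f u.
Proof.
move=> cf u1; rewrite -evCM//; congr (ev _ u); apply/funext => m.
by rewrite fps_natM fpsCM.
Qed.

Lemma conv_natMl n (f : fps C) : conv f -> conv (n%:R * f).
Proof.
move=> /(convC (n%:R)); have -> // : fpsC n%:R * f = n%:R * f.
by apply/funext => m; rewrite fps_natM fpsCM.
Qed.

Lemma ker3_series u : normc u < 1 -> (1 - u) ^+ 3 * ev (pw R 2) u = ker3 u.
Proof.
move=> u1; rewrite (ev_pw pw2 u1) fpsXnX mul1n evD ?evXn//; exact: convX.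
Qed.

Lemma ker5_series u : normc u < 1 -> (1 - u) ^+ 5 * ev (pw R 4) u = ker5 u.
Proof.
move=> u1; rewrite (ev_pw pw4 u1) !fpsXnX !mul1n.
have cX k : conv (fpsX C k) by exact: convX.
have cn k n : conv (n%:R * fpsX C k) by exact: conv_natMl.
have c2 : conv (fpsX C 1 + 11%:R * fpsX C 2) by exact: convD.
have c3 : conv (fpsX C 1 + 11%:R * fpsX C 2 + 11%:R * fpsX C 3) by exact: convD.
rewrite (evD c3 (cX 4%N) u1) (evD c2 (cn 3%N 11%N) u1) (evD (cX 1%N) (cn 2%N 11%N) u1).
by rewrite !(ev_natM _ (cX _) u1) !evXn.
Qed.

Lemma ker3_cvg (u : nat -> C) l : ccvg u l -> ccvg (fun n => ker3 (u n)) (ker3 l).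
Proof. by move=> ul; apply: ccvgD => //; apply: ccvgX. Qed.

Lemma ker5_cvg (u : nat -> C) l : ccvg u l -> ccvg (fun n => ker5 (u n)) (ker5 l).
Proof.
move=> ul; rewrite /ker5; apply: ccvgD; last exact: ccvgX.
by do 2 (apply: ccvgD; last by apply: ccvgM (ccvgX _ ul); exact: ccvg_cst).
Qed.

Lemma ker3_bound u : normc u <= 1 -> normc (ker3 u) <= 2.
Proof.
move=> u1; apply: le_trans (le_normcD _ _) _; rewrite normcX.
by have : normc u ^+ 2 <= 1 by [rewrite exprn_ile1 ?normc_ge0]; lra.
Qed.

Lemma ker5_bound u : normc u <= 1 -> normc (ker5 u) <= 24%:R.
Proof.
move=> u1; have uk k : normc (u ^+ k) <= 1 by rewrite normcX exprn_ile1 ?normc_ge0.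
rewrite /ker5; apply: le_trans (le_normcD _ _) _; apply: le_trans (lerD (le_normcD _ _) (lexx _)) _.
apply: le_trans (lerD (lerD (le_normcD _ _) (lexx _)) (lexx _)) _.
move: (uk 2%N) (uk 3%N) (uk 4%N); move: (u ^+ 2) (u ^+ 3) (u ^+ 4) => a b c.
by rewrite !normcM !normc_nat; lra.
Qed.

Lemma omega_sum : omega ^+ 2 + omega + 1 = 0.
Proof.
have /eqP : (omega - 1) * (omega ^+ 2 + omega + 1) = 0.
  have -> : (omega - 1) * (omega ^+ 2 + omega + 1) = omega ^+ 3 - 1 by ring.
  by rewrite omega_cube subrr.
by rewrite mulf_eq0 subr_eq0 (negPf (omega_neq1 R)) /= => /eqP.
Qed.

Lemma omegaV : omega^-1 = - 1 - omega.
Proof.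
apply: (mulfI (ce_neq0 (3%:R^-1 : C))); rewrite divff ?ce_neq0//.
by have := omega_sum; move: omega => w h; rewrite -[LHS]subr0 -h; ring.
Qed.

Lemma del_sqr : del ^+ 2 = - 3%:R.
Proof.
rewrite omegaV; have := omega_sum; move: omega => w h.
by rewrite -[RHS]addr0 -(mulr0 4%:R) -h; ring.
Qed.

Lemma del_neq0 : del != 0.
Proof. by rewrite -sqrf_eq0 del_sqr oppr_eq0 pnatr_eq0. Qed.

Lemma one_minus_omega3 : (1 - omega) ^+ 3 = - 3%:R * del /\ (1 - omega^-1) ^+ 3 = 3%:R * del.
Proof.
rewrite omegaV; have := omega_sum; move: omega => w h.
have w2 : w ^+ 2 = - 1 - w by rewrite -[RHS]addr0 -h; ring.
have w3 : w ^+ 3 = 1 by rewrite exprS w2 mulrBr mulrN1 -expr2 w2; ring.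
have E1 : (1 - w) ^+ 3 = 1 - 3%:R * w + 3%:R * w ^+ 2 - w ^+ 3 by ring.
have E2 : (1 - (- 1 - w)) ^+ 3 = 8%:R + 12%:R * w + 6%:R * w ^+ 2 + w ^+ 3 by ring.
by rewrite E1 E2 w2 w3; split; ring.
Qed.

(** This yields [rho] = -9, the coefficient of [serB 2] in [eisB]; likewise [ker5_omega] yields the
    3 of [eisC]. *)
Lemma ker3_omega : ker3 omega / (1 - omega) ^+ 3 - ker3 omega^-1 / (1 - omega^-1) ^+ 3
  = 2%:R * del / (-9)%:~R.
Proof.
have [-> ->] := one_minus_omega3; have := del_sqr; have := del_neq0.
have -> : ker3 omega = -1.
  by rewrite /ker3; have := omega_sum; move: omega => w h; rewrite -[RHS]addr0 -h; ring.
have -> : ker3 omega^-1 = -1.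
  by rewrite /ker3 omegaV; have := omega_sum; move: omega => w h; rewrite -[RHS]addr0 -h; ring.
move: del => d d0 d2; have -> : (-9)%:~R = 3%:R * d ^+ 2 by rewrite d2; ring.
by field.
Qed.

Lemma ker5_omega : ker5 omega / (1 - omega) ^+ 5 - ker5 omega^-1 / (1 - omega^-1) ^+ 5
  = 2%:R * del / 3%:~R.
Proof.
have [o1 o2] := one_minus_omega3; rewrite ![_ ^+ 5](exprD _ 3 2) o1 o2.
have := del_sqr; have := del_neq0; have w0 : omega != 0 by exact: ce_neq0.
have v0 : omega^-1 != 0 by rewrite invr_eq0.
have r5 (w : C) : w ^+ 2 + w + 1 = 0 -> ker5 w = - 9%:R * w.
  rewrite /ker5 => h; have w2 : w ^+ 2 = - 1 - w by rewrite -[RHS]addr0 -h; ring.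
  have w3 : w ^+ 3 = 1 by rewrite exprS w2 mulrBr mulrN1 -expr2 w2; ring.
  by rewrite (exprS _ 3) w3 w2; ring.
have r2 (w : C) : w ^+ 2 + w + 1 = 0 -> (1 - w) ^+ 2 = - 3%:R * w.
  by move=> h; rewrite -[RHS]addr0 -h; ring.
have h1 := omega_sum.
have h2 : omega^-1 ^+ 2 + omega^-1 + 1 = 0.
  by rewrite omegaV; move: h1; move: omega => w h; rewrite -[RHS]h; ring.
rewrite (r5 _ h1) (r5 _ h2) (r2 _ h1) (r2 _ h2).
move: v0 w0; move: del => d; move: omega => w; move: (w^-1) => v v0 w0 d0 d2.
rewrite (_ : 3%:~R = - d ^+ 2 :> C); last by rewrite d2 opprK.
by field; rewrite d0 v0 w0.
Qed.
End Kernels.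

Definition eisC : fps int := 1 + 3 * serB 4.

Section Modular.
Variable R : realType.
Local Notation C := R[i].
Implicit Types z w tau : C.
Implicit Types f g : fps int.
Local Notation cv f := (conv (cfps R f)).

Definition mf f z : C := ev (cfps R f) (ce z).

Lemma mfE f z : mf f z = ev (cfps R f) (ce z). Proof. by []. Qed.

Lemma mfM f g z : 0 < Im z -> cv f -> cv g -> mf (f * g) z = mf f z * mf g z.
Proof. by move=> z0 cf cg; rewrite /mf cfpsM evM ?normc_ce_lt1. Qed.

Lemma mfX f k z : 0 < Im z -> cv f -> mf (f ^+ k) z = mf f z ^+ k.
Proof. by move=> z0 cf; rewrite /mf cfpsX evX ?normc_ce_lt1. Qed.

Lemma mfXn k z : mf (fpsX int k) z = ce z ^+ k.
Proof. by rewrite /mf cfpsXn evXn. Qed.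

Lemma mf1 z : mf 1 z = 1.
Proof. by rewrite /mf cfps1 ev1. Qed.

Lemma cvM f g : cv f -> cv g -> cv (f * g).
Proof. by rewrite cfpsM; exact: convM. Qed.

Lemma cvX f k : cv f -> cv (f ^+ k).
Proof. by rewrite cfpsX; exact: conv_expr. Qed.

Lemma cvXn k : cv (fpsX int k).
Proof. by rewrite cfpsXn; exact: convX. Qed.

Lemma cv_serA k : cv (serA k).
Proof.
apply: (@conv_lam R _ 1 k) => a x a0 x0.
rewrite normrM mul1r PoszM exprMn normrX mulrC ler_pM ?exprn_ge0//.
by rewrite (@le_trans _ _ 1)// ?exprn_ege1// -chz_nat chz_norm.
Qed.

Lemma cv_serB k : cv (serB k).
Proof.
apply: (@conv_lam R _ 1 k) => a x a0 x0.
rewrite normrM mul1r PoszM exprMn normrX mulrC; apply: ler_pM; rewrite ?exprn_ge0//.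
by rewrite (@le_trans _ _ 1)// ?exprn_ege1// -chz_nat chz_norm.
Qed.

Lemma cfps_affine (c : int) f : cfps R (1 + c%:~R * f) = 1 + fpsC (c%:~R) * cfps R f.
Proof.
rewrite cfpsD cfps1; congr (_ + _); apply/funext => n; rewrite /cfps fpsCM -intrM; congr _%:~R.
by case: c => m; rewrite ?NegzE ?mulrNz ?mulNr ?fpsN fps_natM natz.
Qed.

Lemma mf_affine (c : int) f z : 0 < Im z -> cv f ->
  mf (1 + c%:~R * f) z = 1 + c%:~R * mf f z.
Proof.
move=> z0 cf; rewrite /mf cfps_affine evD ?ev1 ?evCM ?normc_ce_lt1//; first exact: conv1.
exact: convC.
Qed.

Lemma cv_affine (c : int) f : cv f -> cv (1 + c%:~R * f).
Proof. by move=> cf; rewrite cfps_affine; apply: convD; [exact: conv1|exact: convC]. Qed.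

Lemma eisB_affine : eisB = 1 + (-9)%:~R * serB 2.
Proof. by rewrite /eisB; ring. Qed.

Lemma eisC_affine : eisC = 1 + 3%:~R * serB 4.
Proof. by []. Qed.

Lemma cv_eisB : cv eisB.
Proof. rewrite eisB_affine; exact/cv_affine/cv_serB. Qed.

Lemma cv_eisC : cv eisC.
Proof. rewrite eisC_affine; exact/cv_affine/cv_serB. Qed.

Lemma cv_ode (s f : fps int) : s 0%N = 0 -> fps_deriv f = s * f -> cv s -> cv f.
Proof.
by move=> s0 e cs; apply: (conv_ode _ _ cs); [rewrite /cfps s0|rewrite -cfps_deriv e cfpsM].
Qed.

(** The formal inverse solves the equation with - s, so it converges on the disc too. Hence f has no
    zero there, see [mf_unit_neq0]. *)
Lemma cv_odeV (s f : fps int) : f 0%N = 1 -> s 0%N = 0 -> fps_deriv f = s * f -> cv s ->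
  cv (ps_inv f : fps int).
Proof.
move=> f0 s0 e cs; apply: (cv_ode _ (fps_derivV_log (ps_mulV1 f0) e)).
  by rewrite fpsN s0 oppr0.
by rewrite cfpsN; exact: convN.
Qed.

Lemma cv_natM n f : cv f -> cv (n%:R * f).
Proof.
move=> cf; rewrite (_ : cfps R _ = fpsC n%:R * cfps R f); first exact: convC.
by apply/funext => m; rewrite /cfps fpsCM fps_natM intrM natz.
Qed.

Lemma cv_tlog : cv tlog.
Proof.
apply: (@conv_lam R _ 12 1) => a x a0 x0.
case: ifP => _; first by rewrite normr0.
by rewrite expr1; move: a0 x0; clear; rewrite -[12%:R]/(12%:Z) natz => a0 x0; nia.
Qed.

Lemma cv_logA : cv logA.
Proof.
apply: (cv_natM 3); apply: (@conv_lam R _ 8 1) => a x a0 x0.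
by rewrite expr1 /psiA; case: ifP => _; move: a0 x0; clear=> a0 x0; nia.
Qed.

Lemma cv_logB : cv logB.
Proof.
rewrite /logB mulNr cfpsN; apply/convN/(cv_natM 3); apply: (@conv_lam R _ 3 1) => a x a0 x0.
by rewrite expr1 /psiB; case: ifP => _; move: a0 x0; clear=> a0 x0; nia.
Qed.

Lemma logA0 : logA 0%N = 0. Proof. by rewrite /logA fps_natM lam0 mulr0. Qed.
Lemma logB0 : logB 0%N = 0. Proof. by rewrite /logB mulNr fpsN fps_natM lam0 mulr0 oppr0. Qed.

Definition ty_inv : fps int := ps_inv ty.

Lemma tyK : ty * ty_inv = 1. Proof. exact: ps_mulV1. Qed.

Lemma ty_inv0 : ty_inv 0%N = 1.
Proof. by have := fpsM0 ty ty_inv; rewrite tyK ty0 mul1r. Qed.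

Lemma cv_ty : cv ty.
Proof. by apply: (cv_ode _ ty_ode) cv_tlog; exact: lam0. Qed.

Lemma cv_ty_inv : cv ty_inv.
Proof. by apply: (cv_odeV ty0 _ ty_ode) cv_tlog; exact: lam0. Qed.

Lemma cv_eisA_inv : cv (ps_inv eisA : fps int).
Proof. exact: (cv_odeV eisA0 logA0 eisA_ode cv_logA). Qed.

Lemma cv_eisB_inv : cv (ps_inv eisB : fps int).
Proof. exact: (cv_odeV eisB00 logB0 eisB_ode cv_logB). Qed.

Definition gact (a b c d : int) z : C := (a%:~R * z + b%:~R) / (3%:R * c%:~R * z + d%:~R).

Lemma cG3_neq0 : cG R 3 (-9) != 0.
Proof.
rewrite /cG !mulf_neq0 ?invr_eq0 ?expf_neq0 ?pnatr_eq0 ?intr_eq0//; exact: del_neq0.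
Qed.

Lemma cG5_neq0 : cG R 5 3 != 0.
Proof.
rewrite /cG !mulf_neq0 ?invr_eq0 ?expf_neq0 ?pnatr_eq0 ?intr_eq0//; exact: del_neq0.
Qed.

Lemma valG3E z : 0 < Im z -> valG 3 (-9) z = cG R 3 (-9) * mf eisB z.
Proof. by move=> z0; rewrite eisB_affine mf_affine//; exact: cv_serB. Qed.

Lemma valG5E z : 0 < Im z -> valG 5 3 z = cG R 5 3 * mf eisC z.
Proof. by move=> z0; rewrite eisC_affine mf_affine//; exact: cv_serB. Qed.

Lemma eisB_fricke : exists2 nu : C, nu != 0 & forall z, 0 < Im z ->
  mf eisB (fricke z) = nu * z ^+ 3 * mf (serA 2) z.
Proof.
exists (2%:R / cG R 3 (-9)); first by rewrite mulf_neq0 ?invr_eq0 ?pnatr_eq0 ?cG3_neq0.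
move=> z z0; have := cG3_neq0; move/mulfI; apply; rewrite -valG3E ?Im_fricke_gt0//.
rewrite (valG_fricke _ _ (@ker3_cvg R) (@ker3_bound R) (@ker3_series R) _ (@ker3_omega R) z0)//.
by rewrite /valH /= -/(mf _ _); have := cG3_neq0; move: (cG _ _ _) => c c0; field.
Qed.

Lemma eisC_fricke : exists2 mu : C, mu != 0 & forall z, 0 < Im z ->
  mf eisC (fricke z) = mu * z ^+ 5 * mf (serA 4) z.
Proof.
exists (2%:R / cG R 5 3); first by rewrite mulf_neq0 ?invr_eq0 ?pnatr_eq0 ?cG5_neq0.
move=> z z0; have := cG5_neq0; move/mulfI; apply; rewrite -valG5E ?Im_fricke_gt0//.
rewrite (valG_fricke _ _ (@ker5_cvg R) (@ker5_bound R) (@ker5_series R) _ (@ker5_omega R) z0)//.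
by rewrite /valH /= -/(mf _ _); have := cG5_neq0; move: (cG _ _ _) => c c0; field.
Qed.

Section Gamma.
Variables (a b c d : int) (z : C).
Hypotheses (z0 : 0 < Im z) (det : a * d - 3 * b * c = 1)
  (j0 : 3%:R * c%:~R * z + d%:~R != 0 :> C) (g0 : 0 < Im (gact a b c d z)).

Lemma eisB_gact : mf eisB (gact a b c d z) =
  (chz d)%:~R * (3%:R * c%:~R * z + d%:~R) ^+ 3 * mf eisB z.
Proof.
apply: (mulfI cG3_neq0); rewrite -valG3E//.
rewrite (valG_gamma0 _ _ (@ker3_cvg R) (@ker3_bound R) (@ker3_series R) _ (@ker3_omega R)
  z0 det j0)//.
by rewrite valG3E//; ring.
Qed.

Lemma eisC_gact : mf eisC (gact a b c d z) =
  (chz d)%:~R * (3%:R * c%:~R * z + d%:~R) ^+ 5 * mf eisC z.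
Proof.
apply: (mulfI cG5_neq0); rewrite -valG5E//.
rewrite (valG_gamma0 _ _ (@ker5_cvg R) (@ker5_bound R) (@ker5_series R) _ (@ker5_omega R)
  z0 det j0)//.
by rewrite valG5E//; ring.
Qed.

Lemma serA2_gact : mf (serA 2) (gact a b c d z) =
  (chz d)%:~R * (3%:R * c%:~R * z + d%:~R) ^+ 3 * mf (serA 2) z.
Proof.
have := valH_gamma0 (isT : (2 < 3)%N) isT (@ker3_cvg R) (@ker3_bound R) (@ker3_series R)
  z0 det j0 g0.
rewrite /valH mulrCA; have n2 : 2%:R != 0 :> C by rewrite pnatr_eq0.
by move/(mulfI n2).
Qed.
End Gamma.
End Modular.

(** * The Hecke operator *)

(** The involution j -> -1 / (3 j) of the field with p elements, extended by 0 -> 0. It describes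
    how the Fricke involution permutes the points (z + j) / p. *)
Lemma neg_inv3_mod p : prime p -> (3 < p)%N ->
  exists2 s : 'I_p -> 'I_p, involutive s & forall j : 'I_p,
    if val j == 0%N then val (s j) = 0%N else (p %| 3 * j * s j + 1)%N.
Proof.
(* The carrier of ['F_p] is an ordinal type whose bound equals p by [Fp_cast] but not by
   computation, so the bound is generalised to n. *)
move=> pp p3; suff H n : n = (Zp_trunc (pdiv p)).+2 -> exists2 s : 'I_n -> 'I_n, involutive s &
    forall j : 'I_n, if val j == 0%N then val (s j) = 0%N else (p %| 3 * j * s j + 1)%N.
  exact: H (esym (Fp_cast pp)).
move=> ->; pose s (j : 'F_p) : 'F_p := - (3%:R * j)^-1; have n3 : 3%:R != 0 :> 'F_p.
  by rewrite -(dvdn_pcharf (pchar_Fp pp)) gtnNdvd.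
exists s => [j|j].
  by rewrite /s mulrN invrN opprK invfM invrK mulKf.
case: ifP => [/eqP j0|/negbT j0].
  have -> : j = 0 :> 'F_p by apply: val_inj.
  by rewrite /s mulr0 invr0 oppr0.
have {}j0 : (j : 'F_p) != 0 by apply: contraNneq j0 => ->.
rewrite (dvdn_pcharf (pchar_Fp pp)) natrD !natrM.
have nz (x : 'F_p) : (val x)%:R = x by rewrite natr_Zp.
by rewrite !nz /s mulrN mulfV ?mulf_neq0// addNr.
Qed.

Section Hecke.
Variable R : realType.
Local Notation C := R[i].
Implicit Types z tau : C.

Section Operator.
Variables (p w : nat) (f fs : C -> C) (lambda : C).
Hypotheses (p_prime : prime p) (p3 : (3 < p)%N).
Hypothesis f_fricke : forall z, 0 < Im z -> f (fricke z) = lambda * z ^+ w.+1 * fs z.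
Hypothesis f_gact : forall a b c d z, 0 < Im z -> a * d - 3 * b * c = 1 ->
  3%:R * c%:~R * z + d%:~R != 0 :> C -> 0 < Im (gact a b c d z) ->
  f (gact a b c d z) = (chz d)%:~R * (3%:R * c%:~R * z + d%:~R) ^+ w.+1 * f z.

(** The Hecke operator T_p of weight w + 1 with the character mod 3. *)
Definition hecke (g : C -> C) z : C :=
  p%:R^-1 * (\sum_(j < p) g ((z + j%:R) / p%:R)) + (chz p)%:~R * p%:R ^+ w * g (p%:R * z).

Let p0 : p%:R != 0 :> C.
Proof. by rewrite pnatr_eq0 -lt0n (leq_trans _ p3). Qed.

Lemma chz_sqr : (chz p)%:~R * (chz p)%:~R = 1 :> C.
Proof.
rewrite -intrM -chzM chz_nat chi3E.
have : (p %% 3 < 3)%N by rewrite ltn_mod.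
case E : (p %% 3)%N => [|[|[|]]] // _; last 2 first.
- by rewrite -modnMm E.
- by rewrite -modnMm E.
have := prime_nt_dvdP p_prime (isT : 3 != 1%N); rewrite /dvdn E => /(_ isT) e.
by move: p3; rewrite -e.
Qed.

(* (-1 / (3 z) + j) / p is the image of -1 / (3 s), for s = (z + j') / p, under the element
   [a, j; 3 j', p] of Gamma_0(3). *)
Lemma hecke_term z (j j' : nat) : 0 < Im z -> (p %| 3 * j * j' + 1)%N ->
  f ((fricke z + j%:R) / p%:R) = (chz p)%:~R * lambda * z ^+ w.+1 * fs ((z + j'%:R) / p%:R).
Proof.
move=> z0 /dvdnP[a ea]; set s := (z + j'%:R) / p%:R.
have s0 : 0 < Im s by rewrite /s Im_divn ?divr_gt0 ?ltr0n ?(leq_trans _ p3)// ImD Im_nat addr0.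
have zn0 := Im_gt0_neq0 z0.
have zj0 : z + j'%:R != 0 by apply: Im_gt0_neq0; rewrite ImD Im_nat addr0.
have n3 : 3%:R != 0 :> C by rewrite pnatr_eq0.
have den : 3%:R * j'%:~R * fricke s + p%:~R = p%:R * z / (z + j'%:R) :> C.
  by rewrite /fricke /s -!pmulrn; field; rewrite p0 zj0.
have eaC : a%:R * p%:R = 3%:R * j%:R * j'%:R + 1 :> C by rewrite -natrM -ea natrD !natrM.
have g : gact a j j' p (fricke s) = (fricke z + j%:R) / p%:R.
  rewrite /gact den -!pmulrn.
  have -> : a%:R * fricke s + j%:R = (3%:R * j%:R * z - 1) / (3%:R * (z + j'%:R)) :> C.
    rewrite /fricke /s; apply: (@mulIf _ (3%:R * (z + j'%:R))); first by rewrite mulf_neq0.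
    rewrite mulfVK ?mulf_neq0//.
    have -> : (a%:R * - (3 * ((z + j'%:R) / p%:R))^-1 + j%:R) * (3 * (z + j'%:R)) =
        - (a%:R * p%:R) + 3%:R * j%:R * (z + j'%:R) :> C by field; rewrite p0 zj0.
    by rewrite eaC; ring.
  by rewrite /fricke; field; rewrite p0 zj0 zn0.
have Ws := Im_fricke_gt0 s0.
rewrite -g f_gact//.
- rewrite den f_fricke// /s; move: (fs _) => u.
  have -> : p%:R * z / (z + j'%:R) = z * ((z + j'%:R) / p%:R)^-1 by field; rewrite p0 zj0.
  have S0 : ((z + j'%:R) / p%:R) ^+ w.+1 != 0 by rewrite expf_neq0 ?mulf_neq0 ?invr_eq0.
  rewrite exprMn exprVn; move: S0.
  by move: (((z + _) / _) ^+ _) (z ^+ _) (chz p)%:~R => S Z e S0; field.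
- rewrite -!PoszM; lia.
- by rewrite den !mulf_neq0 ?invr_eq0.
- by rewrite g Im_divn ?divr_gt0 ?ltr0n ?(leq_trans _ p3)// ImD Im_nat addr0 Im_fricke_gt0.
Qed.

(** The terms with j <> 0 are permuted by [hecke_term]. The term j = 0 and the term at p z change
    places, since fricke(z) / p = fricke(p z) and p fricke(z) = fricke(z / p). *)
Lemma hecke_fricke z : 0 < Im z ->
  hecke f (fricke z) = (chz p)%:~R * lambda * z ^+ w.+1 * hecke fs z.
Proof.
move=> z0; have [s sK sP] := neg_inv3_mod p_prime p3.
have pgt0 : (0 < p)%N by rewrite (leq_trans _ p3).
pose o := Ordinal pgt0; have so : s o = o by apply: val_inj; have := sP o.
have zn0 := Im_gt0_neq0 z0; have n3 : 3%:R != 0 :> C by rewrite pnatr_eq0.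
have pz : 0 < Im (p%:R * z) by rewrite mulrC ImMn mulr_gt0 ?ltr0n.
have zp : 0 < Im (z / p%:R) by rewrite Im_divn divr_gt0 ?ltr0n.
have e1 : fricke z / p%:R = fricke (p%:R * z) by rewrite /fricke; field; rewrite p0 zn0.
have e2 : p%:R * fricke z = fricke (z / p%:R) by rewrite /fricke; field; rewrite p0 zn0.
have S : \sum_(j < p | j != o) f ((fricke z + j%:R) / p%:R) =
    (chz p)%:~R * lambda * z ^+ w.+1 * \sum_(j < p | j != o) fs ((z + j%:R) / p%:R).
  rewrite (reindex_inj (inv_inj sK)) mulr_sumr; apply: eq_big => [j|j jo].
    by rewrite -{1}so (inj_eq (inv_inj sK)).
  apply: hecke_term => //; have := sP j; rewrite ifN; last first.
    by apply: contraNneq jo => e; apply/eqP; rewrite -so; congr s; apply: val_inj.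
  by rewrite mulnAC.
rewrite /hecke (bigD1 o)//= S addr0 e1 e2 !f_fricke// [in RHS](bigD1 o)//= addr0.
move: (\sum_(_ < p | _) _) (fs (p%:R * z)) (fs (z / p%:R)) => U V W.
have := chz_sqr; rewrite exprMn expr_div_n [p%:R ^+ w.+1]exprS.
move: (chz p)%:~R (z ^+ w.+1) => e x e2'.
have pw0 : p%:R ^+ w != 0 :> C by rewrite expf_neq0.
move: (p%:R ^+ w) pw0 => q q0.
have -> : p%:R^-1 * (lambda * (p%:R * q * x) * V + e * lambda * x * U) +
   e * q * (lambda * (x / (p%:R * q)) * W)
   = lambda * x * (q * V + e * (p%:R^-1 * (W + U))) by field; rewrite p0 q0.
have -> : e * lambda * x * (p%:R^-1 * (W + U) + e * q * V) =
  lambda * x * ((e * e) * q * V + e * (p%:R^-1 * (W + U))) by ring.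
by rewrite e2' mul1r.
Qed.
End Operator.
End Hecke.

Section Haupt.
Variable R : realType.
Local Notation C := R[i].
Implicit Types z : C.

Definition haupt z : C := ce z * mf ty z.

Lemma mf_unit_neq0 (f g : fps int) z : f * g = 1 -> conv (cfps R f) -> conv (cfps R g) ->
  0 < Im z -> mf f z != 0.
Proof.
move=> fg cf cg z0; apply/eqP => e; have := mfM z0 cf cg.
by rewrite fg mf1 e mul0r => /eqP; rewrite oner_eq0.
Qed.

Lemma eisB_neq0 z : 0 < Im z -> mf eisB z != 0.
Proof. exact: (mf_unit_neq0 (ps_mulV1 eisB00) (@cv_eisB R) (@cv_eisB_inv R)).
Qed.

Lemma ty_neq0 z : 0 < Im z -> mf ty z != 0.
Proof. exact: (mf_unit_neq0 tyK (@cv_ty R) (@cv_ty_inv R)). Qed.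

Lemma haupt_neq0 z : 0 < Im z -> haupt z != 0.
Proof. by move=> z0; rewrite mulf_neq0 ?ce_neq0 ?ty_neq0. Qed.

Lemma serA2_haupt z : 0 < Im z -> mf (serA 2) z = haupt z * mf eisB z.
Proof.
move=> z0; rewrite serA_eisA -ty_eis !mfM ?mfXn ?mulrA//; try exact: cvXn.
- exact: cv_ty. - exact: cv_eisB. - apply: cvM; [exact: cv_ty|exact: cv_eisB].
Qed.

(** Applying [eisB_fricke] at z and at its image returns to B(z), with A = t B each time, so t(z)
    times t at the image is constant. The 27 comes from (z fricke(z))^3 = -1/27. *)
Lemma haupt_fricke : exists2 kappa : C, kappa != 0 &
  forall z, 0 < Im z -> haupt (fricke z) = kappa / haupt z.
Proof.
have [nu nu0 H] := eisB_fricke R; have n3 : 3%:R != 0 :> C by rewrite pnatr_eq0.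
exists (- 27%:R / nu ^+ 2); first by rewrite mulf_neq0 ?oppr_eq0 ?invr_eq0 ?pnatr_eq0 ?expf_neq0.
move=> z z0; have Wz := Im_fricke_gt0 z0; have zn0 := Im_gt0_neq0 z0.
have h2 := H _ Wz; rewrite frickeK// serA2_haupt// H// serA2_haupt// in h2.
have zW : fricke z = - (3%:R * z)^-1 by [].
have E : 1 = - (nu ^+ 2 / 27%:R) * haupt (fricke z) * haupt z.
  apply: (mulIf (eisB_neq0 z0)); rewrite mul1r {1}h2 {1}zW.
  by move: (haupt _) (haupt z) (mf _ _) => x y b; field.
have t0 := haupt_neq0 z0; apply: (mulIf t0); rewrite mulfVK//.
have -> : haupt (fricke z) * haupt z =
    (- 27%:R / nu ^+ 2) * (- (nu ^+ 2 / 27%:R) * haupt (fricke z) * haupt z).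
  by move: (haupt _) (haupt z) => x y; field.
by rewrite -E mulr1.
Qed.

Opaque mf haupt gact ce.

Lemma haupt_gact (a b c d : int) z : 0 < Im z -> a * d - 3 * b * c = 1 ->
  3%:R * c%:~R * z + d%:~R != 0 :> C -> 0 < Im (gact a b c d z) ->
  haupt (gact a b c d z) = haupt z.
Proof.
move=> z0 det j0 g0; have b0 := eisB_neq0 g0; apply: (mulIf b0).
rewrite -(serA2_haupt g0) (serA2_gact z0 det j0 g0) (eisB_gact z0 det j0 g0).
by rewrite (serA2_haupt z0) mulrCA.
Qed.

Section Forms.
Variable m : nat.

Transparent haupt.
Definition fform z : C := mf eisC z / haupt z ^+ m.
(** The image of [fform] under the Fricke involution, up to a constant and the factor z^5, see
    [fform_fricke]. *)
Definition fstar z : C := mf (serA 4) z * haupt z ^+ m.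

Lemma fform_gact (a b c d : int) z : 0 < Im z -> a * d - 3 * b * c = 1 ->
  3%:R * c%:~R * z + d%:~R != 0 :> C -> 0 < Im (gact a b c d z) ->
  fform (gact a b c d z) = (chz d)%:~R * (3%:R * c%:~R * z + d%:~R) ^+ 5 * fform z.
Proof.
by move=> z0 det j0 g0; rewrite /fform (haupt_gact z0 det j0 g0) (eisC_gact z0 det j0 g0) [RHS]mulrA.
Qed.

Lemma fform_q z : 0 < Im z -> fform z * ce z ^+ m = mf (eisC * ty_inv ^+ m) z.
Proof.
move=> z0; rewrite mfM ?mfX//; [|exact: cv_ty_inv|exact: cv_eisC|exact/cvX/cv_ty_inv].
have : mf ty z * mf ty_inv z = 1 :> C by rewrite -mfM ?tyK ?mf1//; [exact: cv_ty|exact: cv_ty_inv].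
move/(congr1 (fun x => x ^+ m)); rewrite expr1n exprMn /fform /haupt exprMn => h.
have t0 := ty_neq0 z0; have c0 := ce_neq0 z.
have tm : mf ty z ^+ m != 0 :> C by rewrite expf_neq0.
have cm : ce z ^+ m != 0 :> C by rewrite expf_neq0.
move: h tm cm; move: (mf ty_inv z ^+ m) (mf ty z ^+ m) (ce z ^+ m) => v t q h tm cm.
have -> : v = t^-1 by apply: (mulfI tm); rewrite h divff.
by field; rewrite tm cm.
Qed.

Lemma fstar_q z : 0 < Im z -> fstar z = ce z ^+ m * mf (serA 4 * ty ^+ m) z.
Proof.
move=> z0; rewrite mfM ?mfX//; [|exact: cv_ty|exact: cv_serA|exact/cvX/cv_ty].
by rewrite /fstar /haupt exprMn; ring.
Qed.

End Forms.
End Haupt.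

(** * The vanishing form *)

Section Vanishing.
Variable R : realType.
Local Notation C := R[i].
Implicit Types z : C.
Local Opaque mf haupt gact ce.
Variables (p r : nat).
Hypotheses (p_prime : prime p) (p3 : (3 < p)%N).
Variable c : nat -> int.

Let m := (r * p)%N.
Let K := (m * p)%N.
Let N := (K - r)%N.
Let eps : int := chz p * p%:Z ^+ 4.

Let p_gt0 : (0 < p)%N := leq_trans (isT : 0 < 4)%N p3.
Let rK : (r <= K)%N.
Proof. by rewrite /K /m -mulnA leq_pmulr// muln_gt0 p_gt0. Qed.
Let KN : K = (N + r)%N.
Proof. by rewrite subnK. Qed.

Definition hser : fps int := eisC * ty_inv ^+ m.
Definition hstar : fps int := serA 4 * ty ^+ m.

(** The expansion of q^K D. The U_p part of the Hecke image has a pole of order r and receives the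
    factor q^N, the V_p part has one of order K and receives none. The index i stands for C / t^(K -
    i), so the exponents of t run from K down to r. *)
Definition dser : fps int :=
  fpsX int N * fps_Lam p hser + fpsC eps * fps_V p hser
  - \sum_(i < N.+1) fpsC (c i) * (fpsX int i * (eisC * ty_inv ^+ (K - i))).

Lemma cvC (a : int) (f : fps int) : conv (cfps R f) -> conv (cfps R (fpsC a * f)).
Proof. by move=> cf; rewrite cfpsC; exact: convC. Qed.

Lemma cfps_sub (f g : fps int) : cfps R (f - g) = cfps R f - cfps R g.
Proof. by rewrite cfpsD cfpsN. Qed.

Lemma cv_hser : conv (cfps R hser).
Proof. apply: cvM; [exact: cv_eisC|exact/cvX/cv_ty_inv]. Qed.

Lemma cfps_Lam (f : fps int) : cfps R (fps_Lam p f) = fps_Lam p (cfps R f).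
Proof. by []. Qed.

Lemma cfps_V (f : fps int) : cfps R (fps_V p f) = fps_V p (cfps R f).
Proof. by apply/funext => n; rewrite /cfps /fps_V; case: ifP. Qed.

Lemma cv_Lam (f : fps int) : conv (cfps R f) -> conv (cfps R (fps_Lam p f)).
Proof. by move=> cf; rewrite cfps_Lam; exact: conv_Lam p_gt0 cf. Qed.

Lemma cv_V (f : fps int) : conv (cfps R f) -> conv (cfps R (fps_V p f)).
Proof. by move=> cf; rewrite cfps_V; exact: conv_V p_gt0 cf. Qed.

Definition mfsum z : C :=
  \sum_(i < N.+1) (c i)%:~R * fform (K - i) z.

Definition mfsum_star (kappa : C) z : C :=
  \sum_(i < N.+1) (c i)%:~R * kappa ^- (K - i) * fstar (K - i) z.

Lemma ce_shift z (j k : nat) : ce ((z + j%:R) / p%:R) ^+ (k * p) = ce z ^+ k.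
Proof.
rewrite mulnC exprM -ceMn mulfVK ?pnatr_eq0 -?lt0n// ceD.
by rewrite ce_nat mulr1.
Qed.

Lemma Im_shift z (j : nat) : 0 < Im z -> 0 < Im ((z + j%:R) / p%:R).
Proof. by move=> z0; rewrite Im_divn ImD Im_nat addr0 divr_gt0// ltr0n. Qed.

Lemma Im_scale z : 0 < Im z -> 0 < Im (p%:R * z).
Proof. by move=> z0; rewrite mulrC ImMn mulr_gt0// ltr0n. Qed.

Lemma mf_Lam (f : fps int) z : 0 < Im z -> conv (cfps R f) ->
  p%:R^-1 * \sum_(j < p) mf f ((z + j%:R) / p%:R) = mf (fps_Lam p f) z.
Proof.
move=> z0 cf; apply: (mulfI (_ : p%:R != 0 :> C)); first by rewrite pnatr_eq0 -lt0n.
rewrite mulVKf ?pnatr_eq0 -?lt0n//.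
have := ev_Lam cf z0 p_gt0; rewrite -cfps_Lam.
by under eq_bigr do rewrite -mfE; rewrite -mfE.
Qed.

Lemma mf_V (f : fps int) z : 0 < Im z -> conv (cfps R f) -> mf (fps_V p f) z = mf f (p%:R * z).
Proof.
move=> z0 cf; rewrite !mfE cfps_V (ev_V p_gt0 cf (normc_ce_lt1 z0)).
by rewrite mulrC ceMn.
Qed.

Lemma hser_q z : 0 < Im z -> mf hser z = fform m z * ce z ^+ m.
Proof. by move=> z0; rewrite fform_q. Qed.

Lemma hecke_fform z : 0 < Im z ->
  hecke p 4 (fform m) z * ce z ^+ K = mf (fpsX int N * fps_Lam p hser + fpsC eps * fps_V p hser) z.
Proof.
move=> z0; rewrite /hecke mulrDl.
have q0 := ce_neq0 z.
have -> : mf (fpsX int N * fps_Lam p hser + fpsC eps * fps_V p hser) z =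
    ce z ^+ N * mf (fps_Lam p hser) z + eps%:~R * mf (fps_V p hser) z.
  have cL : conv (cfps R (fps_Lam p hser)) by exact: cv_Lam cv_hser.
  have cV : conv (cfps R (fps_V p hser)) by exact: cv_V cv_hser.
  have z1 := normc_ce_lt1 z0.
  rewrite !mfE cfpsD cfpsC cfpsM cfpsXn evD//; [|apply: convM => //; exact: convX|exact: convC].
  by rewrite evM ?evXn ?evCM//; exact: convX.
congr (_ + _).
- rewrite -(mf_Lam z0 cv_hser) KN exprD mulrC -!mulrA; congr (_ * _).
  rewrite mulrCA; congr (_ * _); rewrite mulr_sumr; apply: eq_bigr => j _.
  rewrite (hser_q (Im_shift j z0)).
  by rewrite mulrC; congr (_ * _); exact: esym (ce_shift z j r).
- rewrite (mf_V z0 cv_hser) (hser_q (Im_scale z0)) /eps intrM rmorphXn /=.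
  rewrite [p%:R * z]mulrC ceMn -exprM [(p * m)%N]mulnC -!mulrA; congr (_ * _).
Qed.

Let cT i : conv (cfps R (fpsX int i * (eisC * ty_inv ^+ (K - i)))).
Proof. by apply: cvM; [exact: cvXn|apply: cvM; [exact: cv_eisC|exact/cvX/cv_ty_inv]]. Qed.

Let cS : conv (cfps R (\sum_(i < N.+1) fpsC (c i) * (fpsX int i * (eisC * ty_inv ^+ (K - i))))).
Proof. by rewrite cfps_sum; apply: conv_sum => i; exact: cvC. Qed.

Let cH : conv (cfps R (fpsX int N * fps_Lam p hser + fpsC eps * fps_V p hser)).
Proof.
rewrite cfpsD; apply: convD; first exact: cvM (@cvXn R N) (cv_Lam cv_hser).
exact: cvC (cv_V cv_hser).
Qed.

Lemma cv_dser : conv (cfps R dser).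
Proof. by rewrite /dser cfps_sub; apply: convD => //; exact: convN. Qed.

Lemma dser_q z : 0 < Im z -> (hecke p 4 (fform m) z - mfsum z) * ce z ^+ K = mf dser z.
Proof.
move=> z0; rewrite mulrBl hecke_fform// /dser; have z1 := normc_ce_lt1 z0.
have cf := cH; set f : fps int := fpsX int N * _ + _ in cf *.
have -> : mf (f - \sum_(i < N.+1) fpsC (c i) * (fpsX int i * (eisC * ty_inv ^+ (K - i)))) z
   = mf f z - mf (\sum_(i < N.+1) fpsC (c i) * (fpsX int i * (eisC * ty_inv ^+ (K - i)))) z.
  rewrite !mfE cfps_sub; move: (cfps R f) cf (cfps R _) cS => a ca b cb.
  have -> : a - b = a + fpsC (-1) * b by congr (_ + _); apply/funext => n; rewrite fpsCM mulN1r.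
  by rewrite evD ?evCM ?mulN1r//; exact: convC.
congr (_ - _); rewrite /mfsum mulr_suml.
rewrite !mfE cfps_sum ev_sum//; last by move=> i; exact: cvC.
apply: eq_bigr => i _; rewrite cfpsC evCM// -mulrA; congr (_ * _).
rewrite -mfE.
rewrite mfM//; [|exact: cvXn|apply: cvM; [exact: cv_eisC|exact/cvX/cv_ty_inv]].
have iK : (i <= K)%N by rewrite (leq_trans (ltn_ord i : i <= N)%N) ?leq_subr.
have e : ce z ^+ K = ce z ^+ (K - i) * ce z ^+ i by rewrite -exprD subnK.
by rewrite mfXn -(fform_q (K - i) z0) e [RHS]mulrC; exact: mulrA.
Qed.

End Vanishing.

Lemma fpsXnM_low (A : comNzRingType) (r k j : nat) (f : fps A) :
  (r <= k)%N -> f 0%N = 0 -> (j <= r)%N -> (fpsX A k * f) j = 0.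
Proof.
move=> rk f0 jr; rewrite fpsXnM; case: leqP => // kj.
by rewrite (_ : (j - k)%N = 0%N) //; lia.
Qed.

Section Star.
Variable R : realType.
Local Notation C := R[i].
Implicit Types z : C.
Local Opaque mf haupt gact ce fricke.
Variables (p r : nat).
Hypotheses (p_prime : prime p) (p3 : (3 < p)%N).
Variable c : nat -> int.
Variables (kappa mu : C).
Hypothesis hauptW : forall z, 0 < Im z -> haupt (fricke z) = kappa / haupt z.
Hypothesis eisCW : forall z, 0 < Im z -> mf eisC (fricke z) = mu * z ^+ 5 * mf (serA 4) z.

Let m := (r * p)%N.
Let K := (m * p)%N.
Let N := (K - r)%N.
Let eps : int := chz p * p%:Z ^+ 4.
Local Notation hs := (hstar p r).

Let p_gt0 : (0 < p)%N := leq_trans (isT : 0 < 4)%N p3.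
Let rK : (r <= K)%N.
Proof. by rewrite /K /m -mulnA leq_pmulr// muln_gt0 p_gt0. Qed.

Definition dform z : C := hecke p 4 (fform m) z - mfsum p r c z.

Definition dform_star z : C :=
  (chz p)%:~R * kappa ^- m * hecke p 4 (fstar m) z - mfsum_star p r c kappa z.

Lemma fform_fricke k z : 0 < Im z -> fform k (fricke z) = mu * kappa ^- k * z ^+ 5 * fstar k z.
Proof.
move=> z0; rewrite /fform /fstar (hauptW z0) (eisCW z0) expr_div_n invf_div.
by move: (haupt z ^+ k) (mf _ _) (z ^+ 5) (kappa ^+ k) => t a b e; ring.
Qed.

Lemma dform_fricke z : 0 < Im z -> dform (fricke z) = mu * z ^+ 5 * dform_star z.
Proof.
move=> z0; rewrite /dform /dform_star mulrBr.
rewrite (hecke_fricke p_prime p3 (fun w w0 => fform_fricke m w0) (@fform_gact R m) z0).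
congr (_ - _).
  by move: (hecke _ _ _ _) => u; rewrite -!exprVn; ring.
rewrite /mfsum /mfsum_star mulr_sumr; apply: eq_bigr => i _.
rewrite fform_fricke//; ring.
Qed.

(** The expansion of D*, in which no negative power of q occurs. Its coefficients are complex
    because of the powers of [kappa]. *)
Definition dstar : fps C :=
  fpsC ((chz p)%:~R * kappa ^- m) *
    (fpsX C r * cfps R (fps_Lam p hs) + fpsC eps%:~R * (fpsX C K * cfps R (fps_V p hs)))
  - \sum_(i < N.+1) fpsC ((c i)%:~R * kappa ^- (K - i)%N) *
      (fpsX C (K - i)%N * cfps R (serA 4 * ty ^+ (K - i))).

Lemma cv_star k : conv (cfps R (serA 4 * ty ^+ k)).
Proof. by apply: cvM; [exact: cv_serA|exact/cvX/cv_ty]. Qed.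

Lemma cv_XC k (f : fps C) : conv f -> conv (fpsX C k * f).
Proof. by move=> cf; apply: convM => //; exact: convX. Qed.

Let cL : conv (cfps R (fps_Lam p hs)) := cv_Lam p3 (cv_star m).
Let cV : conv (cfps R (fps_V p hs)) := cv_V p3 (cv_star m).

Lemma evB (f g : fps C) x : conv f -> conv g -> normc x < 1 -> ev (f - g) x = ev f x - ev g x.
Proof.
move=> cf cg x1; have -> : f - g = f + fpsC (-1) * g.
  by congr (_ + _); apply/funext => n; rewrite fpsCM mulN1r.
by rewrite evD ?evCM ?mulN1r//; exact: convC.
Qed.

Let cH : conv (fpsX C r * cfps R (fps_Lam p hs) +
  fpsC eps%:~R * (fpsX C K * cfps R (fps_V p hs))).
Proof. by apply: convD; [exact: cv_XC|apply/convC/cv_XC]. Qed.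

Let cT (i : nat) : conv (fpsC ((c i)%:~R * kappa ^- (K - i)%N) *
      (fpsX C (K - i)%N * cfps R (serA 4 * ty ^+ (K - i)))).
Proof. exact/convC/cv_XC/cv_star. Qed.

Lemma conv_dstar : conv dstar.
Proof. by apply: convD; [exact: convC|apply/convN/conv_sum]. Qed.

Lemma hstar_q z : 0 < Im z -> fstar m z = ce z ^+ m * mf hs z.
Proof. exact: fstar_q. Qed.

Lemma dstar_q z : 0 < Im z -> dform_star z = ev dstar (ce z).
Proof.
move=> z0; have z1 := normc_ce_lt1 z0.
rewrite /dform_star /dstar evB//; [|exact: convC|exact: conv_sum].
congr (_ - _).
  rewrite evCM//; congr (_ * _); rewrite evD//; [|exact: cv_XC|exact/convC/cv_XC].
  rewrite evCM//; last exact: cv_XC.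
  rewrite (evM (convX _) cL z1) (evM (convX _) cV z1) !evXn -!mfE /hecke; congr (_ + _).
    rewrite -(mf_Lam p3 z0 (cv_star m)) mulrCA; congr (_ * _); rewrite mulr_sumr.
    apply: eq_bigr => j _; rewrite (hstar_q (Im_shift p3 j z0)); congr (_ * _).
    exact: ce_shift.
  rewrite (mf_V p3 z0 (cv_star m)) (hstar_q (Im_scale p3 z0)) /eps intrM rmorphXn /=.
  by congr (_ * (_ * _)); rewrite [p%:R * z]mulrC ceMn -exprM mulnC.
rewrite /mfsum_star ev_sum//; apply: eq_bigr => i _.
rewrite evCM//; last exact/cv_XC/cv_star.
by rewrite (evM (convX _) (cv_star _) z1) evXn -mfE -fstar_q.
Qed.

(** Every summand has a factor q^k with k >= r, and [serA 4] has no constant term, which gains one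
    more order. *)
Lemma dstar_low j : (j <= r)%N -> dstar j = 0.
Proof.
move=> jr; have s0 k : (cfps R (serA 4 * ty ^+ k)) 0%N = 0.
  by rewrite /cfps fpsM0 serA0 mul0r.
rewrite /dstar fpsB fpsCM fpsD fpsCM !(@fpsXnM_low _ r)//; last 2 first.
- by rewrite /cfps /fps_V dvdn0 div0n; exact: s0.
- exact: s0.
rewrite mulr0 addr0 mulr0 sub0r fps_sum big1 ?oppr0// => i _.
rewrite fpsCM (@fpsXnM_low _ r) ?mulr0//.
by rewrite -{1}(subKn rK) leq_sub2l// -ltnS ltn_ord.
Qed.
End Star.

Section Identity.
Variable R : realType.
Local Notation C := R[i].
Implicit Types z : C.
Local Opaque mf haupt gact ce fricke.

Lemma conv_shift k (f : fps C) : conv f -> conv (fun n => f (n + k)%N).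
Proof.
move=> cf r r0 r1; have [M HM] := cf r r0 r1; exists (M / r ^+ k) => n.
by rewrite ler_pdivlMr ?exprn_gt0// -mulrA -exprD.
Qed.

Lemma fps_exp_eq0 (f : fps C) k : f ^+ k = 0 -> f = 0.
Proof.
elim: k => [|k IH]; last by rewrite exprS => /fps_mul_eq0[].
by rewrite expr0 => /eqP; rewrite oner_eq0.
Qed.

Lemma cfps_eq0 (f : fps int) : cfps R f = 0 -> f = 0.
Proof.
move=> h; apply/funext => n; have := congr1 (fun g : fps C => g n) h.
by move/eqP; rewrite /cfps intr_eq0 => /eqP.
Qed.

Lemma dser_eq0 p r c : prime p -> (3 < p)%N ->
  (forall j, (j <= r * p * p - r)%N -> dser p r c j = 0) -> dser p r c = 0.
Proof.
move=> pp p3 low; set N := (r * p * p - r)%N in low.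
have [kappa kappa0 hW] := haupt_fricke R; have [mu mu0 cW] := eisC_fricke R.
have [nu nu0 bW] := eisB_fricke R.
pose D := @dform R p r c; pose Ds := @dform_star R p r c kappa.
have DW z : 0 < Im z -> D (fricke z) = mu * z ^+ 5 * Ds z.
  by move=> z0; apply: dform_fricke.
have rK : (r <= r * p * p)%N by rewrite -mulnA leq_pmulr// muln_gt0 (leq_trans _ p3).
pose a (z : C) := mf (serA 2) z; pose b (z : C) := mf eisB z.
pose d : fps C := cfps R (dser p r c); pose ds := @dstar R p r c kappa.
have cds : conv ds by exact: conv_dstar.
have cd : conv d by exact: cv_dser.
pose d1 : fps C := fun n => d (n + N.+1)%N; pose ds1 : fps C := fun n => ds (n + r.+1)%N.
have dE : d = fpsX C N.+1 * d1 by apply: fps_shiftE => j jN; rewrite /d /cfps low.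
have dsE : ds = fpsX C r.+1 * ds1 by apply: fps_shiftE => j jr; exact: dstar_low.
have cd1 : conv d1 by exact: conv_shift.
have cds1 : conv ds1 by exact: conv_shift.
(* The formal inverses converge on the disc, so the quotient by (A B)^5 is itself a convergent power
   series, as [fricke_invariant_eq0] demands. *)
pose uinv : fps int := (ps_inv eisA : fps int) * ps_inv eisB.
have cu : conv (cfps R uinv) by apply: cvM; [exact: cv_eisA_inv|exact: cv_eisB_inv].
have uK : eisA * eisB * uinv = 1.
  by rewrite mulrACA (ps_mulV1 eisA0) (ps_mulV1 eisB00) mulr1.
pose k : fps C := fpsX C 1 * ((d1 * ds1) ^+ 3 * cfps R uinv ^+ 5).
have cdd : conv ((d1 * ds1) ^+ 3) by apply: conv_expr; exact: convM.
have cu5 : conv (cfps R uinv ^+ 5) by exact: conv_expr.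
have ck : conv k by apply: convM; [exact: convX|exact: convM].
have ab0 z : 0 < Im z -> a z * b z != 0.
  move=> z0; rewrite /a (serA2_haupt z0); apply: mulf_neq0; last exact: eisB_neq0.
  by apply: mulf_neq0; [exact: haupt_neq0|exact: eisB_neq0].
(* k has weight 3 * (5 + 5) - 5 * (3 + 3) = 0 and is invariant under the Fricke involution,
   and the factor q that is left makes it vanish at the cusp. *)
have kE z : 0 < Im z -> ev k (ce z) = (D z * Ds z) ^+ 3 / (a z * b z) ^+ 5.
  move=> z0; have z1 := normc_ce_lt1 z0; have q0 := ce_neq0 z.
  have e1 : D z * ce z ^+ r = ce z * ev d1 (ce z).
    apply: (@mulIf _ (ce z ^+ N)); first by rewrite expf_neq0.
    rewrite -mulrA -exprD addnC subnK// (@dser_q R p r p3 c z z0) mfE -/d dE.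
    rewrite evM//; last exact: convX.
    by rewrite evXn exprS; ring.
  have e2 : Ds z = ce z ^+ r.+1 * ev ds1 (ce z).
    by rewrite /Ds dstar_q// -/ds dsE evM ?evXn//; exact: convX.
  have e3 : a z * b z * mf uinv z = ce z.
    have h : fpsX int 1 = serA 2 * eisB * uinv.
      by rewrite serA_eisA -!mulrA [eisA * (eisB * uinv)]mulrA uK mulr1.
    rewrite -[RHS]expr1 -mfXn h mfM//; last by apply: cvM; [exact: cv_serA|exact: cv_eisB].
    by rewrite mfM//; [exact: cv_serA|exact: cv_eisB].
  rewrite /k evM//; [|exact: convX|exact: convM].
  rewrite evM// evX//; last exact: convM.
  rewrite evM// evX// evXn expr1 -mfE.
  have -> : D z * Ds z = ce z ^+ 2 * (ev d1 (ce z) * ev ds1 (ce z)).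
    by rewrite e2 exprS mulrA mulrA -[D z * ce z * _]mulrAC e1; ring.
  have := ab0 z z0; rewrite -e3 in q0 *.
  move: (a z * b z) (mf uinv z) (ev d1 _) (ev ds1 _) => x y u v x0.
  by field.
have Wfix z : 0 < Im z -> ev k (ce (fricke z)) = ev k (ce z).
  move=> z0; have W0 := Im_fricke_gt0 z0; rewrite (kE _ z0) (kE _ W0).
  have zn0 := Im_gt0_neq0 z0; have Wn0 := Im_gt0_neq0 W0.
  have h1 := DW _ z0; have h2 : D z = mu * fricke z ^+ 5 * Ds (fricke z).
    by rewrite -(DW _ W0) (frickeK zn0).
  have h3 : b (fricke z) = nu * z ^+ 3 * a z := bW _ z0.
  have h4 : b z = nu * fricke z ^+ 3 * a (fricke z).
    by rewrite /a -(bW _ W0) (frickeK zn0).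
  have a0 y : 0 < Im y -> a y != 0.
    by move=> y0; move: (ab0 _ y0); rewrite mulf_eq0 negb_or => /andP[].
  rewrite h1 h2 h3 h4; have := a0 _ z0; have := a0 _ W0; move: Wn0.
  move: (a (fricke z)) (a z) (Ds (fricke z)) (Ds z) (fricke z) => v u y x w w0 v0 u0.
  by field; rewrite v0 w0 nu0 u0 zn0.
have k0 : k 0%N = 0 by rewrite /k fpsXnM.
have /(fricke_invariant_eq0 ck k0) := Wfix.
rewrite /k => kz; have : (d1 * ds1) ^+ 3 * cfps R uinv ^+ 5 = 0.
  by apply: (@fpsXn_inj _ 1); rewrite kz mulr0.
(* Series over a field have no zero divisors, so D, D* or the inverse of A B vanishes, and the last
   is impossible. *)
case/fps_mul_eq0 => [/fps_exp_eq0 /fps_mul_eq0[] e|/fps_exp_eq0 /cfps_eq0 e].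
- by apply: cfps_eq0; rewrite -/d dE e mulr0.
(* The vanishing of D* passes to D as functions, through the Fricke involution, and then to the
   coefficients by [ev_eq0]. *)
- have ds0 : ds = 0 by rewrite dsE e mulr0.
  have Ds0 z : 0 < Im z -> Ds z = 0 by move=> z0; rewrite /Ds dstar_q// -/ds ds0 ev0.
  have D0 z : 0 < Im z -> D z = 0.
    move=> z0; rewrite -(frickeK (Im_gt0_neq0 z0)) DW ?Ds0 ?mulr0//; exact: Im_fricke_gt0.
  apply: cfps_eq0; apply: (ev_eq0 cd) => z z0.
  have E : D z * ce z ^+ (r * p * p) = mf (dser p r c) z := @dser_q R p r p3 c z z0.
  by rewrite -mfE -E D0 ?mul0r.
- by move: uK; rewrite e mulr0 => /eqP; rewrite eq_sym oner_eq0.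
Qed.
End Identity.

(** * The congruence *)

From Stdlib Require Rdefinitions.
From mathcomp Require Import Rstruct.

Section Triangular.
Variable u : nat -> fps int.
Hypothesis u0 : forall i, u i 0%N = 1.

Definition trisum (c : nat -> int) n : fps int := \sum_(i < n) fpsC (c i) * (fpsX int i * u i).

Lemma trisumE c n j : trisum c n j = \sum_(i < n) c i * (if (i <= j)%N then u i (j - i)%N else 0).
Proof. by rewrite /trisum fps_sum; apply: eq_bigr => i _; rewrite fpsCM fpsXnM. Qed.

(** The series q^i u_i form a unitriangular system, so the coefficients are found one after another
    without division. Their integrality is what makes the reduction mod p^4 meaningful. *)
Lemma trisum_exists (g : fps int) n : exists c, forall j, (j < n)%N -> (g - trisum c n) j = 0.
Proof.
elim: n => [|n [c IH]]; first by exists (fun=> 0).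
exists (fun i => if i == n then (g - trisum c n) n else c i) => j.
rewrite fpsB trisumE big_ord_recr /= eqxx.
rewrite (eq_bigr (fun i : 'I_n => c i * if (i <= j)%N then u i (j - i)%N else 0)); last first.
  by move=> i _; rewrite ltn_eqF.
rewrite -trisumE ltnS leq_eqVlt => /orP[/eqP->|jn]; first by rewrite leqnn subnn u0 fpsB; ring.
by rewrite leqNgt jn /= mulr0 addr0 -fpsB IH.
Qed.

(** Below degree n the left series vanishes, so by induction M divides c_i for i < n. In degree n
    both leading coefficients are 1, which forces c_n = 1 mod M. *)
Lemma trisum_dvd (M : int) (g : fps int) c n : g 0%N = 1 ->
  (forall j, (M %| (fpsX int n * g - trisum c n.+1) j)%Z) -> forall j, (M %| (g - u n) j)%Z.
Proof.
move=> g0 H; have Hlt i : (i < n)%N -> (M %| c i)%Z.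
  elim/ltn_ind: i => i IH iN; have := H i.
  rewrite fpsB fpsXnM leqNgt iN /= sub0r rpredN trisumE.
  rewrite (bigD1 (Ordinal (ltnW iN : i < n.+1)%N))//= leqnn subnn u0 mulr1 rpredDr//.
  apply: rpred_sum => k; rewrite -val_eqE /= => ki; case: ifP => kl; last by rewrite mulr0 dvdz0.
  have {ki kl}ki : (k < i)%N by rewrite ltn_neqAle ki.
  by rewrite dvdz_mulr// (IH _ ki)// (ltn_trans ki).
have Hn j : (M %| g j - c n * u n j)%Z.
  have := H (n + j)%N; rewrite fpsB fpsXnM leq_addr addKn trisumE big_ord_recr /= leq_addr addKn.
  rewrite opprD addrCA rpredDl// rpredN; apply: rpred_sum => k _.
  by rewrite dvdz_mulr// Hlt.
move=> j; have := Hn 0%N; rewrite g0 u0 mulr1 => h.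
rewrite fpsB (_ : _ - _ = (g j - c n * u n j) - (1 - c n) * u n j); last by ring.
by rewrite rpredB// dvdz_mulr.
Qed.
End Triangular.

Lemma eisC0 : eisC 0%N = 1.
Proof. by rewrite /eisC fpsD fps1 fps_natM serB0. Qed.

Lemma eisC_ty_inv0 k : (eisC * ty_inv ^+ k) 0%N = 1.
Proof. by rewrite fpsM0 fpsX0 eisC0 ty_inv0 expr1n mulr1. Qed.

Lemma Lam_congr p r j : prime p -> (3 < p)%N ->
  (p%:Z ^+ 4 %| (fps_Lam p (eisC * ty_inv ^+ (r * p)) - eisC * ty_inv ^+ r) j)%Z.
Proof.
move=> pp p3; pose K := (r * p * p)%N; pose N := (K - r)%N.
have rK : (r <= K)%N by rewrite /K -mulnA leq_pmulr// muln_gt0 (leq_trans _ p3).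
pose u i := eisC * ty_inv ^+ (K - i).
pose g := fpsX int N * fps_Lam p (hser p r) + fpsC (chz p * p%:Z ^+ 4) * fps_V p (hser p r).
have u0 i : u i 0%N = 1 by exact: eisC_ty_inv0.
have [c Hc] := trisum_exists u0 g N.+1.
(* The analysis holds over any [realType], and an identity between integral series needs only one
   model. *)
have d0 : dser p r c = 0 by apply: (@dser_eq0 Rdefinitions.R) => // i iN; exact: Hc.
have -> : eisC * ty_inv ^+ r = u N by rewrite /u subKn.
apply: (trisum_dvd u0 (c := c)); first exact: eisC_ty_inv0.
(* What remains of the exact identity is the V_p part, which carries the factor p^4. *)
move=> i; have -> : fpsX int N * fps_Lam p (eisC * ty_inv ^+ (r * p)) - trisum u c N.+1 =
    dser p r c - fpsC (chz p * p%:Z ^+ 4) * fps_V p (hser p r).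
  by rewrite /dser -/K -/N addrAC addrK.
by rewrite d0 sub0r fpsN rpredN fpsCM -mulrA dvdz_mull// dvdz_mulr.
Qed.

Lemma l_exp_t k : l_exp t k = Laurent k%:Z (ty ^+ k).
Proof.
elim: k => [|k IH] //; rewrite /l_exp iterS -/(l_exp t k) IH /l_mul /= exprS.
by congr Laurent; rewrite -intS.
Qed.

Lemma ps_inv_tyX k : ps_inv (ty ^+ k) = ty_inv ^+ k :> fps int.
Proof.
have e : (ty ^+ k) 0%N = 1 by rewrite fpsX0 ty0 expr1n.
have h : ty_inv ^+ k * ty ^+ k = 1 by rewrite -exprMn [ty_inv * _]mulrC tyK expr1n.
transitivity (ty_inv ^+ k * ty ^+ k * (ps_inv (ty ^+ k) : fps int)); first by rewrite h mul1r.
by rewrite -mulrA (ps_mulV1 e) mulr1.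
Qed.

Lemma l_ser_C : l_ser C = eisC.
Proof.
apply/funext => -[|n] /=; first by rewrite eisC0.
by rewrite /c_ /eisC fpsD fps1 fps_natM add0r /serB -lam_divisors.
Qed.

Lemma l_coef_divCt k n : l_coef (l_div C (l_exp t k)) n =
  if - k%:Z <= n then (eisC * ty_inv ^+ k) (absz (n + k%:Z)) else 0.
Proof.
rewrite l_exp_t /l_coef /= add0r opprK; case: ifP => // _.
by rewrite (ps_inv_tyX k) -l_ser_C.
Qed.

Lemma in_pZloc_int p k (y : int) : prime p -> (p%:Z ^+ k %| y)%Z -> in_pZloc p k y%:~R.
Proof.
move=> pp /dvdzP[x ->]; exists x%:~R; last by rewrite mulrC intrM rmorphXn.
by rewrite /in_Zloc denq_int dvdz1 absz_nat neq_ltn prime_gt1 ?orbT.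
Qed.

Lemma F_dvd p r n : prime p -> (3 < p)%N -> (p%:Z ^+ 4 %| l_coef (F p r) n)%Z.
Proof.
move=> pp p3; have p0 : (0 < p)%N by rewrite (leq_trans _ p3).
rewrite /F l_coef_sub l_coef_Lambda// !l_coef_divCt PoszM -mulNr ler_pM2r ?ltz_nat//.
case: ifP => h; last by rewrite subrr dvdz0.
have [j ->] : exists j : nat, n = j%:Z - r%:Z by exists (absz (n + r%:Z)); lia.
rewrite -mulrDl subrK -PoszM !absz_nat; exact: Lam_congr.
Qed.

Theorem theorem7p3 (p : nat) (p_prime : prime p) (p_ge5 : (5 <= p)%N) :
  (forall r : nat, r \in [:: 1; 2; 3]%N -> l_cong p 4 (F p r) (l_zero int))
  /\ ((forall r : nat, r \in [:: 1; 2; 3]%N ->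
         l_cong p 4 (F p r) (l_zero int))
      <-> (forall r s : nat, (1 <= s <= r)%N -> (r <= 3)%N ->
             in_pZloc p 4 ((delta p r s)%:~R%R))).
Proof.
have H r n : in_pZloc p 4 (l_coef (F p r) n)%:~R.
  by apply: in_pZloc_int => //; apply: F_dvd; rewrite // ltnW.
have Hc r : l_cong p 4 (F p r) (l_zero int).
  by move=> n; rewrite (_ : l_coef (l_zero int) n = 0) ?subr0// /l_coef; case: ifP.
by split=> [r _|]; [exact: Hc|split=> [_ r s _ _|_ r _]; [exact: H|exact: Hc]].
Qed.
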